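(* Let $s>\frac32$. The flow map (initial data $\mapsto$ solution) of the Cauchy problem $$i\partial_t u-\partial_x^2u-iuv\,\partial_xu=0,\qquad i\partial_t v+\partial_x^2v-iuv\,\partial_xv=0,\qquad (u,v)|_{t=0}=(u_0,v_0)\qquad(\ast)$$ on $\mathbb T$ is discontinuous at every point $(u_0,v_0)\in\mathcal H^s(\mathbb T)$. Specifically, for any $(u_0,v_0)\in\mathcal H^s(\mathbb T)$ there exists a sequence $\{(u_{0,n},v_{0,n})\}_{n\in\mathbb N}\subset\mathcal H^s(\mathbb T)$ converging to $(u_0,v_0)$ in $\mathcal H^s(\mathbb T)$ such that, for every $n\in\mathbb N$ and every $T>0$, there is no solution $(u_n,v_n)$ to $(\ast)$ in $\mathcal H^s(\mathbb T)$ on $[0,T]$ with initial data $(u_{0,n},v_{0,n})$, and there is no such solution on $[-T,0]$.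
   Context: $\mathbb T=\mathbb R/2\pi\mathbb Z$; $u,v$ are $\mathbb C$-valued functions. $\int_{\mathbb T}f\,dx:=\frac1{2\pi}\int_{-\pi}^{\pi}f(x)\,dx$ and $\widehat f(k)=\int_{\mathbb T}f(x)e^{-ikx}dx$ for $k\in\mathbb Z$. $H^s(\mathbb T)$ is the $L^2$-based Sobolev space of $\mathbb C$-valued functions with norm $\|f\|_{H^s}=(\sum_{k\in\mathbb Z}(1+|k|^2)^{s}|\widehat f(k)|^2)^{1/2}$. $\mathcal H^s(\mathbb T):=H^s(\mathbb T)\times H^s(\mathbb T)$ with norm $\|(f,g)\|_{\mathcal H^s}=\|f\|_{H^s}+\|g\|_{H^s}$. Definition of solution. Let $s>\frac32$, $T>0$, $(u_0,v_0)\in\mathcal H^s(\mathbb T)$. $(u,v)$ is a solution to $(\ast)$ in $\mathcal H^s(\mathbb T)$ on $[0,T]$ with initial data $(u_0,v_0)$ if (i) $(u,v)\in C([0,T];\mathcal H^s(\mathbb T))$, and (ii) for every $\chi\in C_c^\infty([0,T)\times\mathbb T)$ (smooth functions with compact support in $[0,T)\times\mathbb T$), $$-i\int_0^T\!\!\int_{\mathbb T}u\,\partial_t\chi\,dxdt-i\int_{\mathbb T}u_0(x)\chi(0,x)\,dx-\int_0^T\!\!\int_{\mathbb T}u\,\partial_x^2\chi\,dxdt=i\int_0^T\!\!\int_{\mathbb T}uv\,(\partial_xu)\,\chi\,dxdt,$$ $$-i\int_0^T\!\!\int_{\mathbb T}v\,\partial_t\chi\,dxdt-i\int_{\mathbb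 T}v_0(x)\chi(0,x)\,dx+\int_0^T\!\!\int_{\mathbb T}v\,\partial_x^2\chi\,dxdt=i\int_0^T\!\!\int_{\mathbb T}uv\,(\partial_xv)\,\chi\,dxdt.$$ A solution on $[-T,0]$ is defined in the same manner: $(u,v)\in C([-T,0];\mathcal H^s(\mathbb T))$ and the analogous identities hold for all $\chi\in C_c^\infty((-T,0]\times\mathbb T)$, with $\int_0^T$ replaced by $\int_{-T}^0$ and the terms at $t=0$ replaced by $+i\int_{\mathbb T}u_0\chi(0,x)dx$ and $+i\int_{\mathbb T}v_0\chi(0,x)dx$. *)

(* Defs.v *)
From HB Require Import structures.
From mathcomp Require Import all_boot all_order all_algebra.
From mathcomp Require Import complex.
From mathcomp Require Import all_classical all_reals all_analysis.

Set Implicit Arguments.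
Unset Strict Implicit.
Unset Printing Implicit Defensive.

Import Order.TTheory GRing.Theory Num.Theory.
Import numFieldNormedType.Exports.

Local Open Scope classical_set_scope.
Local Open Scope complex_scope.
Local Open Scope ring_scope.

(* Functions on the torus R/2piZ are 2pi-periodic functions on R; elements of
   L^2 and H^s are represented by arbitrary measurable representatives, and all
   notions below other than pointwise values are invariant under changes on
   null sets. *)

Section ComplexCalculus.
Context {R : realType}.
Implicit Types (f : R -> R[i]) (chi : R -> R -> R[i]).

Definition ReF f : R -> R := fun x => complex.Re (f x).
Definition ImF f : R -> R := fun x => complex.Im (f x).

Definition cis (a : R) : R[i] := cos a +i* sin a.

Definition intC (D : set R) f : R[i] :=
  (\int[lebesgue_measure]_(x in D) ReF f x)
  +i* (\int[lebesgue_measure]_(x in D) ImF f x).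

Definition intT f : R[i] := ((pi *+ 2)^-1)%:C * intC `[- pi, pi] f.

Definition derivC f : R -> R[i] := fun x => derive1 (ReF f) x +i* derive1 (ImF f) x.

Definition derivableC f (x : R) : Prop :=
  derivable (ReF f) x 1 /\ derivable (ImF f) x 1.

Definition periodicT f : Prop := periodic f (pi *+ 2).

Definition smoothT f : Prop :=
  periodicT f /\ forall (n : nat) (x : R), derivableC (iter n derivC f) x.

Definition partial_t chi : R -> R -> R[i] := fun t x => derivC (chi^~ x) t.
Definition partial_x chi : R -> R -> R[i] := fun t x => derivC (chi t) x.

Definition continuousC2 chi : Prop :=
  continuous (fun z : R * R => complex.Re (chi z.1 z.2))
  /\ continuous (fun z : R * R => complex.Im (chi z.1 z.2)).

Fixpoint classC (n : nat) chi : Prop :=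
  if n is m.+1 then
    [/\ continuousC2 chi,
        forall t x : R, derivableC (chi^~ x) t /\ derivableC (chi t) x,
        classC m (partial_t chi) & classC m (partial_x chi)]
  else continuousC2 chi.

(* C_c^oo(J x T) for an interval J relatively open in a time interval [a, b]:
   restrictions to J x T of smooth functions on R x T, with smoothness at the
   endpoint of J meant up to the boundary.  As T is compact, the support in
   J x T is compact iff it lies over a compact subset of J. *)
Definition test_function (J : set R) chi : Prop :=
  [/\ forall n, classC n chi,
      forall t, periodicT (chi t) &
      exists K : set R, [/\ compact K, K `<=` J &
        forall t x, J t -> ~ K t -> chi t x = 0]].

End ComplexCalculus.

Section Sobolev.
Context {R : realType}.
Implicit Types (f g : R -> R[i]) (s : R).

Definition L2T f : Prop :=
  [/\ periodicT f, measurable_fun setT (ReF f), measurable_fun setT (ImF f) &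
      lebesgue_measure.-integrable `[- pi, pi]
        (fun x : R => ((ReF f x) ^+ 2 + (ImF f x) ^+ 2)%:E)].

Definition fourier f (k : int) : R[i] :=
  intT (fun x => f x * cis (- (k%:~R * x))).

Definition sobolev_sum s f : \bar R :=
  \esum_(k in [set: int])
    (((1 + `|k%:~R| ^+ 2) `^ s * ComplexField.Normc.normc (fourier f k) ^+ 2)%R)%:E.

(* H^s(T) for s >= 0, where H^s is a subspace of L^2. *)
Definition Hs s f : Prop := L2T f /\ (sobolev_sum s f < +oo)%E.

Definition Hs_norm s f : R := Num.sqrt (fine (sobolev_sum s f)).

Definition weak_deriv f g : Prop :=
  L2T g /\ forall phi : R -> R[i], smoothT phi ->
    intT (fun x => f x * derivC phi x) = - intT (fun x => g x * phi x).

(* The weak derivative, unique up to null sets; it exists for f in H^s, s >= 1,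
   and the default value 0 is only taken for f outside H^1. *)
Definition wderiv f : R -> R[i] := xget (fun=> 0) [set g | weak_deriv f g].

Definition pairT : Type := ((R -> R[i]) * (R -> R[i]))%type.

Definition Hs2 s (w : pairT) : Prop := Hs s w.1 /\ Hs s w.2.

Definition Hs2_norm s (w : pairT) : R := Hs_norm s w.1 + Hs_norm s w.2.

Definition Hs2_dist s (w w' : pairT) : R :=
  Hs2_norm s (w.1 \- w'.1, w.2 \- w'.2).

Definition CHs2 s (I : set R) (w : R -> pairT) : Prop :=
  (forall t, I t -> Hs2 s (w t)) /\
  (forall t, I t -> Hs2_dist s (w t') (w t) @[t' --> within I (nbhs t)] --> (0 : R)).

End Sobolev.

Arguments pairT : clear implicits.

Section Solutions.
Context {R : realType}.
Implicit Types (s T : R) (I J : set R).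

(* The two weak identities share the form
     -i <u, d_t chi> + sgn * i * int u0 chi(0) - e * <u, d_x^2 chi>
       = i <u v d_x u, chi>
   with e = 1 for u and e = -1 for v, and sgn = -1 (resp. 1) when t = 0 is the
   left (resp. right) endpoint of I. *)
Definition weak_identity (I : set R) (sgn e : R[i])
    (y0 : R -> R[i]) (y N chi : R -> R -> R[i]) : Prop :=
  - 'i%C * intC I (fun t => intT (fun x => y t x * partial_t chi t x))
  + sgn * 'i%C * intT (fun x => y0 x * chi 0 x)
  - e * intC I (fun t => intT (fun x => y t x * partial_x (partial_x chi) t x))
  = 'i%C * intC I (fun t => intT (fun x => N t x * chi t x)).

Definition solution s I J (sgn : R[i]) (w0 : pairT R) (w : R -> pairT R) : Prop :=
  let u := fun t => (w t).1 in
  let v := fun t => (w t).2 in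
  CHs2 s I w /\
  forall chi, test_function J chi ->
    weak_identity I sgn 1 w0.1 u (fun t x => u t x * v t x * wderiv (u t) x) chi
    /\ weak_identity I sgn (- 1) w0.2 v
         (fun t x => u t x * v t x * wderiv (v t) x) chi.

Definition forward_solution s T (w0 : pairT R) (w : R -> pairT R) : Prop :=
  solution s `[0, T] `[0, T[ (- 1) w0 w.

Definition backward_solution s T (w0 : pairT R) (w : R -> pairT R) : Prop :=
  solution s `[- T, 0] `]- T, 0] 1 w0 w.

(* There is a data-to-solution map on a neighbourhood of w0 in H^s x H^s, with
   values in C(I; H^s x H^s) with the sup norm, that is continuous at w0. *)
Definition flow_map_continuous_at s I
    (sol : pairT R -> (R -> pairT R) -> Prop) (w0 : pairT R) : Prop :=
  exists Phi : pairT R -> R -> pairT R,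
    (exists2 r : R, 0 < r &
      forall w1, Hs2 s w1 -> Hs2_dist s w1 w0 < r -> sol w1 (Phi w1)) /\
    (forall eps : R, 0 < eps -> exists2 delta : R, 0 < delta &
      forall w1, Hs2 s w1 -> Hs2_dist s w1 w0 < delta ->
        forall t, I t -> Hs2_dist s (Phi w1 t) (Phi w0 t) < eps).

End Solutions.

(* Main.v *)
(* Only the equation for u is used, with b = u v regarded as a given coefficient of
   its first-order term.  Take data close to (u0, v0) of the form u = P + rough term,
   v = Q with trigonometric polynomials P, Q such that c, the mean of P Q, has
   Im c <> 0.  The gauge E = exp (i/2 int (P Q - c)) removes the oscillating part of
   P Q, and w = E u satisfies, frequency by frequency,
     w_k' = (i k^2 + i c k) w_k + bounded terms + (E (u v - P Q) d_x u)_k,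
   where u v - P Q is small in the Wiener algebra for small times.  On the
   half-line of frequencies where - k Im c > 0 (k Im c > 0 backward in time) the
   modes grow like exp (|Im c| |k| t); since the solution stays bounded in H^s,
   comparing with barriers built from 1 / (1 + mu |k| (T - t)) forces
   |w_k(0)| <= B (1 + |k|)^(- s - 1) there, the small term, which loses one
   derivative, being absorbed by iteration.  Choosing the rough term as
   E^-1 g sum_k (1 + |k|)^(- s - 3/4) e_k, with g small, contradicts this decay. *)

Require Import Defs.
From HB Require Import structures.
From mathcomp Require Import all_boot all_order all_algebra.
From mathcomp Require Import complex.
From mathcomp Require Import all_classical all_reals all_analysis.
From mathcomp Require Import measurable_realfun.
From mathcomp Require Import ring lra.

Import Order.TTheory GRing.Theory Num.Theory.
Import numFieldNormedType.Exports.

Local Open Scope classical_set_scope.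
Local Open Scope complex_scope.
Local Open Scope ring_scope.

Set Implicit Arguments.
Unset Strict Implicit.
Unset Printing Implicit Defensive.

Local Notation nm := ComplexField.Normc.normc.
Local Notation derivC := Defs.derivC.

(** * Complex-valued calculus *)

Section ComplexNorm.
Context {R : realType}.
Implicit Types z w : R[i].

Lemma ReD z w : complex.Re (z + w) = complex.Re z + complex.Re w.
Proof. by case: z w => [a b] [c d]. Qed.
Lemma ImD z w : complex.Im (z + w) = complex.Im z + complex.Im w.
Proof. by case: z w => [a b] [c d]. Qed.
Lemma ReN z : complex.Re (- z) = - complex.Re z.
Proof. by case: z. Qed.
Lemma ImN z : complex.Im (- z) = - complex.Im z.
Proof. by case: z. Qed.
Lemma ReM z w : complex.Re (z * w) =
  complex.Re z * complex.Re w - complex.Im z * complex.Im w.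
Proof. by case: z w => [a b] [c d]. Qed.
Lemma ImM z w : complex.Im (z * w) =
  complex.Re z * complex.Im w + complex.Im z * complex.Re w.
Proof. by case: z w => [a b] [c d]. Qed.
Lemma complex_ext z w : complex.Re z = complex.Re w -> complex.Im z = complex.Im w ->
  z = w.
Proof. by case: z w => [a b] [c d] /= -> ->. Qed.

Lemma nmE z : nm z = Num.sqrt (complex.Re z ^+ 2 + complex.Im z ^+ 2).
Proof. by case: z. Qed.
Lemma nm_ge0 z : 0 <= nm z.
Proof. by rewrite nmE sqrtr_ge0. Qed.
Lemma nm_sqr z : nm z ^+ 2 = complex.Re z ^+ 2 + complex.Im z ^+ 2.
Proof. by rewrite nmE sqr_sqrtr// addr_ge0// sqr_ge0. Qed.
Lemma nmM z w : nm (z * w) = nm z * nm w.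
Proof. exact: ComplexField.Normc.normcM. Qed.
Lemma nmN z : nm (- z) = nm z.
Proof. by rewrite !nmE ReN ImN !sqrrN. Qed.
Lemma nmD z w : nm (z + w) <= nm z + nm w.
Proof. exact: le_normcD. Qed.
Lemma nmB z w : nm (z - w) <= nm z + nm w.
Proof. by rewrite -(nmN w) nmD. Qed.
Lemma nm0 : nm (0 : R[i]) = 0.
Proof. exact: ComplexField.Normc.normc0. Qed.
Lemma nm_eq0 z : nm z = 0 -> z = 0.
Proof. exact: ComplexField.Normc.eq0_normc. Qed.
Lemma nm_gt0 z : z != 0 -> 0 < nm z.
Proof.
by move=> z0; rewrite lt_def nm_ge0 andbT; apply: contra z0 => /eqP/nm_eq0 ->.
Qed.
Lemma nmR (x : R) : nm x%:C = `|x|.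
Proof. by rewrite nmE /= expr0n/= addr0 sqrtr_sqr. Qed.
Lemma nmBC z w : nm (z - w) = nm (w - z).
Proof. by rewrite -nmN opprB. Qed.
Lemma nmI : nm ('i%C : R[i]) = 1.
Proof. by rewrite nmE /= expr0n/= add0r expr1n sqrtr1. Qed.
Lemma nm_dist z w : nm z <= nm w + nm (z - w).
Proof. by rewrite -[X in nm X <= _](subrKC w); exact: nmD. Qed.
Lemma Re_le_nm z : `|complex.Re z| <= nm z.
Proof.
by rewrite -(@ler_pXn2r _ 2)// ?nnegrE ?nm_ge0// nm_sqr real_normK ?num_real// lerDl sqr_ge0.
Qed.
Lemma Im_le_nm z : `|complex.Im z| <= nm z.
Proof.
by rewrite -(@ler_pXn2r _ 2)// ?nnegrE ?nm_ge0// nm_sqr real_normK ?num_real// lerDr sqr_ge0.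
Qed.
Lemma nm_le z : nm z <= `|complex.Re z| + `|complex.Im z|.
Proof.
rewrite -(@ler_pXn2r _ 2)// ?nnegrE ?nm_ge0// ?addr_ge0//.
rewrite nm_sqr sqrrD !real_normK ?num_real//.
by rewrite -addrA lerD2l lerDr mulrn_wge0// mulr_ge0.
Qed.
Lemma nm_sum (I : Type) (r : seq I) (P : pred I) (F : I -> R[i]) :
  nm (\sum_(i <- r | P i) F i) <= \sum_(i <- r | P i) nm (F i).
Proof.
elim/big_rec2 : _ => [|i x y _ h]; first by rewrite nm0.
by rewrite (le_trans (nmD _ _))// lerD2l.
Qed.

Definition cexp (z : R[i]) : R[i] := (expR (complex.Re z))%:C * cis (complex.Im z).

Lemma cisD (a b : R) : cis (a + b) = cis a * cis b.
Proof.
by apply: complex_ext; rewrite /cis ?ReM ?ImM /= ?cosD ?sinD //; ring.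
Qed.
Lemma nm_cis (a : R) : nm (cis a) = 1.
Proof. by rewrite nmE /= cos2Dsin2 sqrtr1. Qed.
Lemma cis0 : cis (0 : R) = 1.
Proof. by rewrite /cis cos0 sin0. Qed.
Lemma Re_cexp z : complex.Re (cexp z) = expR (complex.Re z) * cos (complex.Im z).
Proof. by rewrite /cexp ReM /= mul0r subr0. Qed.
Lemma Im_cexp z : complex.Im (cexp z) = expR (complex.Re z) * sin (complex.Im z).
Proof. by rewrite /cexp ImM /= mul0r addr0. Qed.
Lemma cexpD z w : cexp (z + w) = cexp z * cexp w.
Proof. by rewrite /cexp ReD ImD expRD cisD rmorphM /=; ring. Qed.
Lemma nm_cexp z : nm (cexp z) = expR (complex.Re z).
Proof. by rewrite /cexp nmM nm_cis nmR mulr1 gtr0_norm ?expR_gt0. Qed.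
Lemma cexp0 : cexp 0 = 1.
Proof. by rewrite /cexp /= expR0 cis0 mulr1. Qed.
Lemma cexpNK z : cexp (- z) * cexp z = 1.
Proof. by rewrite -cexpD addNr cexp0. Qed.

End ComplexNorm.

Section ComplexCalculus.
Context {R : realType}.
Implicit Types (f g : R -> R[i]) (x : R) (z : R[i]).

Definition contC f := continuous (ReF f) /\ continuous (ImF f).

Lemma contC_cst z : contC (fun=> z).
Proof. by split=> x; exact: cvg_cst. Qed.
Lemma contCD f g : contC f -> contC g -> contC (fun x => f x + g x).
Proof.
move=> [f1 f2] [g1 g2]; split.
  have -> : ReF (fun x => f x + g x) = ReF f \+ ReF g.
    by apply/funext => x; rewrite /ReF ReD.
  by move=> x; apply: cvgD; [exact: f1|exact: g1].
have -> : ImF (fun x => f x + g x) = ImF f \+ ImF g.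
  by apply/funext => x; rewrite /ImF ImD.
by move=> x; apply: cvgD; [exact: f2|exact: g2].
Qed.
Lemma contCM f g : contC f -> contC g -> contC (fun x => f x * g x).
Proof.
move=> [f1 f2] [g1 g2]; split.
  have -> : ReF (fun x => f x * g x) = (ReF f \* ReF g) \- (ImF f \* ImF g).
    by apply/funext => x; rewrite /ReF ReM.
  by move=> x; apply: cvgB; apply: cvgM; [exact: f1|exact: g1|exact: f2|exact: g2].
have -> : ImF (fun x => f x * g x) = (ReF f \* ImF g) \+ (ImF f \* ReF g).
  by apply/funext => x; rewrite /ImF ImM.
by move=> x; apply: cvgD; apply: cvgM; [exact: f1|exact: g2|exact: f2|exact: g1].
Qed.
Lemma contCN f : contC f -> contC (fun x => - f x).
Proof.
move=> /(contCM (contC_cst (-1))); under eq_fun do rewrite mulN1r; exact.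
Qed.
Lemma contCB f g : contC f -> contC g -> contC (fun x => f x - g x).
Proof. by move=> cf /contCN; exact: contCD. Qed.
Lemma contC_nm f : contC f -> continuous (fun x => nm (f x)).
Proof.
move=> [f1 f2].
have -> : (fun x => nm (f x)) = Num.sqrt \o ((ReF f \* ReF f) \+ (ImF f \* ImF f)).
  by apply/funext => x; rewrite nmE.
move=> x; apply: continuous_comp; last exact: sqrt_continuous.
by apply: cvgD; apply: cvgM; first [exact: f1|exact: f2].
Qed.

Definition is_derC f x z := is_derive x 1 (ReF f) (complex.Re z) /\
  is_derive x 1 (ImF f) (complex.Im z).

Lemma is_derC_derivable f x z : is_derC f x z -> derivableC f x.
Proof. by case=> -[h1 _] [h2 _]; exact: (conj h1 h2). Qed.
Lemma is_derC_val f x z : is_derC f x z -> derivC f x = z.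
Proof.
by case=> f1 f2; rewrite /derivC !derive1E !derive_val; case: z f1 f2.
Qed.
Lemma derivableC_is_derC f x : derivableC f x -> is_derC f x (derivC f x).
Proof.
case=> /derivableP h1 /derivableP h2; rewrite -derive1E in h1; rewrite -derive1E in h2.
exact: (conj h1 h2).
Qed.
Lemma is_derC_cst z x : is_derC (fun=> z) x 0.
Proof. by split=> /=; exact: is_derive_cst. Qed.
Lemma is_derCD f g x z w : is_derC f x z -> is_derC g x w ->
  is_derC (fun y => f y + g y) x (z + w).
Proof.
move=> [f1 f2] [g1 g2]; split.
  have -> : ReF (fun x => f x + g x) = ReF f \+ ReF g.
    by apply/funext => y; rewrite /ReF ReD.
  by rewrite ReD; exact: is_deriveD.
have -> : ImF (fun x => f x + g x) = ImF f \+ ImF g.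
  by apply/funext => y; rewrite /ImF ImD.
by rewrite ImD; exact: is_deriveD.
Qed.
Lemma is_derCM f g x z w : is_derC f x z -> is_derC g x w ->
  is_derC (fun y => f y * g y) x (z * g x + f x * w).
Proof.
move=> [f1 f2] [g1 g2]; split.
  have -> : ReF (fun x => f x * g x) = ReF f * ReF g - ImF f * ImF g.
    by apply/funext => y; rewrite /ReF ReM.
  have h := is_deriveB (is_deriveM f1 g1) (is_deriveM f2 g2).
  apply: is_derive_eq.
  by rewrite ReD !ReM /ReF /ImF /GRing.scale /=; ring.
have -> : ImF (fun x => f x * g x) = ReF f * ImF g + ImF f * ReF g.
  by apply/funext => y; rewrite /ImF ImM.
have h := is_deriveD (is_deriveM f1 g2) (is_deriveM f2 g1).
apply: is_derive_eq.
by rewrite ImD !ImM /ReF /ImF /GRing.scale /=; ring.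
Qed.
Lemma is_derC_cexp f x z : is_derC f x z ->
  is_derC (fun y => cexp (f y)) x (z * cexp (f x)).
Proof.
move=> [f1 f2]; split.
  have -> : ReF (fun x => cexp (f x)) = (expR \o ReF f) * (cos \o ImF f).
    by apply/funext => y; rewrite /ReF /cexp ReM /= mul0r subr0.
  apply: is_derive_eq.
  by rewrite ReM Re_cexp Im_cexp /ReF /ImF /GRing.scale /=; ring.
have -> : ImF (fun x => cexp (f x)) = (expR \o ReF f) * (sin \o ImF f).
  by apply/funext => y; rewrite /ImF /cexp ImM /= mul0r addr0.
apply: is_derive_eq.
by rewrite ImM Re_cexp Im_cexp /ReF /ImF /GRing.scale /=; ring.
Qed.
Lemma is_derC_real (h : R -> R) x (d : R) : is_derive x 1 h d ->
  is_derC (fun y => (h y)%:C) x d%:C.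
Proof. by move=> hd; split; [exact: hd|exact: is_derive_cst]. Qed.
Lemma cis_cexp (a : R) : cis a = cexp ('i%C * a%:C).
Proof.
have -> : 'i%C * a%:C = 0 +i* a by apply: complex_ext; rewrite ?ReM ?ImM /=; ring.
by rewrite /cexp /= expR0 mul1r.
Qed.
Lemma is_derC_cis (a : R) x :
  is_derC (fun y => cis (a * y)) x ('i%C * a%:C * cis (a * x)).
Proof.
have d : is_derC (fun y => 'i%C * (a * y)%:C : R[i]) x ('i%C * a%:C).
  have h : is_derive x 1 (fun y : R => a * y) a.
    apply: is_derive_eq.
    by rewrite /GRing.scale /= mulr1.
  have := is_derCM (is_derC_cst 'i%C x) (is_derC_real h).
  by rewrite mul0r add0r.
have := is_derC_cexp d; rewrite -cis_cexp.
by under eq_fun do rewrite -cis_cexp.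
Qed.

Lemma derivableC_cont f : (forall x, derivableC f x) -> contC f.
Proof.
move=> df; split=> x; have [/derivable1_diffP h1 /derivable1_diffP h2] := df x;
  [exact: (differentiable_continuous h1)|exact: (differentiable_continuous h2)].
Qed.

Fixpoint Ck (n : nat) f : Prop :=
  if n is m.+1 then (forall x, derivableC f x) /\ Ck m (derivC f) else True.

Lemma CkS n f : Ck n.+1 f -> Ck n f.
Proof. by elim: n f => // n IH f [df /IH]. Qed.
Lemma Ck_der n f g : (forall x, is_derC f x (g x)) -> Ck n g -> Ck n.+1 f.
Proof.
move=> fg Cg; split; first by move=> x; exact: is_derC_derivable (fg x).
suff -> : derivC f = g by [].
by apply/funext => x; exact: is_derC_val.
Qed.
Lemma Ck_cst n z : Ck n (fun=> z).
Proof.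
elim: n z => // n IH z; apply: (@Ck_der _ _ (fun=> 0)) => // x.
exact: is_derC_cst.
Qed.
Lemma CkD n f g : Ck n f -> Ck n g -> Ck n (fun x => f x + g x).
Proof.
elim: n f g => // n IH f g [df f1] [dg g1].
apply: (@Ck_der _ _ (fun x => derivC f x + derivC g x)); last exact: IH.
by move=> x; apply: is_derCD; exact: derivableC_is_derC.
Qed.
Lemma CkM n f g : Ck n f -> Ck n g -> Ck n (fun x => f x * g x).
Proof.
elim: n f g => // n IH f g Cf Cg; have [df f1] := Cf; have [dg g1] := Cg.
apply: (@Ck_der _ _ (fun x => derivC f x * g x + f x * derivC g x)).
  by move=> x; apply: is_derCM; exact: derivableC_is_derC.
by apply: CkD; apply: IH => //; exact: CkS.
Qed.
Lemma Ck_cexp n f : Ck n f -> Ck n (fun x => cexp (f x)).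
Proof.
elim: n f => // n IH f Cf; have [df f1] := Cf.
apply: (@Ck_der _ _ (fun x => derivC f x * cexp (f x))).
  by move=> x; apply: is_derC_cexp; exact: derivableC_is_derC.
by apply: CkM => //; apply: IH; exact: CkS.
Qed.
Lemma Ck_cis n (a : R) : Ck n (fun x => cis (a * x)).
Proof.
elim: n => // n IH.
apply: (@Ck_der _ _ (fun x => 'i%C * a%:C * cis (a * x))).
  by move=> x; exact: is_derC_cis.
exact: CkM (Ck_cst _ _) IH.
Qed.
Definition smooth f := forall n, Ck n f.
Lemma smoothE f : smooth f <-> forall n x, derivableC (iter n derivC f) x.
Proof.
split=> [Cf n|df n].
  have {Cf} : Ck n.+1 f by exact: Cf.
  elim: n f => [|n IH] f; first by case.
  by case=> _ /IH; rewrite -iterSr.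
elim: n f df => // n IH f df; split; first exact: (df 0%N).
by apply: IH => m x; rewrite -iterSr; exact: df.
Qed.
Lemma smooth_derivable f x : smooth f -> derivableC f x.
Proof. by move=> /(_ 1%N)[]. Qed.
Lemma smooth_is_derC f x : smooth f -> is_derC f x (derivC f x).
Proof. by move=> Cf; apply: derivableC_is_derC; exact: smooth_derivable. Qed.
Lemma smooth_derivC f : smooth f -> smooth (derivC f).
Proof. by move=> Cf n; case: (Cf n.+1). Qed.
Lemma smooth_contC f : smooth f -> contC f.
Proof. by move=> Cf; apply: derivableC_cont => x; exact: smooth_derivable. Qed.
Lemma smoothM f g : smooth f -> smooth g -> smooth (fun x => f x * g x).
Proof. by move=> Cf Cg n; exact: CkM. Qed.
Lemma smoothD f g : smooth f -> smooth g -> smooth (fun x => f x + g x).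
Proof. by move=> Cf Cg n; exact: CkD. Qed.
Lemma smooth_cst z : smooth (fun=> z).
Proof. by move=> n; exact: Ck_cst. Qed.
Lemma smooth_cis (a : R) : smooth (fun x => cis (a * x)).
Proof. by move=> n; exact: Ck_cis. Qed.
Lemma smooth_cexp f : smooth f -> smooth (fun x => cexp (f x)).
Proof. by move=> Cf n; exact: Ck_cexp. Qed.
End ComplexCalculus.

Section ComplexIntegral.
Context {R : realType}.
Notation mu := (@lebesgue_measure R).
Implicit Types (f g : R -> R[i]) (x : R) (z : R[i]) (D : set R).

Definition integC D f :=
  mu.-integrable D (EFin \o ReF f) /\ mu.-integrable D (EFin \o ImF f).

Lemma contC_integC (a b : R) f : contC f -> integC `[a, b] f.
Proof.
by case=> f1 f2; split; apply: continuous_compact_integrable;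
  [exact: segment_compact|exact: continuous_subspaceT|
   exact: segment_compact|exact: continuous_subspaceT].
Qed.

Lemma integCD D f g : measurable D -> integC D f -> integC D g ->
  integC D (fun x => f x + g x).
Proof.
move=> mD [f1 f2] [g1 g2]; split.
  rewrite (_ : _ \o _ = (EFin \o ReF f) \+ (EFin \o ReF g))%E.
    exact: integrableD.
  by apply/funext => x; rewrite /ReF /= ReD.
rewrite (_ : _ \o _ = (EFin \o ImF f) \+ (EFin \o ImF g))%E.
  exact: integrableD.
by apply/funext => x; rewrite /ImF /= ImD.
Qed.

Lemma intCD D f g : measurable D -> integC D f -> integC D g ->
  intC D (fun x => f x + g x) = intC D f + intC D g.
Proof.
move=> mD [f1 f2] [g1 g2]; apply: complex_ext; rewrite ?ReD ?ImD /=.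
  by rewrite -RintegralD//; apply: eq_Rintegral => x _; rewrite /ReF ReD.
by rewrite -RintegralD//; apply: eq_Rintegral => x _; rewrite /ImF ImD.
Qed.

Lemma integrableZlr D (h : R -> R) (r : R) : measurable D ->
  mu.-integrable D (EFin \o h) -> mu.-integrable D (fun x => (r * h x)%:E).
Proof.
by move=> mD ih; under eq_fun do rewrite EFinM; exact: integrableZl.
Qed.

Lemma integCZ D z f : measurable D -> integC D f -> integC D (fun x => z * f x).
Proof.
move=> mD [f1 f2]; split.
  rewrite (_ : _ \o _ = (fun x => (complex.Re z * ReF f x)%:E) \-
                        (fun x => (complex.Im z * ImF f x)%:E))%E.
    by apply: integrableB => //; exact: integrableZlr.
  by apply/funext => x; rewrite /ReF /ImF /= ReM EFinB.
rewrite (_ : _ \o _ = (fun x => (complex.Re z * ImF f x)%:E) \+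
                        (fun x => (complex.Im z * ReF f x)%:E))%E.
  by apply: integrableD => //; exact: integrableZlr.
by apply/funext => x; rewrite /ReF /ImF /= ImM EFinD.
Qed.

Lemma intCZ D z f : measurable D -> integC D f ->
  intC D (fun x => z * f x) = z * intC D f.
Proof.
move=> mD [f1 f2]; apply: complex_ext; rewrite ?ReM ?ImM /=.
  rewrite -!RintegralZl// -RintegralB//; try exact: integrableZlr.
  by apply: eq_Rintegral => x _; rewrite /ReF ReM.
rewrite -!RintegralZl// -RintegralD//; try exact: integrableZlr.
by apply: eq_Rintegral => x _; rewrite /ImF ImM.
Qed.

Lemma integCN D f : measurable D -> integC D f -> integC D (fun x => - f x).
Proof.
by move=> mD /(integCZ (-1) mD); under eq_fun do rewrite mulN1r.
Qed.
Lemma intCN D f : measurable D -> integC D f ->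
  intC D (fun x => - f x) = - intC D f.
Proof.
move=> mD iF; rewrite -mulN1r -intCZ//; congr intC; apply/funext => x.
by rewrite mulN1r.
Qed.
Lemma integCB D f g : measurable D -> integC D f -> integC D g ->
  integC D (fun x => f x - g x).
Proof. by move=> mD iF ig; apply: integCD => //; exact: integCN. Qed.
Lemma intCB D f g : measurable D -> integC D f -> integC D g ->
  intC D (fun x => f x - g x) = intC D f - intC D g.
Proof. by move=> mD iF ig; rewrite intCD ?intCN//; exact: integCN. Qed.

Lemma Rintegral_bound (a b B : R) (h : R -> R) : a <= b ->
  mu.-integrable `[a, b] (EFin \o h) -> (forall x, a <= x <= b -> `|h x| <= B) ->
  `|\int[mu]_(x in `[a, b]) h x| <= B * (b - a).
Proof.
move=> ab ih hB; apply: (le_trans (le_normr_Rintegral _ ih)) => //.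
rewrite (le_trans (le_Rintegral _ _ (f2 := fun=> B) _ _))//.
- exact: integrable_norm.
- by apply: continuous_compact_integrable;
    [exact: segment_compact|apply: continuous_subspaceT => x; exact: cvg_cst].
- rewrite Rintegral_cst//= lebesgue_measure_itv/= lte_fin; case: ltP => //= ba.
  by rewrite mulr0 mulr_ge0 ?subr_ge0// (le_trans _ (hB a _))// lexx ab.
Qed.

Lemma intC_bound (a b B : R) f : a <= b -> integC `[a, b] f ->
  (forall x, a <= x <= b -> nm (f x) <= B) ->
  nm (intC `[a, b] f) <= 2 * B * (b - a).
Proof.
move=> ab [f1 f2] fB; apply: (le_trans (nm_le _)) => /=.
rewrite -mulrA mulr_natl mulr2n; apply: lerD; apply: Rintegral_bound => // x xab.
  exact: le_trans (Re_le_nm _) (fB _ xab).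
exact: le_trans (Im_le_nm _) (fB _ xab).
Qed.

Lemma FTC2 (F h : R -> R) (a b : R) : a <= b ->
  (forall x : R, is_derive x 1 F (h x)) -> continuous h ->
  \int[mu]_(x in `[a, b]) h x = F b - F a.
Proof.
rewrite le_eqVlt => /orP[/eqP <- _ _|ab dF ch].
  by rewrite set_itv1 Rintegral_set1 subrr.
have cF : continuous F.
  by move=> x; apply: differentiable_continuous; apply/derivable1_diffP; case: (dF x).
rewrite /Rintegral (@continuous_FTC2 _ h F)//.
- exact: continuous_subspaceT.
- split; first by move=> x _; case: (dF x).
  + by apply: cvg_at_right_filter; exact: cF.
  + by apply: cvg_at_left_filter; exact: cF.
- by move=> x _; rewrite derive1E; case: (dF x).
Qed.

Lemma intC_FTC f g (a b : R) : a <= b -> (forall x, is_derC f x (g x)) -> contC g ->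
  intC `[a, b] g = f b - f a.
Proof.
move=> ab df [g1 g2]; apply: complex_ext; rewrite ?ReD ?ImD ?ReN ?ImN /=.
  exact: (@FTC2 (ReF f) (ReF g) a b ab (fun x => (df x).1) g1).
exact: (@FTC2 (ImF f) (ImF g) a b ab (fun x => (df x).2) g2).
Qed.

Lemma eq_intC D f g : (forall x, D x -> f x = g x) -> intC D f = intC D g.
Proof.
move=> fg; apply: complex_ext => /=; apply: eq_Rintegral => x; rewrite inE => Dx;
by rewrite /ReF /ImF fg.
Qed.

End ComplexIntegral.

(** * Fourier coefficients on the torus *)

Section Torus.
Context {R : realType}.
Notation mu := (@lebesgue_measure R).
Implicit Types (f g : R -> R[i]) (x : R) (z : R[i]) (D : set R) (k j : int).

Definition measC D f := measurable_fun D (ReF f) /\ measurable_fun D (ImF f).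
Definition aeC D f g := {ae mu, forall x, D x -> f x = g x}.

Lemma aeS (P Q : set R) : (forall x, P x -> Q x) ->
  {ae mu, forall x, P x} -> {ae mu, forall x, Q x}.
Proof. by move=> PQ; apply: filterS PQ; exact: (ae_filter_ringOfSetsType mu). Qed.
Lemma aeI (P Q : set R) : {ae mu, forall x, P x} -> {ae mu, forall x, Q x} ->
  {ae mu, forall x, P x /\ Q x}.
Proof. exact: (@filterI _ _ (ae_filter_ringOfSetsType mu)). Qed.

Lemma contC_measC D f : measurable D -> contC f -> measC D f.
Proof.
move=> mD [f1 f2]; split; apply: measurable_funS (measurableT) _ _ => //;
  exact: measurable_realfun.continuous_measurable_fun.
Qed.
Lemma integC_measC D f : integC D f -> measC D f.
Proof.
by case=> /integrableP[/measurable_EFinP f1 _] /integrableP[/measurable_EFinP f2 _].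
Qed.
Lemma measCM D f g : measC D f -> measC D g -> measC D (fun x => f x * g x).
Proof.
move=> [f1 f2] [g1 g2]; split.
  rewrite (_ : ReF _ = (ReF f \* ReF g) \- (ImF f \* ImF g)).
    by apply: measurable_funB; apply: measurable_funM.
  by apply/funext => x; rewrite /ReF ReM.
rewrite (_ : ImF _ = (ReF f \* ImF g) \+ (ImF f \* ReF g)).
  by apply: measurable_funD; apply: measurable_funM.
by apply/funext => x; rewrite /ImF ImM.
Qed.

Lemma intC_ae D f g : measurable D -> measC D f -> measC D g -> aeC D f g ->
  intC D f = intC D g.
Proof.
move=> mD [f1 f2] [g1 g2] fg; apply: complex_ext => /=; congr fine;
  apply: ae_eq_integral => //; try exact/measurable_EFinP;
  by apply: aeS fg => x /= H Dx; rewrite /ReF /ImF H.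
Qed.

Lemma integCM_cont (a b : R) f g : integC `[a, b] f -> contC g ->
  integC `[a, b] (fun x => f x * g x).
Proof.
have bd (h : R -> R) : continuous h -> [bounded h x | x in `[a, b]].
  move=> ch; have /compact_bounded[M [M1 Mh]] :=
    continuous_compact (continuous_subspaceT ch) (@segment_compact _ a b).
  by exists M; split => // N MN x xab; apply: Mh MN _ _; exists x.
have H (p h : R -> R) : mu.-integrable `[a, b] (EFin \o p) -> continuous h ->
    mu.-integrable `[a, b] (fun x => (p x * h x)%:E).
  move=> ip ch; rewrite (_ : (fun _ => _) = (EFin \o p) \* (EFin \o h))%E; last first.
    by apply/funext => x; rewrite /= EFinM.
  apply: integrableMl => //; last exact: bd.
  by apply: measurable_funS measurableT _ _ => //; exact: measurable_realfun.continuous_measurable_fun.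
move=> [f1 f2] [g1 g2]; split.
  rewrite (_ : _ \o _ = (fun x => (ReF f x * ReF g x)%:E) \-
                        (fun x => (ImF f x * ImF g x)%:E))%E.
    by apply: integrableB => //; exact: H.
  by apply/funext => x; rewrite /ReF /ImF /= ReM EFinB.
rewrite (_ : _ \o _ = (fun x => (ReF f x * ImF g x)%:E) \+
                        (fun x => (ImF f x * ReF g x)%:E))%E.
  by apply: integrableD => //; exact: H.
by apply/funext => x; rewrite /ReF /ImF /= ImM EFinD.
Qed.

Definition TT : set R := `[- pi, pi].
Lemma mTT : measurable TT. Proof. exact: measurable_itv. Qed.
Hint Resolve mTT : core.
Lemma Npi_le_pi : - pi <= pi :> R.
Proof. by rewrite ge0_cp ?pi_ge0. Qed.

Lemma intTD f g : integC TT f -> integC TT g ->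
  intT (fun x => f x + g x) = intT f + intT g.
Proof. by move=> ? ?; rewrite /intT intCD// mulrDr. Qed.
Lemma intTB f g : integC TT f -> integC TT g ->
  intT (fun x => f x - g x) = intT f - intT g.
Proof. by move=> ? ?; rewrite /intT intCB// mulrBr. Qed.
Lemma intTZ z f : integC TT f -> intT (fun x => z * f x) = z * intT f.
Proof. by move=> ?; rewrite /intT intCZ// mulrCA. Qed.
Lemma intTN f : integC TT f -> intT (fun x => - f x) = - intT f.
Proof. by move=> ?; rewrite /intT intCN// mulrN. Qed.
Lemma intT_ae f g : measC TT f -> measC TT g -> aeC TT f g -> intT f = intT g.
Proof. by move=> ? ? ?; rewrite /intT (intC_ae mTT _ _ (g := g)). Qed.
Lemma eq_intT f g : f =1 g -> intT f = intT g.
Proof. by move=> fg; congr intT; exact/funext. Qed.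
Lemma contC_TT f : contC f -> integC TT f.
Proof. exact: contC_integC. Qed.
Hint Resolve contC_TT : core.

Lemma intT_bound f (B : R) : integC TT f -> (forall x, TT x -> nm (f x) <= B) ->
  nm (intT f) <= 2 * B.
Proof.
move=> iF fB; rewrite /intT nmM nmR.
have p0 := pi_gt0 R.
have p2 : 0 < pi *+ 2 :> R by rewrite mulrn_wgt0.
rewrite ger0_norm ?invr_ge0 ?(ltW p2)// mulrC ler_pdivrMr//.
have fB' (x : R) : - pi <= x <= pi -> nm (f x) <= B.
  by move=> xp; apply: fB; rewrite /TT/= in_itv.
by have := intC_bound Npi_le_pi iF fB'; rewrite opprK -mulr2n.
Qed.

Lemma intT_der0 f g : (forall x, is_derC f x (g x)) -> contC g -> periodicT f ->
  intT g = 0.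
Proof.
move=> df cg pf; rewrite /intT (intC_FTC Npi_le_pi df cg).
have := pf (- pi); rewrite mulr2n addrA addNr add0r => ->.
by rewrite subrr mulr0.
Qed.

Lemma periodicM f g : periodicT f -> periodicT g -> periodicT (fun x => f x * g x).
Proof. by move=> pf pg x; rewrite pf pg. Qed.

Lemma intT_parts f g f' g' : (forall x, is_derC f x (f' x)) ->
  (forall x, is_derC g x (g' x)) -> contC f' -> contC g' ->
  periodicT f -> periodicT g ->
  intT (fun x => f' x * g x) = - intT (fun x => f x * g' x).
Proof.
move=> df dg cf' cg' pf pg; apply/eqP; rewrite -addr_eq0.
have cf : contC f by apply: derivableC_cont => x; exact: is_derC_derivable (df x).
have cg : contC g by apply: derivableC_cont => x; exact: is_derC_derivable (dg x).
rewrite -intTD; [|by apply: contC_TT; apply: contCM..].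
apply/eqP; apply: (@intT_der0 (fun x => f x * g x)).
- by move=> x; exact: is_derCM.
- by apply: contCD; apply: contCM.
- exact: periodicM.
Qed.

Definition ek k x : R[i] := cis (k%:~R * x).
Lemma ekD k j x : ek (k + j) x = ek k x * ek j x.
Proof. by rewrite /ek -cisD -mulrDl intrD. Qed.
Lemma ek0 x : ek 0 x = 1.
Proof. by rewrite /ek mul0r cis0. Qed.
Lemma nm_ek k x : nm (ek k x) = 1.
Proof. exact: nm_cis. Qed.
Lemma smooth_ek k : smooth (ek k).
Proof. exact: smooth_cis. Qed.
Lemma contC_ek k : contC (ek k).
Proof. exact/smooth_contC/smooth_ek. Qed.
Hint Resolve contC_ek smooth_ek : core.
Lemma is_derC_ek k x : is_derC (ek k) x ('i%C * k%:~R * ek k x).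
Proof. by have := is_derC_cis k%:~R x; rewrite rmorph_int. Qed.
Lemma cis_pi2 k : cis (k%:~R * (pi *+ 2)) = 1 :> R[i].
Proof.
have h (n : nat) : cis (n%:R * (pi *+ 2)) = 1 :> R[i].
  elim: n => [|n IH]; first by rewrite mul0r cis0.
  rewrite -natr1 mulrDl mul1r cisD IH mul1r /cis.
  have := @cosD2pi R 0; rewrite add0r => ->.
  have := @sinD2pi R 0; rewrite add0r => ->.
  by rewrite cos0 sin0.
case: k => n; first exact: h.
rewrite NegzE rmorphN /= mulNr; have := h n.+1.
set a := _ * _ => ha; have := cisD a (- a); rewrite subrr ha mul1r => <-.
exact: cis0.
Qed.
Lemma periodic_ek k : periodicT (ek k).
Proof. by move=> x; rewrite /ek mulrDr cisD cis_pi2 mulr1. Qed.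

Lemma fourierE f k : fourier f k = intT (fun x => f x * ek (- k) x).
Proof. by apply: eq_intT => x; rewrite /ek rmorphN /= mulNr. Qed.

Lemma intT1 : intT (fun=> 1 : R[i]) = 1.
Proof.
have d x : is_derC (fun y : R => (y)%:C) x 1.
  by apply: (is_derC_real (d := 1)); exact: is_derive_id.
rewrite /intT (intC_FTC Npi_le_pi d (contC_cst _)) -rmorphB -rmorphM /= opprK.
by rewrite -mulr2n mulVf// mulrn_eq0/= gt_eqF// pi_gt0.
Qed.

Lemma intT_ek k : intT (ek k) = (k == 0)%:R.
Proof.
have [->|k0] := eqVneq k 0.
  by rewrite -[RHS]intT1; apply: eq_intT => x; exact: ek0.
have ik : 'i%C * k%:~R != 0 :> R[i].
  by rewrite mulf_neq0// ?intr_eq0// eq_complex /= oner_eq0 andbF.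
apply: (mulfI ik); rewrite mulr0 -intTZ//; last exact: contC_TT.
apply: (@intT_der0 (ek k)); last exact: periodic_ek.
  exact: is_derC_ek.
by apply: contCM => //; exact: contC_cst.
Qed.

Lemma fourier_ek k j : fourier (ek j) k = (j == k)%:R.
Proof.
rewrite fourierE -subr_eq0 -intT_ek; apply: eq_intT => x; exact/esym/ekD.
Qed.
Lemma fourierD f g k : integC TT f -> integC TT g ->
  fourier (fun x => f x + g x) k = fourier f k + fourier g k.
Proof.
move=> iF ig; rewrite !fourierE -intTD; try exact: integCM_cont.
by apply: eq_intT => x; rewrite mulrDl.
Qed.
Lemma fourierB f g k : integC TT f -> integC TT g ->
  fourier (fun x => f x - g x) k = fourier f k - fourier g k.
Proof.
move=> iF ig; rewrite !fourierE -intTB; try exact: integCM_cont.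
by apply: eq_intT => x; rewrite mulrBl.
Qed.
Lemma fourierZ z f k : integC TT f ->
  fourier (fun x => z * f x) k = z * fourier f k.
Proof.
move=> iF; rewrite !fourierE -intTZ; try exact: integCM_cont.
by apply: eq_intT => x; rewrite mulrA.
Qed.
Lemma fourier_shift f k j : fourier (fun x => ek j x * f x) k = fourier f (k - j).
Proof.
rewrite !fourierE; apply: eq_intT => x.
by rewrite mulrAC -ekD mulrC opprB.
Qed.
Lemma fourier_ae f g k : measC TT f -> measC TT g -> aeC TT f g ->
  fourier f k = fourier g k.
Proof.
move=> mf mg fg; rewrite !fourierE; apply: intT_ae.
- by apply: measCM => //; exact: contC_measC.
- by apply: measCM => //; exact: contC_measC.
- by apply: aeS fg => x /= + xT => ->.
Qed.
Lemma fourier_bound f k (B : R) : integC TT f -> (forall x, TT x -> nm (f x) <= B) ->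
  nm (fourier f k) <= 2 * B.
Proof.
move=> iF fB; rewrite fourierE; apply: intT_bound; first exact: integCM_cont.
by move=> x xT; rewrite nmM nm_ek mulr1; exact: fB.
Qed.
Lemma fourier_der f f' k : (forall x, is_derC f x (f' x)) -> contC f' ->
  periodicT f -> fourier f' k = 'i%C * k%:~R * fourier f k.
Proof.
move=> df cf' pf; have cf : contC f.
  by apply: derivableC_cont => x; exact: is_derC_derivable (df x).
rewrite !fourierE (intT_parts df (is_derC_ek (- k)))//; last exact: periodic_ek.
  rewrite -intTN -?intTZ.
  - by apply: eq_intT => x; rewrite rmorphN /=; ring.
  - by apply: contC_TT; exact: contCM.
  - by apply: contC_TT; apply: contCM => //; apply: contCM => //; exact: contC_cst.
by apply: contCM => //; exact: contC_cst.
Qed.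
End Torus.

(** * Sums over the integers *)

Section IntSums.
Context {R : realType}.
Implicit Types (a b : int -> R) (c : int -> R[i]) (M : R) (k j : int).

Definition S a : \bar R := \esum_(k in [set: int]) (a k)%:E.
Arguments S a%_ring_scope.

Lemma S_leP a (M : R) : (S a <= M%:E)%E <->
  forall r : seq int, uniq r -> \sum_(k <- r) a k <= M.
Proof.
split=> [SM r ur|H].
  rewrite -lee_fin; apply: le_trans SM; apply: esum_ge.
  exists [set` r]; first by split => //; exact: finite_seq.
  by rewrite -fsbig_seq// sumEFin.
apply: ge_ereal_sup => _ /= [A [fA _] <-].
rewrite fsbig_finite//= sumEFin lee_fin; apply: H; exact: finmap.fset_uniq.
Qed.

Lemma S_ge0 a : (forall k, 0 <= a k) -> (0 <= S a)%E.
Proof. by move=> a0; apply: esum_ge0 => k _; rewrite lee_fin. Qed.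

Lemma le_S a b : (forall k, a k <= b k) -> (S a <= S b)%E.
Proof. by move=> ab; apply: le_esum => k _; rewrite lee_fin. Qed.

Lemma S_le_trans a b (M : R) : (forall k, a k <= b k) -> (S b <= M%:E)%E ->
  (S a <= M%:E)%E.
Proof. by move=> ab; apply: le_trans; exact: le_S. Qed.

Lemma S_ge_term a (M : R) k : (S a <= M%:E)%E -> a k <= M.
Proof. by move/S_leP => /(_ [:: k] isT); rewrite big_seq1. Qed.

Lemma S_bound_ge0 a (M : R) : (S a <= M%:E)%E -> 0 <= M.
Proof. by move/S_leP => /(_ [::] isT); rewrite big_nil. Qed.

Lemma S_Z a (M r : R) : 0 <= r -> (S a <= M%:E)%E ->
  (S (fun k => (r * a k)%R) <= (r * M)%:E)%E.
Proof.
move=> r0 /S_leP aM; apply/S_leP => s us; rewrite -mulr_sumr.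
by apply: ler_wpM2l => //; exact: aM.
Qed.

Lemma S_D a b (M N : R) : (S a <= M%:E)%E -> (S b <= N%:E)%E ->
  (S (fun k => (a k + b k)%R) <= (M + N)%:E)%E.
Proof.
move=> /S_leP aM /S_leP bM; apply/S_leP => s us; rewrite big_split /=.
by apply: lerD; [exact: aM|exact: bM].
Qed.

Lemma S_reindex a (M : R) (f : int -> int) : injective f -> (S a <= M%:E)%E ->
  (S (fun k => a (f k)) <= M%:E)%E.
Proof.
move=> inf /S_leP aM; apply/S_leP => s us.
by rewrite -(big_map f xpredT a); apply: aM; rewrite map_inj_uniq.
Qed.

Lemma S_fin a : (S a < +oo)%E -> (forall k, 0 <= a k) -> exists M : R, (S a <= M%:E)%E.
Proof.
move=> fa a0; exists (fine (S a)); rewrite fineK// ge0_fin_numE//.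
exact: S_ge0.
Qed.

Lemma S_tail a (M e : R) : (forall k, 0 <= a k) -> (S a <= M%:E)%E -> 0 < e ->
  exists2 r : seq int, uniq r &
    (S (fun k => if k \in r then 0%R else a k) <= e%:E)%E.
Proof.
move=> a0 aM e0; have fS : S a \is a fin_num.
  by rewrite ge0_fin_numE ?S_ge0// (le_lt_trans aM)// ltry.
have [A [fA _] hA] : exists2 A : set int, fsets [set: int] A &
    (S a - e%:E < \sum_(k \in A) (a k)%:E)%E.
  have [_ [A fA <-] hA] := ub_ereal_sup_adherent e0 fS.
  by exists A.
set r := finmap.enum_fset (fset_set A).
have ur : uniq r by exact: finmap.fset_uniq.
exists r => //; apply/S_leP => s us.
rewrite fsbig_finite//= sumEFin -/r in hA.
have /S_leP H : (S a <= (fine (S a))%:E)%E by rewrite fineK.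
have := H (r ++ [seq k <- s | k \notin r]).
rewrite cat_uniq ur filter_uniq// andbT /=.
have -> : ~~ has (fun x => x \in r) [seq k <- s | k \notin r].
  by apply/hasPn => k; rewrite mem_filter => /andP[].
move=> /(_ isT); rewrite big_cat /= big_filter.
rewrite -(fineK fS) -EFinB lte_fin in hA.
move=> H2; rewrite (_ : \sum_(k <- s) _ = \sum_(k <- s | k \notin r) a k).
  by rewrite -(lerD2l (\sum_(k <- r) a k)) (le_trans H2)// -lerBlDr ltW.
by rewrite [RHS]big_mkcond /=; apply: eq_bigr => k _; case: (k \in r).
Qed.

Lemma S_conv a b (M N : R) : (forall k, 0 <= a k) -> (forall k, 0 <= b k) ->
  (S a <= M%:E)%E -> (S b <= N%:E)%E ->
  (\esum_(k in [set: int]) S (fun j => (a j * b (k - j))%R) <= (M * N)%:E)%E.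
Proof.
move=> a0 b0 aM bN; rewrite /S esum_esum; last first.
  by move=> i j _ _; rewrite lee_fin mulr_ge0.
rewrite (@reindex_esum R _ _ ([set: int] `*`` fun=> [set: int]) _
  (fun x : int * int => (x.2, x.1))); last first.
  split => //; first by move=> [i j] [i' j'] _ _ [-> ->].
  by move=> [i j] _; exists (j, i).
rewrite -(esum_esum (a := fun x y => (a x * b (y - x))%:E)); last first.
  by move=> i j _ _; rewrite lee_fin mulr_ge0.
rewrite (le_trans (le_esum (b := fun k => (N * a k)%:E) _))//.
  move=> j _; rewrite [(N * _)%R]mulrC; apply: S_Z => //.
  by apply: S_reindex bN; exact: addIr.
by rewrite mulrC; apply: S_Z => //; exact: S_bound_ge0 bN.
Qed.

Definition psum {V : zmodType} (c : int -> V) : V ^nat :=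
  fun n => \sum_(0 <= i < n) (c (Posz i) + c (Negz i)).

Lemma psumE {V : zmodType} (c : int -> V) n : psum c n =
  \sum_(k <- map Posz (iota 0 n) ++ map Negz (iota 0 n)) c k.
Proof.
by rewrite big_cat /= !big_map -big_split /= /psum /index_iota subn0.
Qed.
Lemma win_uniq n : uniq (map Posz (iota 0 n) ++ map Negz (iota 0 n)).
Proof.
rewrite cat_uniq !map_inj_uniq ?iota_uniq //=; try by move=> x y [].
rewrite andbT; apply/hasPn => _ /mapP[i _ ->]; apply/mapP => -[j _] //.
Qed.
Lemma psum_le a (M : R) n : (S a <= M%:E)%E -> psum a n <= M.
Proof. by move=> /S_leP; rewrite psumE; apply; exact: win_uniq. Qed.
Lemma mem_win k : exists n, k \in map Posz (iota 0 n) ++ map Negz (iota 0 n).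
Proof.
case: k => n; exists n.+1; rewrite mem_cat; apply/orP; [left|right];
  by apply/mapP; exists n => //; rewrite mem_iota /=.
Qed.

Lemma nm_psumB c n m : (n <= m)%N ->
  nm (psum c m - psum c n) <= psum (fun k => nm (c k)) m - psum (fun k => nm (c k)) n.
Proof.
move=> nm_; rewrite /psum !(big_cat_nat (leq0n n) nm_) /=.
have e (V : zmodType) (x y : V) : x + y - x = y by rewrite addrAC subrr add0r.
rewrite !e.
rewrite (le_trans (nm_sum _ _ _))//; apply: ler_sum => i _; exact: nmD.
Qed.

Lemma psum_tail a (M : R) : (forall k, 0 <= a k) -> (S a <= M%:E)%E ->
  exists2 r : R ^nat, r @ \oo --> 0 &
    forall n m, (n <= m)%N -> psum a m - psum a n <= r n.
Proof.
move=> a0 aM.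
have nd : nondecreasing_seq (psum a).
  apply/nondecreasing_seqP => n; rewrite /psum big_nat_recr//= lerDl.
  by rewrite addr_ge0.
have cv : cvgn (psum a).
  apply: nondecreasing_is_cvgn => //; exists M => _ [n _ <-].
  exact: psum_le.
exists (fun n => limn (psum a) - psum a n).
  by rewrite -(subrr (limn (psum a))); apply: cvgB => //; exact: cvg_cst.
by move=> n m _; rewrite lerD2r; apply: nondecreasing_cvgn_le.
Qed.

Definition sumto c (z : R[i]) := (fun n => nm (z - psum c n)) @ \oo --> (0 : R).

Lemma sumto_le c z (M : R) n : sumto c z ->
  (forall m, (n <= m)%N -> nm (psum c m - psum c n) <= M) ->
  nm (z - psum c n) <= M.
Proof.
move=> cz H.
have h : (fun m => nm (z - psum c m) + M) @ \oo --> (0 + M).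
  by apply: cvgD => //; exact: cvg_cst.
rewrite -[M]add0r; apply: (@ler_cvg_to _ _ _ _ (fun=> nm (z - psum c n)) _ _ _ (cvg_cst _) h).
exists n => // m /= nm_.
rewrite (_ : z - psum c n = (z - psum c m) + (psum c m - psum c n)).
  by rewrite (le_trans (nmD _ _))// lerD2l; exact: H.
by rewrite addrA subrK.
Qed.

Lemma sumto_uniq c z w : sumto c z -> sumto c w -> z = w.
Proof.
move=> cz cw; apply/eqP; rewrite -subr_eq0; apply/eqP; apply: nm_eq0.
apply/eqP; rewrite eq_le nm_ge0 andbT -(addr0 0).
apply: (@ler_cvg_to _ _ _ _ (fun=> nm (z - w)) _ _ _ (cvg_cst _) (cvgD cz cw)).
apply: nearW => n /=; rewrite (_ : z - w = (z - psum c n) - (w - psum c n)).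
  exact: nmB.
by rewrite opprB addrA subrK.
Qed.

Lemma sumto_nm c z (M : R) : sumto c z -> (S (fun k => nm (c k)) <= M%:E)%E -> nm z <= M.
Proof.
move=> cz cM; rewrite -[z]subr0.
have p0 : psum c 0 = 0 by rewrite /psum big_geq.
rewrite -p0; apply: sumto_le => // m _; rewrite p0 subr0 /psum.
apply: (le_trans (nm_sum _ _ _)); apply: le_trans (psum_le m cM).
by apply: ler_sum => i _; exact: nmD.
Qed.

Lemma sumto_ex c : (S (fun k => nm (c k)) < +oo)%E -> exists z, sumto c z.
Proof.
move=> fc; have [//|M cM] := S_fin fc; first by move=> k; exact: nm_ge0.
have H (p : R[i] -> R) : (forall z w, p (z + w) = p z + p w) -> p 0 = 0 ->
    (forall z, `|p z| <= nm z) ->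
    (fun n => p (psum c n)) @ \oo --> limn (fun n => p (psum c n)).
  move=> pD p0 pn.
  have -> : (fun n => p (psum c n)) = series (fun i => p (c (Posz i) + c (Negz i))).
    by apply/funext => n; exact: (big_morph p pD p0).
  apply: normed_cvg; apply: nondecreasing_is_cvgn.
    by apply/nondecreasing_seqP => n; rewrite [leRHS]big_nat_recr//= lerDl.
  exists M => _ [n _ <-]; apply: le_trans (psum_le n cM).
  by apply: ler_sum => i _; rewrite (le_trans (pn _))// nmD.
have H1 := H _ (@ReD R) erefl (@Re_le_nm R).
have H2 := H _ (@ImD R) erefl (@Im_le_nm R).
exists (limn (fun n => complex.Re (psum c n)) +i* limn (fun n => complex.Im (psum c n))).
rewrite /sumto; set x := limn _; set y := limn _.
have h : (fun n => `|x - complex.Re (psum c n)| + `|y - complex.Im (psum c n)|) @ \oo --> (0 : R).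
  rewrite -[X in _ --> X](addr0 0); apply: cvgD; rewrite -[X in _ --> X](@normr0 _ R);
  apply: cvg_norm.
    by rewrite -(subrr x); apply: cvgB => //; exact: cvg_cst.
  by rewrite -(subrr y); apply: cvgB => //; exact: cvg_cst.
apply: (squeeze_cvgr _ (cvg_cst 0) h); apply: nearW => n.
by rewrite nm_ge0 /= (le_trans (nm_le _))// ReD ImD ReN ImN.
Qed.
End IntSums.

Local Notation Sle a M := (S a%R <= M%R%:E)%E.

Section Fsum.
Context {R : realType}.
Notation mu := (@lebesgue_measure R).
Implicit Types (a b : int -> R[i]) (f g : R -> R[i]) (x : R) (M : R) (k j : int).

Definition nf a : int -> R := fun k => nm (a k).

Lemma unif_lim_cont (p : nat -> R -> R) (f : R -> R) (r : R ^nat) :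
  (forall n, continuous (p n)) -> (forall n x, `|f x - p n x| <= r n) ->
  r @ \oo --> 0 -> continuous f.
Proof.
move=> cp fp r0 x; apply/cvgrPdist_le => e e0.
have e3 : 0 < e / 3 by rewrite divr_gt0.
have /cvgrPdist_le/(_ _ e3)[N _ /(_ N (leqnn _))] := r0.
rewrite /= sub0r normrN => rN.
have {}rN : r N <= e / 3 by rewrite (le_trans _ rN)// ler_norm.
have /cvgrPdist_le/(_ _ e3) := cp N x; apply: filterS => y hy.
rewrite (_ : f x - f y = (f x - p N x) + (p N x - p N y) + (p N y - f y)); last by ring.
have h1 := fp N x; have h2 := fp N y; rewrite distrC in h2.
have := ler_normD (f x - p N x + (p N x - p N y)) (p N y - f y).
have := ler_normD (f x - p N x) (p N x - p N y).
lra.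
Qed.

Lemma unif_lim_contC (p : nat -> R -> R[i]) f (r : R ^nat) :
  (forall n, contC (p n)) -> (forall n x, nm (f x - p n x) <= r n) ->
  r @ \oo --> 0 -> contC f.
Proof.
move=> cp fp r0; split.
  apply: (unif_lim_cont (p := fun n => ReF (p n))) r0 => [n|n x].
    by case: (cp n).
  by apply: le_trans (fp n x); rewrite /ReF -ReN -ReD Re_le_nm.
apply: (unif_lim_cont (p := fun n => ImF (p n))) r0 => [n|n x].
  by case: (cp n).
by apply: le_trans (fp n x); rewrite /ImF -ImN -ImD Im_le_nm.
Qed.

(* The value is 0 where the series diverges. *)
Definition fsum a x : R[i] := xget 0 [set z | sumto (fun k => a k * ek k x) z].

Lemma nf_ek a x : (fun k => nm (a k * ek k x)) = nf a.
Proof. by apply/funext => k; rewrite nmM nm_ek mulr1. Qed.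

Lemma fsumP a M x : Sle (nf a) M ->
  sumto (fun k => a k * ek k x) (fsum a x).
Proof.
move=> aM; have [|z zP] := @sumto_ex R (fun k => a k * ek k x).
  by rewrite nf_ek (le_lt_trans aM)// ltry.
by rewrite /fsum; case: xgetP => [_ -> //|/(_ z)].
Qed.

Lemma fsum_nm a M x : Sle (nf a) M -> nm (fsum a x) <= M.
Proof. by move=> aM; apply: sumto_nm (fsumP x aM) _; rewrite nf_ek. Qed.

Lemma fsum_tail a M : Sle (nf a) M ->
  exists2 r : R ^nat, r @ \oo --> 0 &
  forall n x, nm (fsum a x - psum (fun k => a k * ek k x) n) <= r n.
Proof.
move=> aM; have [|r r0 rP] := psum_tail _ aM; first by move=> k; exact: nm_ge0.
exists r => // n x; apply: sumto_le; first exact: fsumP aM.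
by move=> m nm_; apply: le_trans (nm_psumB _ nm_) _; rewrite nf_ek; exact: rP.
Qed.

Lemma contC_sum (I : Type) (s : seq I) (F : I -> R -> R[i]) :
  (forall i, contC (F i)) -> contC (fun x => \sum_(i <- s) F i x).
Proof.
move=> cF; elim: s => [|i s IH].
  by under eq_fun do rewrite big_nil; exact: contC_cst.
by under eq_fun do rewrite big_cons; exact: contCD.
Qed.

Lemma contC_psum a n : contC (fun x => psum (fun k => a k * ek k x) n).
Proof.
have H k : contC (fun x => a k * ek k x) by apply: contCM; [exact: contC_cst|exact: contC_ek].
by apply: contC_sum => i; exact: contCD.
Qed.

Lemma contC_fsum a M : Sle (nf a) M -> contC (fsum a).
Proof.
move=> aM; have [r r0 rP] := fsum_tail aM.
exact: unif_lim_contC (contC_psum a) rP r0.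
Qed.

Lemma periodic_fsum a : periodicT (fsum a).
Proof.
move=> x; rewrite /fsum; congr xget; apply/funext => z.
rewrite /=; congr (sumto _ _); apply/funext => k.
by rewrite periodic_ek.
Qed.

Lemma psumD {V : zmodType} (a b : int -> V) n :
  psum (fun k => a k + b k) n = psum a n + psum b n.
Proof.
by rewrite /psum -big_split /=; apply: eq_bigr => i _; rewrite addrACA.
Qed.
Lemma psumN {V : zmodType} (a : int -> V) n : psum (fun k => - a k) n = - psum a n.
Proof.
by rewrite /psum -sumrN; apply: eq_bigr => i _; rewrite opprD.
Qed.

Lemma sumto_lim (c : int -> R[i]) z (r : R ^nat) : r @ \oo --> 0 ->
  (forall n, nm (z - psum c n) <= r n) -> sumto c z.
Proof.
move=> r0 H; apply: (squeeze_cvgr _ (cvg_cst 0) r0); apply: nearW => n.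
by rewrite nm_ge0 H.
Qed.

Lemma cvgD_seq0 (u v : R ^nat) : u @ \oo --> 0 -> v @ \oo --> 0 ->
  (fun n => u n + v n) @ \oo --> 0.
Proof. by move=> u0 v0; rewrite -(addr0 0); exact: cvgD. Qed.

Lemma fsumB a b M (N : R) x : Sle (nf a) M -> Sle (nf b) N ->
  fsum (fun k => a k - b k) x = fsum a x - fsum b x.
Proof.
move=> aM bN; have := S_D aM bN => abM.
have {}abM : Sle (nf (fun k => a k - b k)) (M + N).
  by apply: S_le_trans abM => k; exact: nmB.
apply: sumto_uniq (fsumP x abM) _.
have h := cvgD_seq0 (fsumP x aM) (fsumP x bN).
apply: (sumto_lim h) => n /=.
rewrite (_ : psum _ n = psum (fun k => a k * ek k x) n - psum (fun k => b k * ek k x) n).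
  by rewrite opprD addrACA -opprD; exact: nmB.
by rewrite -psumN -psumD; congr (psum _ _); apply/funext => k; rewrite mulrBl.
Qed.

Lemma intT_sum (I : Type) (s : seq I) (F : I -> R -> R[i]) :
  (forall i, contC (F i)) ->
  intT (fun x => \sum_(i <- s) F i x) = \sum_(i <- s) intT (F i).
Proof.
move=> cF; elim: s => [|i s IH].
  rewrite big_nil -[RHS](mul0r (intT (fun=> 0))) -intTZ.
    by apply: eq_intT => x; rewrite big_nil mul0r.
  by apply: contC_TT; exact: contC_cst.
rewrite big_cons -IH -intTD; try apply: contC_TT => //; last exact: contC_sum.
by apply: eq_intT => x; rewrite big_cons.
Qed.

Lemma contC_bounded g : contC g -> exists2 G : R, 0 <= G & forall x, TT x -> nm (g x) <= G.
Proof.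
move=> /contC_nm cg; have /compact_bounded[M [M1 Mh]] :=
    continuous_compact (continuous_subspaceT cg) (@segment_compact _ (- pi : R) pi).
exists (`|M| + 1) => [|x xT]; first by rewrite addr_ge0.
have h : M < `|M| + 1 by rewrite (le_lt_trans (ler_norm _))// ltrDl.
have := Mh _ h (nm (g x)); rewrite /= ger0_norm ?nm_ge0//; apply.
by exists x.
Qed.

Lemma sumto_intT a M g : Sle (nf a) M -> contC g ->
  sumto (fun k => a k * intT (fun x => ek k x * g x)) (intT (fun x => fsum a x * g x)).
Proof.
move=> aM cg; have [r r0 rP] := fsum_tail aM.
have [G G0 gG] := contC_bounded cg.
have r1 : (fun n => 2 * (r n * G)) @ \oo --> (0 : R).
  rewrite -(mulr0 2) -(mul0r G); apply: cvgM; first exact: cvg_cst.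
  by apply: cvgM => //; exact: cvg_cst.
apply: sumto_lim r1 _ => n.
have cf := contC_fsum aM; have cp := contC_psum a n.
have -> : psum (fun k => a k * intT (fun x => ek k x * g x)) n =
    intT (fun x => psum (fun k => a k * ek k x) n * g x).
  transitivity (\sum_(0 <= i < n) intT (fun x => (a (Posz i) * ek i x + a (Negz i) * ek (Negz i) x) * g x)).
    apply: eq_bigr => i _; have ci k : contC (fun x => ek k x * g x).
      by apply: contCM => //; exact: contC_ek.
    have ci' k : contC (fun x => a k * (ek k x * g x)) by apply: contCM => //; exact: contC_cst.
    rewrite -!intTZ -?intTD; try by apply: contC_TT.
    by apply: eq_intT => x; rewrite mulrDl !mulrA.
  rewrite -intT_sum => [|i].
    by apply: eq_intT => x; rewrite /psum mulr_suml.
  by apply: contCM => //; apply: contCD; apply: contCM; (exact: contC_cst || exact: contC_ek).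
rewrite -intTB; try by apply: contC_TT; exact: contCM.
apply: intT_bound => [|x xT].
  by apply: contC_TT; apply: contCB; exact: contCM.
by rewrite -mulrBl nmM ler_pM ?nm_ge0// gG.
Qed.

Lemma sumto_delta k (z : R[i]) : sumto (fun j => if j == k then z else 0) z.
Proof.
have [n kn] := mem_win k; apply: cvg_near_cst; exists n => // m /= nm_.
rewrite psumE -big_mkcond -big_filter /=.
have km : k \in map Posz (iota 0 m) ++ map Negz (iota 0 m).
  move: kn; rewrite !mem_cat => /orP[] /mapP-[i + ->]; rewrite mem_iota /= add0n => im.
    by apply/orP; left; apply/mapP; exists i => //; rewrite mem_iota /= add0n (leq_trans im).
  by apply/orP; right; apply/mapP; exists i => //; rewrite mem_iota /= add0n (leq_trans im).
by rewrite (filter_pred1_uniq (win_uniq m) km) big_seq1 subrr nm0.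
Qed.

Lemma eq_sumto c c' (z : R[i]) : c =1 c' -> sumto c z -> sumto c' z.
Proof. by move=> /funext ->. Qed.

Lemma fourier_fsum a M k : Sle (nf a) M -> fourier (fsum a) k = a k.
Proof.
move=> aM; rewrite fourierE; apply: sumto_uniq (sumto_intT aM (contC_ek (- k))) _.
apply: eq_sumto (sumto_delta k (a k)) => j.
have -> : intT (fun x => ek j x * ek (- k) x) = (j == k)%:R by rewrite -fourierE fourier_ek.
by case: eqP => [->|]; rewrite ?mulr1 ?mulr0.
Qed.

Lemma fourier_prod a M g k (N : R) : Sle (nf a) M -> contC g ->
  Sle (fun j => nm (a j) * nm (fourier g (k - j))) N ->
  nm (fourier (fun x => fsum a x * g x) k) <= N.
Proof.
move=> aM cg aN.
have cge : contC (fun x => g x * ek (- k) x) by apply: contCM => //; exact: contC_ek.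
have := sumto_intT aM cge.
rewrite (_ : intT _ = fourier (fun x => fsum a x * g x) k); last first.
  by rewrite fourierE; apply: eq_intT => x; rewrite mulrA.
move=> /sumto_nm; apply; apply: S_le_trans aN => j; rewrite nmM.
by rewrite -fourier_shift fourierE; under eq_intT do rewrite mulrA.
Qed.

Lemma fsum_parts a M (N : R) (phi phi' : R -> R[i]) :
  Sle (nf a) M -> Sle (nf (fun k => 'i%C * k%:~R * a k)) N ->
  (forall x, is_derC phi x (phi' x)) -> contC phi' -> periodicT phi ->
  intT (fun x => fsum a x * phi' x) =
  - intT (fun x => fsum (fun k => 'i%C * k%:~R * a k) x * phi x).
Proof.
move=> aM aN dphi cphi' pphi.
have cphi : contC phi by apply: derivableC_cont => x; exact: is_derC_derivable (dphi x).
have h := sumto_intT aN cphi.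
apply: sumto_uniq (sumto_intT aM cphi') _.
apply: (sumto_lim h) => n.
have H k : 'i%C * k%:~R * a k * intT (fun x => ek k x * phi x) +
           a k * intT (fun x => ek k x * phi' x) = 0.
  have := intT_parts (is_derC_ek k) dphi _ cphi' (@periodic_ek _ k) pphi.
  rewrite (_ : intT _ = 'i%C * k%:~R * intT (fun x => ek k x * phi x)).
    move=> /(_ _)/eqP; rewrite -addr_eq0 => h'.
    rewrite mulrAC mulrC -mulrDr; apply/eqP; rewrite mulf_eq0 h' ?orbT//.
    by apply: contCM; [exact: contC_cst|exact: contC_ek].
  rewrite -intTZ; first by apply: eq_intT => x; rewrite mulrA.
  by apply: contC_TT; apply: contCM => //; exact: contC_ek.
have -> : psum (fun k => a k * intT (fun x => ek k x * phi' x)) n =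
    - psum (fun k => 'i%C * k%:~R * a k * intT (fun x => ek k x * phi x)) n.
  rewrite -psumN; congr (psum _ _); apply/funext => k.
  by apply/eqP; rewrite -addr_eq0 addrC H.
by rewrite opprK addrC nmBC.
Qed.
End Fsum.

(** * Uniqueness of Fourier coefficients *)

Section Uniqueness.
Hint Resolve mTT : core.
Context {R : realType}.
Notation mu := (@lebesgue_measure R).
Implicit Types (a x y z d : R) (h phi : R -> R).

Lemma integrable_subset (A B : set R) h : measurable A -> measurable B ->
  B `<=` A -> mu.-integrable A (EFin \o h) -> mu.-integrable B (EFin \o h).
Proof.
move=> mA mB BA ih; have H := integrableS _ _ _ ih.
by apply: H; [exact: mA|exact: mB|exact: BA].
Qed.
Lemma integrable_subR (A : set R) (h g : R -> R) : measurable A ->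
  mu.-integrable A (EFin \o h) -> mu.-integrable A (EFin \o g) ->
  mu.-integrable A ((EFin \o h) \- (EFin \o g))%E.
Proof. by move=> mA ih ig; have H := integrableB _ ih ig; exact: H. Qed.
Lemma integrable_leR (A : set R) (h g : R -> R) : measurable A ->
  measurable_fun A (EFin \o h) -> mu.-integrable A (EFin \o g) ->
  (forall x, A x -> `|h x| <= `|g x|) -> mu.-integrable A (EFin \o h).
Proof.
move=> mA mh ig hg; have H := le_integrable _ _ _ ig.
by apply: H; [exact: mA|exact: mh|move=> x Ax; rewrite lee_fin; exact: hg].
Qed.
Lemma integrable_addR (A : set R) (h g : R -> R) : measurable A ->
  mu.-integrable A (EFin \o h) -> mu.-integrable A (EFin \o g) ->
  mu.-integrable A (EFin \o (h \+ g)).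
Proof. by move=> mA ih ig; have H := integrableD _ ih ig; exact: H. Qed.

Lemma integral_finR (A : set R) h : measurable A -> mu.-integrable A (EFin \o h) ->
  (\int[mu]_(x in A) (h x)%:E \is a fin_num)%E.
Proof. by move=> mA ih; have H := integrable_fin_num _ ih; apply: H; exact: mA. Qed.

Lemma RintegralBR (A : set R) h g : measurable A -> mu.-integrable A (EFin \o h) ->
  mu.-integrable A (EFin \o g) ->
  \int[mu]_(x in A) (h x - g x) = \int[mu]_(x in A) h x - \int[mu]_(x in A) g x.
Proof. by move=> mA ih ig; have H := RintegralB _ ih ig; apply: H; exact: mA. Qed.

Lemma dominated_convergenceR (A : set R) (fn : nat -> R -> R) (f h : R -> R) :
  measurable A ->
  (forall n, measurable_fun A (EFin \o fn n)) -> measurable_fun A (EFin \o f) ->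
  mu.-integrable A (EFin \o h) ->
  {ae mu, forall x, A x -> fn n x @[n --> \oo] --> f x} ->
  (forall n x, A x -> `|fn n x| <= h x) ->
  (\int[mu]_(x in A) (fn n x)%:E)%E @[n --> \oo] --> (\int[mu]_(x in A) (f x)%:E)%E.
Proof.
move=> mA mfn mf ih cf fh; have H := dominated_convergence _ _ _ _ ih.
have c1 : {ae mu, forall x, A x -> ((EFin \o fn n) x @[n --> \oo] --> (EFin \o f) x)}.
  by apply: aeS cf => x fx /fx fnx; apply/cvg_EFin; [exact: nearW|exact: fnx].
have c2 : {ae mu, forall x, forall n, A x -> (`|(EFin \o fn n) x| <= (EFin \o h) x)%E}.
  by apply: aeW => x n Ax; rewrite /= lee_fin; exact: fh.
by have [] := H mA (fun n => EFin \o fn n) (EFin \o f) mfn mf c1 c2.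
Qed.

Lemma bernoulli_ge z m : 0 <= z -> 1 + m%:R * z <= (1 + z) ^+ m.
Proof.
move=> z0; elim: m => [|m IH]; first by rewrite mul0r addr0 expr0.
rewrite exprS; have := ler_wpM2l (addr_ge0 ler01 z0) IH; apply: le_trans.
rewrite -natr1; have := mulr_ge0 (ler0n R m) (sqr_ge0 z); nra.
Qed.
Lemma bernoulli_le z m : 0 <= z <= 1 -> 1 - m%:R * z <= (1 - z) ^+ m.
Proof.
move=> /andP[z0 z1]; elim: m => [|m IH]; first by rewrite mul0r subr0 expr0.
rewrite exprS; have z1' : 0 <= 1 - z by rewrite subr_ge0.
have := ler_wpM2l z1' IH; apply: le_trans.
rewrite -natr1; have := mulr_ge0 (ler0n R m) (sqr_ge0 z); nra.
Qed.

(* As n grows, [bump y n] tends to 1 for y < 1/2 and to 0 for 1/2 < y <= 1; with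
   y an affine function of cos (x - a) this gives trigonometric polynomials
   converging boundedly to the indicator of an interval around a. *)
Definition bump y n := (1 - y ^+ n) ^+ (2 ^ n).

Lemma bump01 y n : 0 <= y <= 1 -> 0 <= bump y n <= 1.
Proof.
move=> /andP[y0 y1]; have h0 := exprn_ge0 n y0; have h1 := exprn_ile1 n y0 y1.
have i0 : 0 <= 1 - y ^+ n by rewrite subr_ge0.
have i1 : 1 - y ^+ n <= 1 by rewrite gerBl.
by rewrite /bump exprn_ge0//= exprn_ile1.
Qed.
Lemma bump_to1 y : 0 <= y < 2^-1 -> (fun n => bump y n) @ \oo --> (1 : R).
Proof.
move=> /andP[y0 y2].
have y1 : y <= 1 by apply: ltW; apply: lt_trans y2 _; lra.
have g : (fun n => 1 - (2 * y) ^+ n) @ \oo --> (1 : R).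
  rewrite -[X in _ --> X](subr0 1); apply: cvgB; [exact: cvg_cst|apply: cvg_expr].
  by rewrite ger0_norm ?mulr_ge0//; lra.
apply: (squeeze_cvgr _ g (cvg_cst (1 : R))).
apply: nearW => n; have y01 : 0 <= y <= 1 by rewrite y0.
have /andP[_ ->] := bump01 n y01; rewrite andbT.
have h := @bernoulli_le (y ^+ n) (2 ^ n).
rewrite (le_trans _ (h _)) ?exprn_ge0 ?exprn_ile1//.
by rewrite natrX -exprMn.
Qed.
Lemma bump_to0 y : 2^-1 < y <= 1 -> (fun n => bump y n) @ \oo --> (0 : R).
Proof.
move=> /andP[y2 y1]; have y0 : 0 < y by apply: lt_trans y2; lra.
have g : (fun n => (2 * y)^-1 ^+ n) @ \oo --> (0 : R).
  apply: cvg_expr; rewrite ger0_norm ?invr_ge0 ?mulr_ge0 ?ltW//.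
  by rewrite invf_lt1 ?mulr_gt0//; lra.
apply: (squeeze_cvgr _ (cvg_cst 0) g); apply: nearW => n.
have y01 : 0 <= y <= 1 by rewrite (ltW y0).
have /andP[-> _] /= := bump01 n y01.
have p2 : 0 < (2 * y) ^+ n by rewrite exprn_gt0// mulr_gt0.
rewrite exprVn -[leRHS]mul1r ler_pdivlMr// /bump.
set z := y ^+ n; have z0 : 0 <= z by rewrite exprn_ge0// ltW.
have z1 : z <= 1 by rewrite exprn_ile1// ltW.
have -> : (2 * y) ^+ n = (2 ^ n)%:R * z by rewrite natrX -exprMn.
have h : (2 ^ n)%:R * z <= (1 + z) ^+ (2 ^ n).
  by apply: le_trans (bernoulli_ge _ z0); rewrite lerDr.
apply: (@le_trans _ _ ((1 - z) ^+ (2 ^ n) * (1 + z) ^+ (2 ^ n))).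
  by rewrite ler_wpM2l// exprn_ge0// subr_ge0.
rewrite -exprMn exprn_ile1//; first by rewrite mulr_ge0 ?subr_ge0 ?addr_ge0.
nra.
Qed.

Lemma ball_integral0_ae h : mu.-integrable (TT : set R) (EFin \o h) ->
  (forall a d, 0 < d -> - pi < a - d -> a + d < pi -> d < pi / 2 ->
    (\int[mu]_(x in ball a d) (h x)%:E = 0)%E) ->
  {ae mu, forall x, TT x -> h x = 0}.
Proof.
move=> ih H.
have := lebesgue_differentiation (integrable_locally mTT ih).
set f := h \_ TT => L.
have E : {ae mu, forall x, x != pi /\ x != - pi}.
  apply: aeI.
    exists [set pi]; split => //; first exact: lebesgue_measure_set1.
    by move=> x /= /negP; rewrite negbK => /eqP.
  exists [set - pi]; split => //; first exact: lebesgue_measure_set1.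
  by move=> x /= /negP; rewrite negbK => /eqP.
apply: aeS (aeI E L) => x [[xp xNp] Lx] xT.
apply/eqP/negPn/negP => hx0.
have fx : f x = h x by rewrite /f patchE mem_set.
have xI : - pi < x < pi.
  move: xT; rewrite /TT /= in_itv /= => /andP[l1 l2].
  by rewrite !lt_neqAle l1 l2 xp eq_sym xNp.
have [l1 l2] := andP xI.
set d0 := Num.min (Num.min (x + pi) (pi - x)) (pi / 2).
have d00 : 0 < d0 by rewrite !lt_min; have := pi_gt0 R; lra.
pose B x (n : nat) : set R := ball x n.+1%:R^-1.
have hE y : nicely_shrinking y (B y).
  split=> [n|]; first exact: measurable_ball.
  have p n : 0 < (n.+1%:R^-1 : R) by rewrite invr_gt0.
  exists (1, fun n => PosNum (p n)); split => //=; first exact: cvg_harmonic.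
  by move=> n; exact: subset_refl.
  by move=> n; rewrite mul1e.
have := nice_lebesgue_differentiation hE (integrable_locally mTT ih) Lx.
rewrite -/f fx => Lim.
have Z : \forall n \near \oo, ((mu (B x n))^-1 * \int[mu]_(y in B x n) (f y)%:E = 0)%E.
  near=> n.
  have rd : (n.+1%:R^-1 : R) < d0.
    by near: n; have /cvgr_lt := @cvg_harmonic R; apply.
  set r : R := n.+1%:R^-1 in rd.
  move: rd; rewrite !lt_min => /andP[/andP[rd1 rd2] rd3].
  have r0 : 0 < r by rewrite invr_gt0.
  have bT : ball x r `<=` TT.
    move=> y; rewrite /ball /= ltr_distlC /TT /= in_itv /= => /andP[y1 y2].
    by apply/andP; split; apply: ltW; lra.
  have -> : (\int[mu]_(y in B x n) (f y)%:E = \int[mu]_(y in ball x r) (h y)%:E)%E.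
    apply: eq_integral => y /set_mem yb; rewrite /f patchE mem_set//; exact: bT.
  by rewrite H ?mule0//; lra.
have : ((h x)%:E = 0)%E.
  apply: (cvg_unique _ Lim) => //.
  by apply: cvg_near_cst; apply: filterS Z => n ->.
by case=> /eqP; rewrite (negPf hx0).
Unshelve. all: by end_near.
Qed.

Definition tp (l : seq (R[i] * int)) (x : R) : R[i] := \sum_(p <- l) p.1 * ek p.2 x.
Definition istp (phi : R -> R[i]) := exists l, forall x, phi x = tp l x.

Lemma istp_cst (z : R[i]) : istp (fun=> z).
Proof. by exists [:: (z, 0)] => x; rewrite /tp big_seq1 ek0 mulr1. Qed.
Lemma istp_ek k : istp (ek k).
Proof. by exists [:: (1, k)] => x; rewrite /tp big_seq1 mul1r. Qed.
Lemma istpD (f g : R -> R[i]) : istp f -> istp g -> istp (fun x => f x + g x).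
Proof.
by move=> [l fl] [m gm]; exists (l ++ m) => x; rewrite fl gm /tp big_cat.
Qed.
Lemma istpM (f g : R -> R[i]) : istp f -> istp g -> istp (fun x => f x * g x).
Proof.
move=> [l fl] [m gm].
exists [seq (p.1 * q.1, p.2 + q.2) | p <- l, q <- m] => x.
rewrite fl gm /tp big_allpairs_dep /= mulr_suml; apply: eq_bigr => p _.
by rewrite mulr_sumr; apply: eq_bigr => q _; rewrite ekD mulrACA.
Qed.
Lemma istpX (f : R -> R[i]) n : istp f -> istp (fun x => f x ^+ n).
Proof.
move=> tf; elim: n => [|n IH].
  by under eq_fun do rewrite expr0; exact: istp_cst.
by under eq_fun do rewrite exprS; exact: istpM.
Qed.
Lemma istp_contC (f : R -> R[i]) : istp f -> contC f.
Proof.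
move=> [l fl]; rewrite (_ : f = tp l); last exact/funext.
apply: contC_sum => p; apply: contCM; [exact: contC_cst|exact: contC_ek].
Qed.
Lemma istp_cos a : istp (fun x => (cos (x - a))%:C).
Proof.
have -> : (fun x => (cos (x - a))%:C) =
    (fun x => 2^-1 * (cis (- a) * ek 1 x + cis a * ek (-1) x)) :> (R -> R[i]).
  apply/funext => x; rewrite /ek mulr1z mul1r mulrNz mulr1z mulN1r -!cisD.
  rewrite (_ : a - x = - (x - a)); last by ring.
  rewrite (addrC (- a)) /cis cosN sinN.
  apply: (@mulfI _ 2); first by rewrite pnatr_eq0.
  rewrite mulrA divff ?pnatr_eq0// mul1r.
  by apply: complex_ext; rewrite ?ReD ?ImD ?ReM ?ImM /=; ring.
apply: istpM; first exact: istp_cst.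
by apply: istpD; apply: istpM; (exact: istp_cst || exact: istp_ek).
Qed.

Lemma intT_istp0 (g phi : R -> R[i]) : integC TT g ->
  (forall k, fourier g k = 0) -> istp phi -> intT (fun x => g x * phi x) = 0.
Proof.
move=> ig g0 [l fl]; under eq_intT do rewrite fl; rewrite /tp.
elim: l {fl} => [|p l IH].
  rewrite -[RHS](mul0r (intT (fun=> 0))) -intTZ.
    by apply: eq_intT => x; rewrite big_nil mulr0 mul0r.
  by apply: contC_TT; exact: contC_cst.
have i1 : integC TT (fun x => g x * ek p.2 x) by apply: integCM_cont => //; exact: contC_ek.
rewrite (_ : intT _ = intT (fun x => p.1 * (g x * ek p.2 x) +
    g x * \sum_(p <- l) p.1 * ek p.2 x)).
  rewrite intTD ?IH ?addr0 ?intTZ//.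
  - by have := g0 (- p.2); rewrite fourierE opprK => ->; rewrite mulr0.
  - exact: integCZ mTT _.
  - by apply: integCM_cont => //; apply: (@istp_contC (tp l)); exists l.
by apply: eq_intT => x; rewrite big_cons mulrDr mulrCA.
Qed.

Lemma real_uniqueness h : mu.-integrable (TT : set R) (EFin \o h) ->
  (forall phi, istp (fun x => (phi x)%:C) ->
     \int[mu]_(x in TT) (h x * phi x) = 0) ->
  {ae mu, forall x, TT x -> h x = 0}.
Proof.
move=> ih H; apply: ball_integral0_ae => // a d d0 ad1 ad2 d2.
have cd0 : 0 <= cos d by apply: cos_ge0_pihalf; have := pi_gt0 R; lra.
have cd1 := cos_le1 d.
pose tau : R := (1 + cos d)^-1.
have t0 : 0 < tau by rewrite invr_gt0; lra.
have te : tau * (1 + cos d) = 1 by rewrite mulVf// gt_eqF//; lra.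
pose y x : R := tau * (1 + cos (x - a)) / 2.
have y01 x : 0 <= y x <= 1.
  rewrite /y; have := cos_geN1 (x - a); have := cos_le1 (x - a); set c := cos _ => c1 c2.
  have : 0 <= tau * (1 + c) by apply: mulr_ge0; [exact: ltW|lra].
  have : tau * (1 + c) <= tau * (2 * (1 + cos d)) by apply: ler_wpM2l; [exact: ltW|lra].
  rewrite (mulrCA tau) te; lra.
have ylt x : cos (x - a) < cos d -> y x < 2^-1.
  move=> c; rewrite /y; have : tau * (1 + cos (x - a)) < tau * (1 + cos d).
    by rewrite ltr_pM2l// ltrD2l.
  rewrite te; lra.
have ygt x : cos d < cos (x - a) -> 2^-1 < y x.
  move=> c; rewrite /y; have : tau * (1 + cos d) < tau * (1 + cos (x - a)).
    by rewrite ltr_pM2l// ltrD2l.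
  rewrite te; lra.
have cosin x : `|x - a| < d -> cos d < cos (x - a).
  move=> xd; rewrite -(cos_norm (x - a)) ltr_cos// in_itv /= ?normr_ge0 ?(ltW d0)//=;
  have := pi_gt0 R; lra.
have cosout x : TT x -> d < `|x - a| -> cos (x - a) < cos d.
  rewrite /TT /= in_itv /= => /andP[x1 x2] xd; have p0 := pi_gt0 R.
  rewrite -(cos_norm (x - a)); have : `|x - a| < 2 * pi - d.
    by rewrite ltr_norml; apply/andP; split; lra.
  set t := `|_| in xd * => t2; have [tp|tp] := leP t pi.
    by rewrite ltr_cos// in_itv /= ?(ltW d0) ?tp/= ?andbT; lra.
  rewrite -cosN -cosD2pi ltr_cos// ?in_itv /=; first by rewrite -mulr_natl; lra.
    by rewrite (ltW d0) /=; lra.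
  by rewrite -mulr_natl; apply/andP; split; lra.
pose F x : R := if `|x - a| < d then 0 else h x.
pose Fn n x := h x * bump (y x) n.
have mh : measurable_fun (TT : set R) h.
  by case/integrableP : ih => /measurable_EFinP.
have cb n : continuous (fun x => bump (y x) n).
  move=> x; rewrite /bump /y.
  apply: (@continuous_comp _ _ _ (fun x => 1 - (tau * (1 + cos (x - a)) / 2) ^+ n)
    (fun z => z ^+ (2 ^ n))); last exact: exprn_continuous.
  apply: cvgB; first exact: cvg_cst.
  apply: (@continuous_comp _ _ _ (fun x => tau * (1 + cos (x - a)) / 2)
    (fun z => z ^+ n)); last exact: exprn_continuous.
  apply: cvgMr_tmp; apply: cvgMl_tmp; apply: cvgD; first exact: cvg_cst.
  apply: continuous_comp; last exact: continuous_cos.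
  by apply: cvgB; [exact: cvg_id|exact: cvg_cst].
have mFn n : measurable_fun (TT : set R) (Fn n).
  apply: measurable_funM => //; apply: measurable_funS measurableT _ _ => //.
  exact: measurable_realfun.continuous_measurable_fun.
have iFn n : \int[mu]_(x in TT) Fn n x = 0.
  apply: H; rewrite /bump /y.
  have H0 : istp (fun x => ((tau * (1 + cos (x - a)) / 2))%:C).
    under eq_fun do rewrite !rmorphM rmorphD /=.
    by apply: istpM; [apply: istpM; [exact: istp_cst|apply: istpD; [exact: istp_cst|exact: istp_cos]]|exact: istp_cst].
  under eq_fun do rewrite rmorphXn rmorphB rmorphXn /=.
  apply: istpX; under eq_fun do rewrite -mulN1r; apply: istpD; first exact: istp_cst.
  by apply: istpM; [exact: istp_cst|exact: istpX].
have mB : measurable (ball a d) by exact: measurable_ball.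
have FE x : F x = h x - (h \_ (ball a d)) x.
  rewrite /F patchE distrC; case: ifPn => xb; first by rewrite mem_set ?subrr.
  by rewrite memNset ?subr0//; apply/negP.
have bT : ball a d `<=` TT.
  move=> z; rewrite /ball /= ltr_distlC /TT /= in_itv /= => /andP[y1 y2].
  by apply/andP; split; apply: ltW; lra.
have ib : mu.-integrable (TT : set R) (EFin \o (h \_ (ball a d))).
  rewrite -restrict_EFin; apply/(integrable_restrict mu mB mTT).
  have mI : measurable (TT `&` ball a d) by apply: measurableI => //; exact: mTT.
  by apply: (integrable_subset mTT mI _ ih); exact: subIsetl.
have iF : mu.-integrable (TT : set R) (EFin \o F).
  rewrite (_ : _ \o F = (EFin \o h) \- (EFin \o (h \_ (ball a d))))%E.
    exact: (integrable_subR mTT ih ib).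
  by apply/funext => x; rewrite /= FE EFinB.
have mF : measurable_fun (TT : set R) (EFin \o F) by case/integrableP : iF.
have mFn' n : measurable_fun (TT : set R) (EFin \o Fn n) by exact/measurable_EFinP.
have dom n x : (`|(EFin \o Fn n) x| <= `|(EFin \o h) x|)%E.
  rewrite /= lee_fin /Fn normrM; have /andP[b0 b1] := bump01 n (y01 x).
  by rewrite (ger0_norm b0) ler_piMr.
have ae1 : {ae mu, forall x, TT x -> Fn n x @[n --> \oo] --> F x}.
  have E : {ae mu, forall x, x != a - d /\ x != a + d}.
    apply: aeI.
      exists [set a - d]; split => //; first exact: lebesgue_measure_set1.
      by move=> x /= /negP; rewrite negbK => /eqP.
    exists [set a + d]; split => //; first exact: lebesgue_measure_set1.
    by move=> x /= /negP; rewrite negbK => /eqP.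
  apply: aeS E => x [xd1 xd2] xT.
  rewrite /Fn /F /=; have [xd|xd] := ltP `|x - a| d.
    rewrite -[X in _ --> X](mulr0 (h x)); apply: cvgMl_tmp.
    by apply: bump_to0; rewrite ygt ?cosin//; case/andP: (y01 x).
  rewrite -[X in _ --> X](mulr1 (h x)); apply: cvgMl_tmp; apply: bump_to1.
  have {}xd : d < `|x - a|.
    rewrite lt_neqAle xd andbT; apply/negP => /eqP dx.
    have [s|s] := leP 0 (x - a); move: dx; rewrite ?(ger0_norm s) ?(ltr0_norm s) => dx.
      by move: xd2; rewrite dx addrC subrK eqxx.
    by move: xd1; rewrite dx opprK addrC subrK eqxx.
  by rewrite ylt ?cosout// andbT; case/andP: (y01 x).
have iFn' n : mu.-integrable (TT : set R) (EFin \o Fn n).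
  by apply: (integrable_leR mTT (mFn' n) ih) => x _; have := dom n x; rewrite lee_fin.
have inh : mu.-integrable (TT : set R) (EFin \o (fun x => `|h x|)).
  by have H' := integrable_norm ih; exact: H'.
have domr n x : TT x -> `|Fn n x| <= `|h x| by have := dom n x; rewrite lee_fin.
have := dominated_convergenceR mTT mFn' mF inh ae1 domr.
have -> : (fun n => \int[mu]_(x in TT) (Fn n x)%:E)%E = cst 0%E.
  apply/funext => n; rewrite -[LHS]fineK; last exact: (integral_finR mTT (iFn' n)).
  by have := iFn n; rewrite /Rintegral => ->.
move=> /(cvg_unique (@ereal_hausdorff R))/(_ (cvg_cst _)) F0.
have h0 : (\int[mu]_(x in TT) (h x)%:E = 0)%E.
  rewrite -[LHS]fineK; last exact: (integral_finR mTT ih).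
  have := H (fun=> 1) (istp_cst _); rewrite /Rintegral.
  by under eq_integral do rewrite mulr1; move=> ->.
rewrite -(setIidr bT) integral_mkcondr restrict_EFin.
have e : \int[mu]_(x in TT) F x =
    \int[mu]_(x in TT) h x - \int[mu]_(x in TT) (h \_ (ball a d)) x.
  by rewrite -(RintegralBR mTT ih ib); apply: eq_Rintegral => x _; exact: FE.
rewrite -[LHS]fineK; last exact: (integral_finR mTT ib).
congr EFin; move: e; rewrite /Rintegral F0 h0 /= sub0r => /esym/eqP.
by rewrite oppr_eq0 => /eqP.
Qed.

Lemma fourier_uniqueness (g : R -> R[i]) : integC TT g ->
  (forall k, fourier g k = 0) -> aeC TT g (fun=> 0).
Proof.
move=> ig g0.
have H phi : istp (fun x => (phi x)%:C) ->
    \int[mu]_(x in TT) (ReF g x * phi x) = 0 /\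
    \int[mu]_(x in TT) (ImF g x * phi x) = 0.
  move=> tphi; have := intT_istp0 ig g0 tphi; rewrite /intT => /eqP.
  rewrite mulf_eq0 fmorph_eq0 invr_eq0 mulrn_eq0/= gt_eqF ?pi_gt0//= => /eqP.
  rewrite /intC => -[e1 e2]; split.
    by rewrite -e1; apply: eq_Rintegral => x _; rewrite /ReF ReM /= mulr0 subr0.
  by rewrite -e2; apply: eq_Rintegral => x _; rewrite /ImF ImM /= mulr0 add0r.
have h1 := real_uniqueness ig.1 (fun phi tp => (H phi tp).1).
have h2 := real_uniqueness ig.2 (fun phi tp => (H phi tp).2).
apply: aeS (aeI h1 h2) => x [e1 e2] xT; apply: complex_ext; first exact: e1.
exact: e2.
Qed.

Lemma L2T_integC (f : R -> R[i]) : L2T f -> integC TT f.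
Proof.
move=> [pf m1 m2 i2].
have i1 : mu.-integrable (TT : set R) (fun x => (1 + (ReF f x ^+ 2 + ImF f x ^+ 2))%:E).
  have i0 : mu.-integrable (TT : set R) (EFin \o cst (1 : R)).
    apply: continuous_compact_integrable; first exact: segment_compact.
    by apply: continuous_subspaceT => x; exact: cvg_cst.
  exact: (@integrable_addR _ (cst 1) (fun x => ReF f x ^+ 2 + ImF f x ^+ 2) mTT i0 i2).
have mS (h : R -> R) : measurable_fun setT h -> measurable_fun (TT : set R) (EFin \o h).
  by move=> mh; apply/measurable_EFinP; exact: measurable_funS measurableT _ mh.
split; apply: (@integrable_leR _ _ (fun x => 1 + (ReF f x ^+ 2 + ImF f x ^+ 2)) mTT _ i1);
  try exact: mS.
  move=> x _; rewrite [leRHS]ger0_norm ?addr_ge0 ?sqr_ge0//.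
  have := sqr_ge0 (`|ReF f x| - 1); have := sqr_ge0 (ImF f x); have := normr_ge0 (ReF f x).
  rewrite sqrrB1 real_normK ?num_real//; lra.
move=> x _; rewrite [leRHS]ger0_norm ?addr_ge0 ?sqr_ge0//.
have := sqr_ge0 (`|ImF f x| - 1); have := sqr_ge0 (ReF f x); have := normr_ge0 (ImF f x).
rewrite sqrrB1 real_normK ?num_real//; lra.
Qed.

Lemma fsum_fourier_ae (f : R -> R[i]) (M : R) : integC TT f ->
  (S (nf (fourier f)) <= M%:E)%E -> aeC TT f (fsum (fourier f)).
Proof.
move=> iF fM; have cf := contC_fsum fM.
have : aeC TT (fun x => f x - fsum (fourier f) x) (fun=> 0).
  apply: fourier_uniqueness => [|k]; first by apply: (integCB mTT) => //; exact: contC_TT.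
  by rewrite fourierB// ?(fourier_fsum _ fM) ?subrr//; exact: contC_TT.
by apply: aeS => x + xT => /(_ xT)/eqP; rewrite subr_eq0 => /eqP.
Qed.
End Uniqueness.

(** * Backward smoothing for the system of modes *)

Section Barrier.
Context {R : realType}.
Implicit Types (s t T : R) (k j : int).

Definition nk k : R := `|k%:~R|.
Definition jp k : R := 1 + nk k.
Definition jw s k : R := jp k `^ (- s).

Lemma nk_ge0 k : 0 <= nk k. Proof. exact: normr_ge0. Qed.
Lemma jp_ge1 k : 1 <= jp k. Proof. by rewrite lerDl nk_ge0. Qed.
Lemma jp_gt0 k : 0 < jp k. Proof. exact: lt_le_trans (jp_ge1 k). Qed.
Lemma jw_gt0 s k : 0 < jw s k. Proof. by rewrite powR_gt0 ?jp_gt0. Qed.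
Lemma nk_ge1 k : k != 0 -> 1 <= nk k.
Proof.
by move=> k0; rewrite /nk -intr_norm -[1]/(1%:~R) ler_int -gtz0_ge1 normr_gt0.
Qed.
Lemma nkB k j : nk (k - j) <= nk k + nk j.
Proof. by rewrite /nk intrB; exact: ler_normB. Qed.
Lemma nk_le k j : nk k <= nk (k - j) + nk j.
Proof. by have := ler_normD ((k - j)%:~R : R) j%:~R; rewrite -intrD subrK. Qed.
Lemma jw_half s k j : 0 <= s -> jp k <= 2 * jp j -> jw s j <= 2 `^ s * jw s k.
Proof.
move=> s0 kj; rewrite /jw !powRN -ler_pdivrMr ?invr_gt0 ?powR_gt0 ?jp_gt0//.
rewrite invrK mulrC ler_pdivrMr ?powR_gt0 ?jp_gt0// -powRM ?(ltW (jp_gt0 _))//.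
by apply: ge0_ler_powR; rewrite ?nnegrE ?mulr_ge0 ?(ltW (jp_gt0 _)).
Qed.

Lemma is_derive_inv_affine (c a b N r : R) : 1 + a * (b - r) != 0 ->
  is_derive r 1 (fun r => c * ((1 + a * (b - r))^-1 + N))
     (c * (a / (1 + a * (b - r)) ^+ 2)).
Proof.
move=> o0.
have dl : is_derive r 1 (fun r : R => 1 + a * (b - r)) (- a).
  by apply: is_derive_eq; rewrite /GRing.scale /=; ring.
have dv := @is_deriveV R (fun r : R => 1 + a * (b - r)) r (- a) 1 o0 dl.
apply: is_derive_eq; rewrite /GRing.scale /=.
by field.
Qed.

(* Backwards in time from T, [expR (- Re lam * t) * g t] dominates
   [cexp (- lam * t) * y t]; the factor 2 in the hypothesis on H pays for treating
   real and imaginary parts separately. *)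
Lemma barrier (y H : R -> R[i]) (lam : R[i]) (g g' : R -> R) T :
  contC y -> (forall t, 0 <= t <= T -> {for t, continuous g}) ->
  (forall t, 0 < t < T -> is_derC y t (lam * y t + H t)) ->
  (forall t, 0 < t < T -> is_derive t 1 g (g' t)) ->
  (forall t, 0 < t < T -> 2 * nm (H t) <= complex.Re lam * g t - g' t) ->
  nm (y T) <= g T -> forall t, 0 <= t <= T -> nm (y t) <= g t.
Proof.
move=> cy cg dy dg Hg yT t /andP[t0 tT].
pose Z t := cexp (- lam * t%:C) * y t.
pose G t := expR (- complex.Re lam * t) * g t.
have dlin (r : R) : is_derive r 1 (fun t : R => - complex.Re lam * t) (- complex.Re lam).
  by apply: is_derive_eq; rewrite /GRing.scale /= mulr1.
have dexp r : is_derC (fun t => cexp (- lam * t%:C)) r (- lam * cexp (- lam * r%:C)).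
  apply: is_derC_cexp.
  have := is_derCM (is_derC_cst (- lam) r) (is_derC_real (is_derive_id r (1 : R))).
  by rewrite mul0r add0r mulr1.
have dZ r : 0 < r < T -> is_derC Z r (cexp (- lam * r%:C) * H r).
  move=> rT; have := is_derCM (dexp r) (dy r rT).
  by congr is_derC; ring.
have dG r : 0 < r < T -> is_derive r 1 G (expR (- complex.Re lam * r) * (g' r - complex.Re lam * g r)).
  move=> rT; have := dg r rT => dgr; have := dlin r => dl.
  apply: is_derive_eq.
  by rewrite /GRing.scale /=; ring.
have cZ : contC Z.
  apply: contCM => //; apply: derivableC_cont => r; exact: is_derC_derivable (dexp r).
have cG r : 0 <= r <= T -> {for r, continuous G}.
  move=> rT; apply: cvgM; last exact: cg.
  apply: (@continuous_comp _ _ _ (fun t : R => - complex.Re lam * t) expR); last exact: continuous_expR.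
  by apply: cvgMl_tmp; exact: cvg_id.
have nmZ r : nm (Z r) = expR (- complex.Re lam * r) * nm (y r).
  by rewrite /Z nmM nm_cexp ReM ReN /= mulr0 subr0.
have key (p : R -> R) (p' : R -> R) : continuous p ->
    (forall r, 0 < r < T -> is_derive r 1 p (p' r)) ->
    (forall r, 0 < r < T -> `|p' r| <= nm (cexp (- lam * r%:C) * H r)) ->
    `|p t - p T| <= (G t - G T) / 2.
  move=> cp dp bp.
  have E r : 0 < r < T -> `|p' r| <= - (expR (- complex.Re lam * r) * (g' r - complex.Re lam * g r)) / 2.
    move=> rT; apply: (le_trans (bp r rT)).
    rewrite nmM nm_cexp ReM ReN /= mulr0 subr0.
    have := Hg r rT; have := expR_gt0 (- complex.Re lam * r); set ee := expR _; nra.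
  have mono (q : R -> R) (q' : R -> R) : (forall r, 0 <= r <= T -> {for r, continuous q}) ->
      (forall r, 0 < r < T -> is_derive r 1 q (q' r)) ->
      (forall r, 0 < r < T -> q' r <= 0) -> q T <= q t.
    move=> cq dq nq.
    apply: (@ler0_derive1_nincr _ q 0 T) => //.
    - by move=> r; rewrite in_itv /= => rT; case: (dq r rT).
    - move=> r; rewrite in_itv /= => rT; rewrite derive1E.
      by have [_ ->] := dq r rT; exact: nq.
    - apply: continuous_in_subspaceT => r /set_mem /=; rewrite in_itv /= => rT.
      exact: cq.
  have h1 : 2^-1 * G T + p T <= 2^-1 * G t + p t.
    apply: (mono (fun r => 2^-1 * G r + p r)
      (fun r => 2^-1 * (expR (- complex.Re lam * r) * (g' r - complex.Re lam * g r)) + p' r)).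
    - by move=> r rT; apply: cvgD; [apply: cvgMl_tmp; exact: cG|exact: cp].
    - move=> r rT; have d1 := dG r rT; have d2 := dp r rT.
      by apply: is_deriveD; apply: is_deriveZ.
    - move=> r rT; have := E r rT; rewrite ler_norml => /andP[_]; lra.
  have h2 : 2^-1 * G T - p T <= 2^-1 * G t - p t.
    apply: (mono (fun r => 2^-1 * G r - p r)
      (fun r => 2^-1 * (expR (- complex.Re lam * r) * (g' r - complex.Re lam * g r)) - p' r)).
    - by move=> r rT; apply: cvgB; [apply: cvgMl_tmp; exact: cG|exact: cp].
    - move=> r rT; have d1 := dG r rT; have d2 := dp r rT.
      by apply: is_deriveB; apply: is_deriveZ.
    - move=> r rT; have := E r rT; rewrite ler_norml => /andP[+ _]; lra.
  by rewrite ler_norml; lra.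
have k1 := key (ReF Z) _ cZ.1 (fun r rT => (dZ r rT).1) (fun r _ => Re_le_nm _).
have k2 := key (ImF Z) _ cZ.2 (fun r rT => (dZ r rT).2) (fun r _ => Im_le_nm _).
have ZG : nm (Z t) <= G t.
  have h1 := nm_dist (Z t) (Z T).
  have h2 := nm_le (Z t - Z T); rewrite ReD ReN ImD ImN in h2.
  have h3 : nm (Z T) <= G T by rewrite nmZ /G ler_pM2l ?expR_gt0.
  rewrite /ReF /ImF in k1 k2; lra.
by move: ZG; rewrite nmZ /G ler_pM2l ?expR_gt0.
Qed.

End Barrier.

Section SequenceLemma.
Context {R : realType}.
Implicit Types (t : R) (k j : int).
Variables (s T kap A eps : R) (P : pred int).
Variables (w H : int -> R -> R[i]) (lam : int -> R[i]) (D : R -> int -> R).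
Hypotheses (s0 : 0 <= s) (T0 : 0 < T) (kap0 : 0 < kap) (epsk : 24 * 2 `^ s * eps <= kap).
Hypothesis P0 : forall k, P k -> k != 0.
Hypothesis PB : forall k j, P k -> 2 * nk j <= nk k :> R -> P (k - j).
Hypothesis lamP : forall k, P k -> complex.Re (lam k) = kap * nk k.
Hypothesis cw : forall k, contC (w k).
Hypothesis dw : forall k, P k -> forall t, 0 < t < T ->
  is_derC (w k) t (lam k * w k t + H k t).
Hypothesis wA : forall k t, 0 <= t <= T -> nm (w k t) <= A * jw s k.
Hypothesis D0 : forall t j, 0 <= D t j.
Hypothesis DA : forall t j, 0 <= t <= T -> D t j <= A * jw s j.
Hypothesis Deps : forall t, 0 <= t <= T -> Sle (D t) eps.
Hypothesis wS : forall t, 0 <= t <= T -> Sle (fun m => nk m * nm (w m t)) A.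
Hypothesis HA : forall k t (B : R), P k -> 0 <= t <= T ->
  Sle (fun j => D t j * (nk (k - j) * nm (w (k - j) t))) B ->
  nm (H k t) <= A * jw s k + B.

Let c2 : R := 2 `^ s.
Let mu : R := kap / 2.
(* The term N makes the a priori bound wA an admissible start of the iteration
   (with constant A / N); it is sent to 0 at the end. *)
Let gN (N : R) k t : R := jw s k * ((1 + mu * nk k * (T - t))^-1 + N).

Let mu0 : 0 < mu. Proof. by rewrite divr_gt0. Qed.
Let c20 : 0 < c2. Proof. by rewrite powR_gt0. Qed.
Let A0 : 0 <= A.
Proof.
have h : 0 <= (0:R) <= T by rewrite lexx ltW.
exact: S_bound_ge0 (wS h).
Qed.
Let eps0 : 0 <= eps.
Proof.
have h : 0 <= (0:R) <= T by rewrite lexx ltW.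
exact: S_bound_ge0 (Deps h).
Qed.
Let om_ge1 k t : t <= T -> 1 <= 1 + mu * nk k * (T - t).
Proof. by move=> tT; rewrite lerDl !mulr_ge0 ?nk_ge0 ?subr_ge0// ltW. Qed.
Let gN_ge (N : R) k t : 0 <= N -> t <= T -> jw s k * N <= gN N k t.
Proof.
move=> N0 tT; rewrite /gN ler_wpM2l ?(ltW (jw_gt0 _ _))// lerDr invr_ge0.
by rewrite (le_trans _ (om_ge1 k tT)).
Qed.
Let gN_ge' (N : R) k t : 0 <= N -> t <= T -> jw s k * (1 + mu * nk k * (T - t))^-1 <= gN N k t.
Proof. by move=> N0 tT; rewrite /gN ler_wpM2l ?(ltW (jw_gt0 _ _))// lerDl. Qed.

Let A1 := (A + c2 * A * A) * (1 + mu * T).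
Let K M : R := A + 4 * A1 / kap + M / 2.

Let A10 : 0 <= A1.
Proof.
apply: mulr_ge0; last by rewrite addr_ge0// mulr_ge0// ltW.
by rewrite addr_ge0// !mulr_ge0// ltW.
Qed.

Ltac pos := repeat first [exact: nk_ge0|exact: nm_ge0|done|by apply: ltW|
  exact: ltW (jw_gt0 _ _)|apply: divr_ge0|apply: mulr_ge0|apply: addr_ge0].

(* [K M] is a constant plus [M / 2], so iterating removes the dependence on N.
   In the convolution, k - j with |j| <= |k| / 2 stays in P and uses the bound being
   improved; for the other j the decay DA of D is enough. *)
Lemma seq_improve (N M : R) : 0 < N -> 0 <= M ->
  (forall k t, P k -> 0 <= t <= T -> nm (w k t) <= M * gN N k t) ->
  (forall k t, P k -> 0 <= t <= T -> nm (w k t) <= K M * gN N k t).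
Proof.
move=> N0 M0 wM k t Pk tT.
have K0 : 0 <= K M.
  apply: addr_ge0; last by rewrite divr_ge0.
  by apply: addr_ge0 => //; apply: divr_ge0; [rewrite mulr_ge0|exact: ltW].
have n1 := @nk_ge1 R _ (P0 Pk); set n := nk k in n1.
have jk0 := jw_gt0 s k.
have n00 : 0 <= n by exact: nk_ge0.
have om r : r <= T -> 0 < 1 + mu * n * (T - r).
  by move=> rT; apply: lt_le_trans (om_ge1 k rT).
pose g' r := K M * (jw s k * (mu * n / (1 + mu * n * (T - r)) ^+ 2)).
have HB r : 0 < r < T -> nm (H k r) <= n * gN N k r * (A1 + 3 * c2 * eps * M).
  move=> /andP[r0 rT']; have rT : 0 <= r <= T by rewrite !ltW.
  have g0 : 0 <= gN N k r.
    by apply: le_trans (gN_ge k (ltW N0) (ltW rT')); rewrite mulr_ge0// ltW.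
  have near j : D r j * (nk (k - j) * nm (w (k - j) r)) <=
      (3 * c2 * (n * M * gN N k r)) * D r j + (c2 * A * jw s k) * (nk (k - j) * nm (w (k - j) r)).
    have X0 : 0 <= nk (k - j) * nm (w (k - j) r) by rewrite mulr_ge0 ?nk_ge0 ?nm_ge0.
    have D0j := D0 r j.
    have [jk|jk] := lerP (2 * nk j) (nk k : R).
      have Pkj := PB Pk jk; have h1 := wM _ _ Pkj rT.
      have h2 := @nk_le R k j; have h3 := @nkB R k j.
      rewrite -/n in h2 h3 jk.
      have h4 : jw s (k - j) <= c2 * jw s k.
        by apply: jw_half => //; rewrite /jp -/n; lra.
      have h5 : (1 + mu * nk (k - j) * (T - r))^-1 <= 2 * (1 + mu * n * (T - r))^-1.
        rewrite -[leRHS]invrK lef_pV2 ?posrE ?invr_gt0 ?mulr_gt0 ?invr_gt0 ?om ?(ltW rT')//; last first.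
          by apply: lt_le_trans (om_ge1 (k - j) (ltW rT')).
        rewrite invfM invrK; have Tr : 0 <= mu * (T - r) by rewrite mulr_ge0 ?subr_ge0 ?ltW.
        have hh : n / 2 <= nk (k - j) by lra.
        have := ler_wpM2l Tr hh; lra.
      have h6 : gN N (k - j) r <= 2 * c2 * gN N k r.
        rewrite /gN -/n.
        set o1 := (1 + mu * nk (k - j) * (T - r))^-1 in h5 *.
        set o2 := (1 + mu * n * (T - r))^-1 in h5 *.
        have o10 : 0 <= o1 by rewrite invr_ge0 (le_trans _ (om_ge1 (k - j) (ltW rT'))).
        apply: (@le_trans _ _ (c2 * jw s k * (2 * (o2 + N)))); last by lra.
        apply: ler_pM => //; [exact: ltW (jw_gt0 _ _)|by rewrite addr_ge0// ltW|lra].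
      have h7 : nk (k - j) * nm (w (k - j) r) <= 3 * c2 * (n * M * gN N k r).
        apply: (@le_trans _ _ ((3 / 2 * n) * (M * (2 * c2 * gN N k r)))); last by lra.
        apply: ler_pM; [exact: nk_ge0|exact: nm_ge0|lra|].
        by apply: le_trans h1 _; rewrite ler_wpM2l.
      rewrite -[leLHS]addr0; apply: lerD; last by pos.
      by rewrite mulrC ler_wpM2r.
    rewrite -[leLHS]add0r; apply: lerD; first by pos.
    apply: ler_wpM2r => //; apply: le_trans (DA j rT) _.
    rewrite mulrAC mulrC ler_wpM2r//; apply: jw_half => //; rewrite /jp.
    have := @nk_ge0 R j; lra.
  have S1 := S_D (S_Z (r := 3 * c2 * (n * M * gN N k r)) _ (Deps rT))
                 (S_Z (r := c2 * A * jw s k) _ (S_reindex (f := fun j => k - j) _ (wS rT))).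
  have {}S1 : Sle (fun j => D r j * (nk (k - j) * nm (w (k - j) r)))
      (3 * c2 * (n * M * gN N k r) * eps + c2 * A * jw s k * A).
    apply: S_le_trans near _; apply: S1.
    - by pos.
    - by pos.
    - by move=> x y /addrI/oppr_inj.
  apply: le_trans (HA Pk rT S1) _.
  have jg : jw s k <= n * gN N k r * (1 + mu * T).
    apply: (@le_trans _ _ (n * (jw s k * (1 + mu * n * (T - r))^-1) * (1 + mu * T))); last first.
      apply: ler_wpM2r; first by pos.
      apply: ler_wpM2l => //; exact: gN_ge' (ltW N0) (ltW rT').
    rewrite (_ : n * _ * _ = jw s k * (n * (1 + mu * T) / (1 + mu * n * (T - r)))); last by ring.
    rewrite ler_peMr ?(ltW jk0)// ler_pdivlMr ?om ?(ltW rT')// mul1r.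
    have h1 : mu * (T - r) <= mu * T by rewrite ler_wpM2l ?(ltW mu0)//; lra.
    have h2 : n * (mu * (T - r)) <= n * (mu * T) by rewrite ler_wpM2l// (le_trans _ n1).
    lra.
  have h : (A + c2 * A * A) * jw s k <= (A + c2 * A * A) * (n * gN N k r * (1 + mu * T)).
    by apply: ler_wpM2l => //; pos.
  rewrite /A1; lra.
have C1 r : 0 <= r <= T -> {for r, continuous (fun r => K M * gN N k r)}.
  move=> /andP[r0 rT]; apply: cvgMl_tmp; apply: cvgMl_tmp; apply: cvgD; last exact: cvg_cst.
  apply: cvgV; first by rewrite gt_eqF ?om.
  apply: cvgD; first exact: cvg_cst.
  by apply: cvgMl_tmp; apply: cvgB; [exact: cvg_cst|exact: cvg_id].
have C2 r : 0 < r < T -> is_derive r 1 (fun r => K M * gN N k r) (g' r).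
  move=> /andP[r0 rT'].
  have rT : r <= T by exact: ltW.
  have o0 : 1 + mu * n * (T - r) != 0 by rewrite gt_eqF// om.
  have := is_derive_inv_affine (K M * jw s k) N o0.
  rewrite /g' /gN -/n -!mulrA; under eq_fun do rewrite -mulrA.
  by [].
have C3 r : 0 < r < T -> 2 * nm (H k r) <= complex.Re (lam k) * (K M * gN N k r) - g' r.
  move=> rT; have [r0 rT'] := andP rT; rewrite (lamP Pk) -/n.
  have := HB r rT.
  have g0 : 0 <= gN N k r.
    by apply: le_trans (gN_ge k (ltW N0) (ltW rT')); rewrite mulr_ge0// ltW.
  have gg : g' r <= mu * n * (K M * gN N k r).
    rewrite /g' (mulrCA (mu * n)); apply: ler_wpM2l => //.
    apply: (@le_trans _ _ (mu * n * (jw s k * (1 + mu * n * (T - r))^-1))); last first.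
      apply: ler_wpM2l; first by pos.
      exact: gN_ge' (ltW N0) (ltW rT').
    rewrite (mulrCA (mu * n)); apply: ler_wpM2l; first by pos.
    apply: ler_wpM2l; first by pos.
    rewrite lef_pV2 ?posrE ?exprn_gt0 ?om ?(ltW rT')// expr2.
    by rewrite ler_peMl ?om_ge1 ?(ltW rT')// ltW// om ?ltW.
  have : 4 * (A1 + 3 * c2 * eps * M) <= kap * K M.
    rewrite /K; have : kap * (4 * A1 / kap) = 4 * A1 by rewrite mulrCA divff ?mulr1 ?gt_eqF.
    have : 24 * c2 * eps * M <= kap * M by rewrite ler_wpM2r.
    have : 0 <= kap * A by rewrite mulr_ge0// ltW.
    rewrite !mulrDr; lra.
  move=> hK hH.
  have ng0 : 0 <= n * gN N k r by rewrite mulr_ge0// (le_trans _ n1).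
  have h8 := ler_wpM2l ng0 hK.
  apply: (@le_trans _ _ (kap * n * (K M * gN N k r) / 2)); first by lra.
  move: gg; rewrite /mu; lra.
have C4 : nm (w k T) <= K M * gN N k T.
  have TT0 : 0 <= T <= T by rewrite ltW/=.
  apply: le_trans (wA k TT0) _.
  have : jw s k <= gN N k T.
    by have := gN_ge' k (ltW N0) (lexx T); rewrite subrr mulr0 addr0 invr1 mulr1.
  move=> h; apply: (@le_trans _ _ (A * gN N k T)); first by rewrite ler_wpM2l.
  rewrite ler_wpM2r//; first by apply: le_trans h; exact: ltW.
  by rewrite /K -addrA lerDl; pos.
exact: (barrier (cw k) C1 (dw Pk) C2 C3 C4 tT).
Qed.

Lemma seq_decay : exists B : R, forall k, P k -> nm (w k 0) * nk k <= B * jw s k.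
Proof.
pose A2 := 2 * (A + 4 * A1 / kap).
have A20 : 0 <= A2.
  apply: mulr_ge0 => //; apply: addr_ge0 => //.
  by apply: divr_ge0; [rewrite mulr_ge0|exact: ltW].
have main (N : R) k t : 0 < N -> P k -> 0 <= t <= T -> nm (w k t) <= A2 * gN N k t.
  move=> N0 Pk tT.
  have tT' : t <= T by case/andP: tT.
  have AN0 : 0 <= A / N by rewrite divr_ge0// ltW.
  have it (i : nat) k' t' : P k' -> 0 <= t' <= T ->
      nm (w k' t') <= (A2 + A / N * 2^-1 ^+ i) * gN N k' t'.
    elim: i k' t' => [|i IH] k' t' Pk' t'T.
      have [_ t'T'] := andP t'T.
      apply: le_trans (wA k' t'T) _.
      have h := gN_ge k' (ltW N0) t'T'.
      have g0 : 0 <= gN N k' t'.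
        by apply: le_trans h; rewrite mulr_ge0 ?(ltW N0) ?(ltW (jw_gt0 _ _)).
      apply: (@le_trans _ _ (A / N * gN N k' t')).
        rewrite -mulrA ler_wpM2l// ler_pdivlMl// mulrC; exact: h.
      by rewrite expr0 mulr1 ler_wpM2r// lerDr.
    have M0 : 0 <= A2 + A / N * 2^-1 ^+ i.
      by apply: addr_ge0 => //; apply: mulr_ge0 => //; rewrite exprn_ge0// invr_ge0.
    have := seq_improve N0 M0 IH Pk' t'T.
    have -> : K (A2 + A / N * 2^-1 ^+ i) = A2 + A / N * 2^-1 ^+ i.+1.
      by rewrite /K /A2 exprS; lra.
    by [].
  have lim : (fun i => (A2 + A / N * 2^-1 ^+ i) * gN N k t) @ \oo --> (A2 + A / N * 0) * gN N k t.
    apply: cvgMr_tmp; apply: cvgD; first exact: cvg_cst.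
    apply: cvgMl_tmp; apply: cvg_expr; rewrite ger0_norm ?invr_ge0//; lra.
  rewrite mulr0 addr0 in lim.
  apply: (@ler_cvg_to _ _ _ _ (fun=> nm (w k t)) _ _ _ (cvg_cst _) lim).
  by apply: nearW => i; exact: it.
have mT : 0 < mu * T by rewrite mulr_gt0.
exists (A2 / (mu * T)) => k Pk.
have n1 := @nk_ge1 R _ (P0 Pk); set n := nk k in n1 *.
have jk0 := jw_gt0 s k.
have n0 : 0 < n by apply: lt_le_trans n1.
have TT0 : 0 <= (0 : R) <= T by rewrite lexx ltW.
have om : 0 < 1 + mu * n * T by rewrite ltr_wpDr// !mulr_ge0 ?ltW.
have h : nm (w k 0) <= A2 * (jw s k * (1 + mu * n * T)^-1).
  apply/ler_addgt0Pr => e e0.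
  have c0 : 0 < A2 * jw s k + 1 by rewrite ltr_wpDl// mulr_ge0// ltW.
  have N0 : 0 < e / (A2 * jw s k + 1) by rewrite divr_gt0.
  have := main _ k 0 N0 Pk TT0; rewrite /gN subr0 -/n => /le_trans; apply.
  rewrite mulrDr [leLHS]mulrDr lerD2l mulrA mulrCA ler_piMr// ?(ltW e0)//.
  by rewrite ler_pdivrMr// mul1r lerDl.
apply: le_trans (ler_wpM2r (ltW n0) h) _.
rewrite [leLHS](_ : _ = A2 * jw s k * (n / (1 + mu * n * T))); last by ring.
rewrite [leRHS](_ : _ = A2 * jw s k * (mu * T)^-1); last by ring.
apply: ler_wpM2l; first by pos.
rewrite ler_pdivrMr// ler_pdivlMl//; lra.
Qed.
End SequenceLemma.

(** * Test functions with separated variables *)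

Section Cutoff.
Context {R : realType}.
Implicit Types (t x : R) (p : {poly R}).

Lemma polyexp_bound p (c : R) : 0 < c ->
  exists2 C : R, 0 <= C & forall z, 0 <= z -> `|p.[z]| * expR (- (c * z)) <= C.
Proof.
elim/poly_ind : p c => [|p b IH] c c0.
  by exists 0 => // z z0; rewrite horner0 normr0 mul0r.
have c2 : 0 < c / 2 by rewrite divr_gt0.
have [C C0 HC] := IH _ c2; exists (C * (2 / c) + `|b|).
  by rewrite addr_ge0// mulr_ge0// divr_ge0// ltW.
move=> z z0; rewrite hornerMXaddC.
have e1 : expR (- (c * z)) <= 1 by rewrite -expR0 ler_expR oppr_le0 mulr_ge0// ltW.
apply: (@le_trans _ _ ((`|p.[z]| * z + `|b|) * expR (- (c * z)))).
  rewrite ler_wpM2r ?expR_ge0// (le_trans (ler_normD _ _))// lerD2r normrM.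
  by rewrite (ger0_norm z0).
rewrite mulrDl; apply: lerD; last by rewrite ler_piMr.
have -> : - (c * z) = - (c / 2 * z) - (c / 2 * z) by field.
rewrite expRD mulrACA; apply: ler_pM; rewrite ?mulr_ge0 ?expR_ge0//; first exact: HC.
rewrite expRN ler_pdivrMr ?expR_gt0//.
have := expR_ge1Dx (c / 2 * z) => h; rewrite mulrC -ler_pdivrMr ?divr_gt0//.
by rewrite invf_div; apply: le_trans h; rewrite mulrC lerDr.
Qed.

Lemma is_derive_quadratic (f : R -> R) (a C : R) :
  (forall t, `|f t| <= C * (t - a) ^+ 2) -> is_derive a 1 f 0.
Proof.
move=> fC; have fa : f a = 0.
  apply/eqP; rewrite -normr_eq0 eq_le normr_ge0 andbT (le_trans (fC a))//.
  by rewrite subrr expr0n mulr0.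
have L : h^-1 *: (f (h *: 1 + a) - f a) @[h --> (0 : R)^'] --> (0 : R).
  have g : (fun h : R => C * `|h|) @ (0 : R)^' --> (0 : R).
    rewrite -[X in _ --> X](mulr0 C); apply: cvgMl_tmp.
    rewrite -[X in _ --> X](@normr0 _ R); apply: cvg_norm.
    exact: cvg_within.
  apply/cvgr0Pnorm_le => e e0; have /cvgr0Pnorm_le/(_ e e0) := g.
  apply: filterS => h; apply: le_trans.
  have [->|h0] := eqVneq h 0; first by rewrite invr0 scale0r normr0.
  have := fC (h *: 1 + a); rewrite fa subr0 addrK /GRing.scale /= mulr1 normrM => hh.
  rewrite normfV ler_pdivrMl ?normr_gt0//; apply: (le_trans hh).
  rewrite -(real_normK (num_real h)) expr2 mulrA [leLHS]mulrC.
  by apply: ler_wpM2l => //; exact: ler_norm.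
split; first by apply/cvg_ex; exists 0.
exact: (cvg_lim (@norm_hausdorff _ R)).
Qed.

Variables (a c : R).
Hypothesis c0 : 0 < c.

Definition Bp p t : R := if t < a then p.[(a - t)^-1] * expR (- (c * (a - t)^-1)) else 0.

Lemma Bp_derive p t : is_derive t 1 (Bp p) (Bp ('X^2 * (p^`() - c%:P * p)) t).
Proof.
have [ta|ta|->] := ltgtP t a.
- have at0 : a - t != 0 by rewrite gt_eqF// subr_gt0.
  apply: (@near_eq_is_derive _ _ _
    (fun t => p.[(a - t)^-1] * expR (- (c * (a - t)^-1)))).
    by near=> s; rewrite /Bp ifT//; near: s; exact: lt_nbhsl.
  have dl : is_derive t 1 (fun t : R => a - t) (- 1).
    by apply: is_derive_eq; ring.
  have dv := @is_deriveV R (fun t : R => a - t) t (- 1) 1 at0 dl.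
  have dv' : is_derive t 1 (fun t : R => (a - t)^-1) ((a - t)^-1 ^+ 2).
    by apply: is_derive_eq; rewrite /GRing.scale /= mulrNN mulr1 -exprVn.
  have d1 : is_derive t 1 (horner p \o (fun t : R => (a - t)^-1)) (p^`().[(a - t)^-1] * (a - t)^-1 ^+ 2).
    by apply: is_derive1_comp.
  have d2 : is_derive t 1 (expR \o (fun t : R => - (c * (a - t)^-1)))
      (expR (- (c * (a - t)^-1)) * (- (c * (a - t)^-1 ^+ 2))).
    apply: is_derive1_comp.
  have D := is_deriveM d1 d2; rewrite /Bp ta; apply: is_derive_eq.
  rewrite /GRing.scale /= !hornerE /=; ring.
- have -> : Bp ('X^2 * (p^`() - c%:P * p)) t = 0 by rewrite /Bp ltNge (ltW ta).
  apply: (@near_eq_is_derive _ _ _ (fun=> 0)).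
    near=> s; rewrite /Bp ltNge ifF//; apply/negbTE; rewrite negbK ltW//.
    by near: s; exact: lt_nbhsr.
- have -> : Bp ('X^2 * (p^`() - c%:P * p)) a = 0 by rewrite /Bp ltxx.
  have [C C0 HC] := polyexp_bound (p * 'X^2) c0.
  apply: (@is_derive_quadratic _ _ C) => s; rewrite /Bp; case: ltP => sa; last first.
    by rewrite normr0 mulr_ge0// sqr_ge0.
  have as0 : 0 < a - s by rewrite subr_gt0.
  have := HC (a - s)^-1; rewrite invr_ge0 (ltW as0) => /(_ isT).
  rewrite hornerM hornerXn !normrM (ger0_norm (expR_ge0 _)) => h.
  rewrite -(opprB a s) sqrrN -ler_pdivrMr ?exprn_gt0//; apply: le_trans h.
  rewrite -exprVn (ger0_norm (x := (a - s)^-1)) ?invr_ge0 ?(ltW as0)//.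
  by rewrite le_eqVlt; apply/orP; left; apply/eqP; ring.
Unshelve. all: by end_near.
Qed.

Lemma smooth_Bp p : smooth (fun t => (Bp p t)%:C).
Proof.
move=> n; elim: n p => // n IH p.
apply: (@Ck_der _ _ _ (fun t => (Bp ('X^2 * (p^`() - c%:P * p)) t)%:C)) => // t.
exact: is_derC_real (Bp_derive p t).
Qed.
End Cutoff.

Section TestFunctions.
Context {R : realType}.
Implicit Types (t x : R) (theta phi : R -> R[i]).

Lemma derivC_opp theta t : smooth theta ->
  is_derC (fun t => theta (- t)) t (- derivC theta (- t)).
Proof.
move=> th; have [h1 h2] := smooth_is_derC (- t) th.
have dN : is_derive t 1 (fun t : R => - t) (- 1) by apply: is_derive_eq.
split.
  have := @is_derive1_comp _ (ReF theta) _ _ _ _ h1 dN.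
  by rewrite mulrN1 -ReN.
have := @is_derive1_comp _ (ImF theta) _ _ _ _ h2 dN.
by rewrite mulrN1 -ImN.
Qed.

Lemma smooth_opp theta : smooth theta -> smooth (fun t => theta (- t)).
Proof.
move=> th n; elim: n theta th => // n IH theta th.
apply: (@Ck_der _ _ _ (fun t => - derivC theta (- t))).
  by move=> t; exact: derivC_opp.
under eq_fun do rewrite -mulN1r; apply: CkM; first exact: Ck_cst.
by apply: IH; exact: smooth_derivC.
Qed.

Lemma partial_t_tensor theta phi : smooth theta ->
  partial_t (fun t x => theta t * phi x) = (fun t x => derivC theta t * phi x).
Proof.
move=> th; apply/funext => t; apply/funext => x; rewrite /partial_t.
have := is_derCM (smooth_is_derC t th) (is_derC_cst (phi x) t).
by rewrite mulr0 addr0 => /is_derC_val.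
Qed.
Lemma partial_x_tensor theta phi : smooth phi ->
  partial_x (fun t x => theta t * phi x) = (fun t x => theta t * derivC phi x).
Proof.
move=> th; apply/funext => t; apply/funext => x; rewrite /partial_x.
have := is_derCM (is_derC_cst (theta t) x) (smooth_is_derC x th).
by rewrite mul0r add0r => /is_derC_val.
Qed.
Lemma continuousC2_tensor theta phi : contC theta -> contC phi ->
  continuousC2 (fun t x => theta t * phi x).
Proof.
have c1 (f : R -> R) : continuous f -> continuous (fun z : R * R => f z.1).
  by move=> cf z; apply: (@continuous_comp _ _ _ fst f); [exact: cvg_fst|exact: cf].
have c2 (f : R -> R) : continuous f -> continuous (fun z : R * R => f z.2).
  by move=> cf z; apply: (@continuous_comp _ _ _ snd f); [exact: cvg_snd|exact: cf].
move=> [t1 t2] [p1 p2]; split.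
  rewrite (_ : (fun z => _) = (fun z : R * R => ReF theta z.1 * ReF phi z.2 - ImF theta z.1 * ImF phi z.2)).
    move=> z; apply: cvgB; apply: cvgM; by [exact: c1|exact: c2].
  by apply/funext => z; rewrite ReM.
rewrite (_ : (fun z => _) = (fun z : R * R => ReF theta z.1 * ImF phi z.2 + ImF theta z.1 * ReF phi z.2)).
  move=> z; apply: cvgD; apply: cvgM; by [exact: c1|exact: c2].
by apply/funext => z; rewrite ImM.
Qed.
Lemma classC_tensor n theta phi : smooth theta -> smooth phi ->
  classC n (fun t x => theta t * phi x).
Proof.
elim: n theta phi => [|n IH] theta phi th ph /=.
  by apply: continuousC2_tensor; exact: smooth_contC.
split.
- by apply: continuousC2_tensor; exact: smooth_contC.
- move=> t x; split.
    exact: is_derC_derivable (is_derCM (smooth_is_derC t th) (is_derC_cst (phi x) t)).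
  exact: is_derC_derivable (is_derCM (is_derC_cst (theta t) x) (smooth_is_derC x ph)).
- by rewrite partial_t_tensor//; apply: IH => //; exact: smooth_derivC.
- by rewrite partial_x_tensor//; apply: IH => //; exact: smooth_derivC.
Qed.
End TestFunctions.

Section DuBois.
Context {R : realType}.
Notation mu := (@lebesgue_measure R).
Implicit Types (t x : R).

Lemma FTC2_on (F h : R -> R) (a b : R) : a < b ->
  (forall x, a <= x <= b -> is_derive x 1 F (h x)) ->
  (forall x, a <= x <= b -> {for x, continuous h}) ->
  \int[mu]_(x in `[a, b]) h x = F b - F a.
Proof.
move=> ab dF ch.
have cF x : a <= x <= b -> {for x, continuous F}.
  by move=> xab; apply: differentiable_continuous; apply/derivable1_diffP; case: (dF x xab).
rewrite /Rintegral (@continuous_FTC2 _ h F)//.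
- by apply: continuous_in_subspaceT => x /set_mem /=; rewrite in_itv /=; exact: ch.
- split; first by move=> x; rewrite in_itv /= => /andP[ax xb]; case: (dF x _) => //; rewrite !ltW.
  + by apply: cvg_at_right_filter; apply: cF; rewrite lexx ltW.
  + by apply: cvg_at_left_filter; apply: cF; rewrite lexx ltW.
- move=> x; rewrite in_itv /= => /andP[ax xb]; rewrite derive1E.
  by case: (dF x _) => //; rewrite !ltW.
Qed.

Lemma contin_integrable (h : R -> R) (a b : R) :
  (forall x, a <= x <= b -> {for x, continuous h}) ->
  mu.-integrable `[a, b] (EFin \o h).
Proof.
move=> ch; apply: continuous_compact_integrable; first exact: segment_compact.
by apply: continuous_in_subspaceT => x /set_mem /=; rewrite in_itv /=; exact: ch.
Qed.

Let q c : {poly R} := 'X^2 * ((1 : {poly R})^`() - c%:P * 1).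

Lemma Bp1E (a c t : R) : t < a -> Bp a c 1 t = expR (- (c * (a - t)^-1)).
Proof. by move=> ta; rewrite /Bp ta hornerC mul1r. Qed.
Lemma BpqE (a c t : R) : t < a ->
  Bp a c (q c) t = - (c * (a - t)^-1 ^+ 2 * expR (- (c * (a - t)^-1))).
Proof.
move=> ta; rewrite /Bp ta /q -[X in X^`()]polyC1 poly.derivC sub0r mulr1 !hornerE /=; ring.
Qed.
Lemma Bp_ge (a c p t : R) pp : a <= t -> Bp a c pp t = 0.
Proof. by move=> ta; rewrite /Bp ltNge ta. Qed.

(* The derivatives of the cutoffs [expR (- c / (a - t))] concentrate at t = a as c
   tends to 0. *)
Lemma dubois_const (z : R -> R) (a T k0 : R) : 0 < a < T ->
  (forall t, 0 <= t <= T -> {for t, continuous z}) ->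
  (forall c, 0 < c -> \int[mu]_(t in `[0, T]) (z t * Bp a c (q c) t) =
     - (k0 * Bp a c 1 0)) ->
  z a = k0.
Proof.
move=> /andP[a0 aT] cz H.
have T0 : 0 < T by exact: lt_trans aT.
set k := z a; apply/eqP; rewrite -subr_eq0 -normr_eq0 eq_le normr_ge0 andbT.
have [M0 M00 zM] : exists2 M : R, 0 <= M & forall t, 0 <= t <= T -> `|z t - k| <= M.
  have cw : {within `[0, T], continuous (fun t => z t - k)}.
    apply: continuous_in_subspaceT => x /set_mem /=; rewrite in_itv /= => xT.
    by apply: cvgB; [exact: cz|exact: cvg_cst].
  have /compact_bounded[M [M1 Mh]] := continuous_compact cw (@segment_compact _ 0 T).
  exists (`|M| + 1) => [|t tT]; first by rewrite addr_ge0.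
  apply: (Mh (`|M| + 1)); first by rewrite (le_lt_trans (ler_norm _))// ltrDl.
  by exists t => //=; rewrite in_itv.
apply/ler_addgt0Pr => e e0; rewrite add0r.
have aT' : 0 <= a <= T by rewrite !ltW.
have [d d0 zd] : exists2 d : R, 0 < d & forall t, `|t - a| < d -> `|z t - k| <= e.
  have /cvgrPdist_le/(_ e e0) := cz a aT'; move=> [d /= d0 hd].
  exists d => // t td; rewrite distrC; apply: hd; rewrite /ball /= distrC; exact: td.
pose C1 := M0 / d ^+ 2.
have C10 : 0 <= C1 by rewrite divr_ge0// sqr_ge0.
have key c : 0 < c -> `|k - k0| * Bp a c 1 0 <= e + C1 * T * c.
  move=> c0.
  have cB p : continuous (Bp a c p).
    by have [cc _] := smooth_contC (@smooth_Bp R a c c0 p).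
  have dB t : is_derive t 1 (Bp a c 1) (Bp a c (q c) t) by exact: Bp_derive.
  have iB : \int[mu]_(t in `[0, T]) Bp a c (q c) t = - Bp a c 1 0.
    by rewrite (FTC2 (ltW T0) dB (cB _)) Bp_ge ?(ltW aT)// sub0r.
  have b0 : 0 <= Bp a c 1 0 by rewrite Bp1E// expR_ge0.
  have b1 : Bp a c 1 0 <= 1.
    by rewrite Bp1E// -expR0 ler_expR oppr_le0 mulr_ge0 ?invr_ge0 ?subr_ge0// ltW.
  have i1 : mu.-integrable `[0, T] (EFin \o (fun t => z t * Bp a c (q c) t)).
    by apply: contin_integrable => t tT; apply: cvgM; [exact: cz|exact: cB].
  have i2 : mu.-integrable `[0, T] (EFin \o (fun t => k * Bp a c (q c) t)).
    by apply: contin_integrable => t tT; apply: cvgM; [exact: cvg_cst|exact: cB].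
  have i3 : mu.-integrable `[0, T] (EFin \o (fun t => (z t - k) * Bp a c (q c) t)).
    apply: contin_integrable => t tT; apply: cvgM; last exact: cB.
    by apply: cvgB; [exact: cz|exact: cvg_cst].
  have i4 : mu.-integrable `[0, T] (EFin \o (fun t => e * - Bp a c (q c) t + C1 * c)).
    apply: contin_integrable => t tT; apply: cvgD; last exact: cvg_cst.
    by apply: cvgMl_tmp; apply: cvgN; exact: cB.
  have ii : \int[mu]_(t in `[0, T]) ((z t - k) * Bp a c (q c) t) = (k - k0) * Bp a c 1 0.
    under eq_Rintegral do rewrite mulrBl.
    have mI : measurable (`[0, T]%classic : set R) by exact: measurable_itv.
    rewrite (RintegralBR mI i1 i2) H// RintegralZl//; last first.
      by apply: contin_integrable => t tT; exact: cB.
    by rewrite iB; ring.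
  have i3' : mu.-integrable `[0, T] (EFin \o (fun t => `|(z t - k) * Bp a c (q c) t|)).
    by have H' := integrable_norm i3; exact: H'.
  rewrite -[X in _ * X](ger0_norm b0) -normrM -ii.
  apply: (le_trans (le_normr_Rintegral _ i3)) => //.
  apply: (@le_trans _ _ (\int[mu]_(t in `[0, T]) (e * - Bp a c (q c) t + C1 * c))).
    apply: le_Rintegral => // t; rewrite /= in_itv /= => tT; rewrite normrM.
    have [ta|ta] := ltP t a; last by rewrite Bp_ge// normr0 mulr0 oppr0 mulr0 add0r mulr_ge0// ltW.
    have at0 : 0 < a - t by rewrite subr_gt0.
    rewrite BpqE// normrN opprK; set E := expR _.
    have E0 : 0 <= E by exact: expR_ge0.
    have E1 : E <= 1 by rewrite -expR0 ler_expR oppr_le0 mulr_ge0 ?invr_ge0// ltW.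
    have u0 : 0 <= c * (a - t)^-1 ^+ 2 * E by apply: mulr_ge0 => //; apply: mulr_ge0; [exact: ltW|exact: sqr_ge0].
    rewrite (ger0_norm u0).
    have [td|td] := ltP `|t - a| d.
      apply: (@le_trans _ _ (e * (c * (a - t)^-1 ^+ 2 * E))).
        by rewrite ler_wpM2r// zd.
      by rewrite lerDl mulr_ge0// ltW.
    apply: (@le_trans _ _ (C1 * c)); last by rewrite lerDr mulr_ge0// ltW.
    apply: (@le_trans _ _ (M0 * (c * (a - t)^-1 ^+ 2 * E))).
      by rewrite ler_wpM2r// zM.
    rewrite [leRHS](_ : _ = M0 * (c * (d ^+ 2)^-1)); last by rewrite /C1; ring.
    apply: ler_wpM2l => //; rewrite -mulrA; apply: ler_wpM2l; first exact: ltW.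
    apply: (@le_trans _ _ ((a - t)^-1 ^+ 2)); first by rewrite ler_piMr// sqr_ge0.
    rewrite exprVn lef_pV2 ?posrE ?exprn_gt0//.
    by rewrite ler_pXn2r ?nnegrE ?(ltW d0) ?(ltW at0)//; move: td; rewrite distrC gtr0_norm.
  rewrite RintegralD//=; last 2 first.
  - by apply: contin_integrable => t tT; apply: cvgMl_tmp; apply: cvgN; exact: cB.
  - by apply: contin_integrable => t tT; exact: cvg_cst.
  have iN : mu.-integrable `[0, T] (EFin \o (fun t => - Bp a c (q c) t)).
    by apply: contin_integrable => t tT; apply: cvgN; exact: cB.
  rewrite RintegralZl// Rintegral_cst//= lebesgue_measure_itv/= lte_fin T0 /= subr0.
  have -> : \int[mu]_(t in `[0, T]) - Bp a c (q c) t = Bp a c 1 0.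
    rewrite -[RHS]opprK -iB -mulN1r -RintegralZl//; last first.
      by apply: contin_integrable => t tT; exact: cB.
    by apply: eq_Rintegral => t _; rewrite mulN1r.
  have : e * Bp a c 1 0 <= e by rewrite ler_piMr// ltW.
  lra.
have key2 c : 0 < c -> `|k - k0| <= e + (C1 * T + `|k - k0| / a) * c.
  move=> c0; have := key c c0; rewrite Bp1E// subr0.
  have h := expR_ge1Dx (- (c / a)); have k00 := normr_ge0 (k - k0).
  have := ler_wpM2l k00 h; lra.
apply/ler_addgt0Pr => e' e'0.
have X0 : 0 < C1 * T + `|k - k0| / a + 1.
  apply: ltr_wpDl => //; apply: addr_ge0; first by rewrite mulr_ge0// ltW.
  by rewrite divr_ge0// ltW.
have c0 : 0 < e' / (C1 * T + `|k - k0| / a + 1) by rewrite divr_gt0.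
apply: le_trans (key2 _ c0) _; rewrite lerD2l mulrCA ler_piMr ?(ltW e'0)//.
by rewrite ler_pdivrMr// mul1r lerDl.
Qed.

Lemma dubois_real (f g : R -> R) (y0 T : R) : 0 < T -> continuous f -> continuous g ->
  (forall a c, 0 < a < T -> 0 < c ->
    \int[mu]_(t in `[0, T]) (f t * Bp a c (q c) t) + y0 * Bp a c 1 0 =
    - \int[mu]_(t in `[0, T]) (g t * Bp a c 1 t)) ->
  f 0 = y0 /\ forall t, 0 < t < T -> is_derive t 1 f (g t).
Proof.
move=> T0 cf cg H.
pose G x : R := \int[mu]_(t in `[-1, x]) g t.
have dG x : 0 <= x <= T -> is_derive x 1 G (g x).
  move=> /andP[x0 xT].
  have h1 : -1 < x by rewrite (lt_le_trans _ x0)// ltrN10.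
  have h2 : x < T + 1 by rewrite (le_lt_trans xT)// ltrDl.
  have ig : mu.-integrable `[-1, T + 1] (EFin \o g) by apply: contin_integrable => t _; exact: cg.
  have [dd ee] := continuous_FTC1_closed h2 ig h1 (cg x).
  by split; [exact: dd|rewrite -derive1E; exact: ee].
have cG x : 0 <= x <= T -> {for x, continuous G}.
  by move=> xT; apply: differentiable_continuous; apply/derivable1_diffP; case: (dG x xT).
pose z t := f t - G t.
have cz t : 0 <= t <= T -> {for t, continuous z}.
  by move=> tT; apply: cvgB; [exact: cf|exact: cG].
have zc a : 0 < a < T -> z a = y0 - G 0.
  move=> aT; apply: (dubois_const aT cz) => c c0.
  have cB p : continuous (Bp a c p).
    by have [cc _] := smooth_contC (@smooth_Bp R a c c0 p).
  have dB t : is_derive t 1 (Bp a c 1) (Bp a c (q c) t) by exact: Bp_derive.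
  have iF (F : R -> R) p : (forall t, 0 <= t <= T -> {for t, continuous F}) ->
    mu.-integrable `[0, T] (EFin \o (fun t => F t * Bp a c p t)).
    by move=> cF; apply: contin_integrable => t tT; apply: cvgM; [exact: cF|exact: cB].
  have mI : measurable (`[0, T]%classic : set R) by exact: measurable_itv.
  have e1 : \int[mu]_(t in `[0, T]) (g t * Bp a c 1 t) +
      \int[mu]_(t in `[0, T]) (G t * Bp a c (q c) t) = - (G 0 * Bp a c 1 0).
    rewrite -RintegralD//; try (by apply: iF => t _; exact: cg); last by apply: iF => t; exact: cG.
    have d1 t : 0 <= t <= T -> is_derive t 1 (fun t => G t * Bp a c 1 t)
        (g t * Bp a c 1 t + G t * Bp a c (q c) t).
      move=> tT; have d1 := dG t tT; have d2 := dB t.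
      by apply: is_derive_eq; rewrite /GRing.scale /=; ring.
    have d2 t : 0 <= t <= T ->
        {for t, continuous (fun t => g t * Bp a c 1 t + G t * Bp a c (q c) t)}.
      by move=> tT; apply: cvgD; apply: cvgM; by [exact: cg|exact: cB|exact: cG].
    rewrite (FTC2_on T0 d1 d2) (@Bp_ge a c T T) ?mulr0 ?sub0r// ltW//.
    by case/andP: aT.
  under eq_Rintegral do rewrite mulrBl.
  rewrite (RintegralBR mI); [|by apply: iF => t _; exact: cf|by apply: iF => t; exact: cG].
  have := H a c aT c0; lra.
have dfg t : 0 < t < T -> is_derive t 1 f (g t).
  move=> tT; have tT' : 0 <= t <= T by case/andP: tT => ? ?; rewrite !ltW.
  apply: (@near_eq_is_derive _ _ _ (fun t => G t + (y0 - G 0))).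
    have [t0 t1] := andP tT.
    near=> s; rewrite -(zc s) ?/z; first by rewrite addrC subrK.
    apply/andP; split; near: s; [exact: lt_nbhsr|exact: lt_nbhsl].
  have d1 := dG t tT'.
  by apply: is_derive_eq; rewrite addr0.
split => //.
have T00 : 0 <= (0 : R) <= T by rewrite lexx ltW.
have l1 : z t @[t --> (0 : R)^'+] --> z 0 by apply: cvg_at_right_filter; exact: cz.
have l2 : z t @[t --> (0 : R)^'+] --> y0 - G 0.
  apply: cvg_near_cst; near=> t; apply: zc; apply/andP; split; near: t.
    exact: nbhs_right_gt.
  exact: nbhs_right_lt.
have e : z 0 = y0 - G 0 by exact: (cvg_unique (@norm_hausdorff _ R) l1 l2).
exact: (@addIr _ (- G 0)).
Unshelve. all: by end_near.
Qed.

Lemma dubois (Y G : R -> R[i]) (y0 : R[i]) (T : R) : 0 < T -> contC Y -> contC G ->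
  (forall theta : R -> R[i], smooth theta ->
    (exists2 a, 0 < a < T & forall t, a <= t -> theta t = 0) ->
    intC `[0, T] (fun t => Y t * derivC theta t) + y0 * theta 0 =
    - intC `[0, T] (fun t => G t * theta t)) ->
  Y 0 = y0 /\ forall t, 0 < t < T -> is_derC Y t (G t).
Proof.
move=> T0 cY cG H.
have key a c : 0 < a < T -> 0 < c ->
    intC `[0, T] (fun t => Y t * (Bp a c (q c) t)%:C) + y0 * (Bp a c 1 0)%:C =
    - intC `[0, T] (fun t => G t * (Bp a c 1 t)%:C).
  move=> aT c0; rewrite -H.
  - congr (intC _ _ + _); apply/funext => t; congr (_ * _); apply/esym.
    exact: is_derC_val (is_derC_real (Bp_derive a c0 1 t)).
  - exact: smooth_Bp.
  - by exists a => // t ta; rewrite Bp_ge.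
have h1 : ReF Y 0 = complex.Re y0 /\ forall t, 0 < t < T -> is_derive t 1 (ReF Y) (ReF G t).
  apply: (dubois_real T0 cY.1 cG.1) => a c aT c0.
  have := congr1 (@complex.Re _) (key a c aT c0); rewrite ReD ReN ReM /= mulr0 subr0 => e.
  have -> : \int[mu]_(t in `[0, T]) (ReF Y t * Bp a c (q c) t) =
      \int[mu]_(t in `[0, T]) ReF (fun t => Y t * (Bp a c (q c) t)%:C) t.
    by apply: eq_Rintegral => t _; rewrite /ReF ReM /= mulr0 subr0.
  rewrite e; congr (- _); apply: eq_Rintegral => t _.
  by rewrite /ReF ReM /= mulr0 subr0.
have h2 : ImF Y 0 = complex.Im y0 /\ forall t, 0 < t < T -> is_derive t 1 (ImF Y) (ImF G t).
  apply: (dubois_real T0 cY.2 cG.2) => a c aT c0.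
  have := congr1 (@complex.Im _) (key a c aT c0); rewrite ImD ImN ImM /= mulr0 add0r => e.
  have -> : \int[mu]_(t in `[0, T]) (ImF Y t * Bp a c (q c) t) =
      \int[mu]_(t in `[0, T]) ImF (fun t => Y t * (Bp a c (q c) t)%:C) t.
    by apply: eq_Rintegral => t _; rewrite /ImF ImM /= mulr0 add0r.
  rewrite e; congr (- _); apply: eq_Rintegral => t _.
  by rewrite /ImF ImM /= mulr0 add0r.
split; first exact: complex_ext h1.1 h2.1.
by move=> t tT; split; [exact: h1.2|exact: h2.2].
Qed.
End DuBois.

(** * Sobolev weights *)

Section PSeries.
Context {R : realType}.
Implicit Types (p s M : R) (k j : int) (a b : int -> R).

Lemma sum_subset a (r W : seq int) : (forall k, 0 <= a k) -> uniq r ->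
  {subset r <= W} -> \sum_(k <- r) a k <= \sum_(k <- W) a k.
Proof.
move=> a0; elim: r W => [|k r IH] W; first by rewrite big_nil sumr_ge0.
move=> /= /andP[kr ur] rW; have kW : k \in W by apply: rW; rewrite mem_head.
rewrite big_cons (perm_big _ (perm_to_rem kW)) big_cons lerD2l; apply: IH => // j jr.
have jk : j != k by apply: contraNneq kr => <-.
have := rW j; rewrite in_cons jr orbT => /(_ isT).
by rewrite (perm_mem (perm_to_rem kW)) in_cons (negPf jk).
Qed.

Lemma S_psum a M : (forall k, 0 <= a k) -> (forall n, psum a n <= M) -> Sle a M.
Proof.
move=> a0 H; apply/S_leP => r ur.
have [n rn] : exists n, {subset r <= map Posz (iota 0 n) ++ map Negz (iota 0 n)}.
  elim: r {ur} => [|k r [n rn]]; first by exists 0%N.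
  have [m km] := mem_win k; exists (maxn n m) => j.
  have mono (l : nat) : (l <= maxn n m)%N ->
      {subset map Posz (iota 0 l) ++ map Negz (iota 0 l) <=
              map Posz (iota 0 (maxn n m)) ++ map Negz (iota 0 (maxn n m))}.
    move=> lm i; rewrite !mem_cat => /orP[] /mapP-[i' + ->]; rewrite mem_iota /= add0n => im.
      by apply/orP; left; apply/mapP; exists i' => //; rewrite mem_iota /= add0n (leq_trans im).
    by apply/orP; right; apply/mapP; exists i' => //; rewrite mem_iota /= add0n (leq_trans im).
  rewrite in_cons => /orP[/eqP ->|jr]; first exact: mono (leq_maxr _ _) _ km.
  by apply: mono (leq_maxl _ _) _ _; exact: rn.
by apply: le_trans (sum_subset a0 ur rn) _; rewrite -psumE.
Qed.

Lemma pseries_step p (x : R) : 1 < p -> 1 <= x ->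
  (p - 1) * (x + 1) `^ (- p) <= x `^ (1 - p) - (x + 1) `^ (1 - p).
Proof.
move=> p1 x1; set th := p - 1; have th0 : 0 < th by rewrite subr_gt0.
have x0 : 0 < x by apply: lt_le_trans x1.
have x10 : 0 < x + 1 by rewrite addr_gt0.
have -> : 1 - p = - th by rewrite /th; ring.
have -> : - p = - th - 1 by rewrite /th; ring.
set y := x + 1 in x10 *.
have -> : x `^ (- th) = y `^ (- th) * expR (th * ln (y / x)).
  rewrite /powR !gt_eqF// -expRD; congr expR.
  by rewrite ln_div ?posrE//; ring.
have l1 : y^-1 <= ln (y / x).
  have h : ln (x / y) <= x / y - 1.
    have := @expR_ge1Dx R (ln (x / y)); rewrite lnK ?posrE ?divr_gt0//; lra.
  have -> : ln (y / x) = - ln (x / y) by rewrite -invf_div lnV ?posrE ?divr_gt0.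
  have e : y^-1 = 1 - x / y by rewrite /y; field; rewrite gt_eqF.
  by move: h e; set l := ln _; set q := x / y; lra.
have e1 := expR_ge1Dx (th * ln (y / x)).
have y0 : 0 < y `^ (- th) by rewrite powR_gt0.
have -> : y `^ (- th - 1) = y `^ (- th) * y^-1.
  by rewrite powRB ?(gt_eqF x10) ?implybT// (powRr1 (ltW x10)).
have h := ler_wpM2l (ltW y0) e1.
have h2 := ler_wpM2l (ltW th0) l1.
have h3 := ler_wpM2l (ltW y0) h2.
lra.
Qed.

Lemma S_jw p : 1 < p -> exists C : R, Sle (jw p) C.
Proof.
move=> p1; have th0 : 0 < p - 1 by rewrite subr_gt0.
pose c (i : nat) : R := i.+1%:R `^ (- p).
have one (z : R) : (1%:R : R) `^ z = 1 by rewrite powR1.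
have H n : \sum_(0 <= i < n.+1) c i <= 1 + (1 - n.+1%:R `^ (1 - p)) / (p - 1).
  elim: n => [|n IH].
    by rewrite big_nat1 /c !one subrr mul0r addr0.
  rewrite big_nat_recr//=; apply: (le_trans (lerD IH (lexx _))).
  have n1 : 1 <= (n.+1%:R : R) by rewrite ler1n.
  have := pseries_step p1 n1; rewrite natr1 => h.
  rewrite /c -addrA lerD2l -(ler_pM2r th0) mulrDl !divfK ?gt_eqF//; lra.
have Hc n : \sum_(0 <= i < n) c i <= 1 + (p - 1)^-1.
  case: n => [|n]; first by rewrite big_geq// addr_ge0// invr_ge0 ltW.
  apply: (le_trans (H n)); rewrite lerD2l -[leRHS]mul1r.
  apply: ler_wpM2r; first by rewrite invr_ge0 ltW.
  by rewrite lerBlDr lerDl powR_ge0.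
have jpn (i : nat) : jp (Posz i) = i.+1%:R :> R.
  by rewrite /jp /nk -pmulrn normr_nat -natr1 addrC.
have jpm (i : nat) : jp (Negz i) = i.+2%:R :> R.
  by rewrite /jp /nk NegzE rmorphN normrN /= -pmulrn normr_nat -[in RHS]natr1 addrC.
exists (2 * (1 + (p - 1)^-1)); apply: S_psum => [k|n]; first exact: ltW (jw_gt0 _ _).
rewrite /psum; apply: (@le_trans _ _ (\sum_(0 <= i < n) (c i + c i))).
  apply: ler_sum => i _; rewrite /jw jpn jpm lerD2l /c !powRN.
  rewrite lef_pV2 ?posrE ?powR_gt0 ?ltr0n//.
  by apply: ge0_ler_powR; rewrite ?nnegrE// ?ler_nat// ltW// (lt_trans _ p1).
by rewrite big_split /=; have := Hc n; lra.
Qed.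

Lemma jwD s (t : R) k : jw (s + t) k = jw s k * jw t k :> R.
Proof. by rewrite /jw opprD powRD// (gt_eqF (jp_gt0 _)) implybT. Qed.
Lemma jw1 k : jw 1 k = (jp k)^-1 :> R.
Proof. by rewrite /jw powRN powRr1// ltW// jp_gt0. Qed.

Definition sw s k : R := (1 + `|k%:~R| ^+ 2) `^ s.

Lemma jw_sqr s k : (jw s k)^-1 ^+ 2 = (jp k ^+ 2) `^ s :> R.
Proof.
have j0 := ltW (@jp_gt0 R k); rewrite /jw powRN invrK !expr2.
by rewrite powRM.
Qed.

Lemma sw_le s k : 0 <= s -> sw s k <= (jw s k)^-1 ^+ 2.
Proof.
move=> s0; rewrite /sw jw_sqr.
apply: ge0_ler_powR; rewrite ?nnegrE ?powR_ge0 ?addr_ge0 ?sqr_ge0//.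
rewrite /jp /nk.
have := normr_ge0 (k%:~R : R); set n := `|_|; nra.
Qed.
Lemma sw_ge s k : 0 <= s -> (jw s k)^-1 ^+ 2 <= 2 `^ s * sw s k.
Proof.
move=> s0; rewrite /sw jw_sqr -powRM ?addr_ge0 ?sqr_ge0//.
apply: ge0_ler_powR; rewrite ?nnegrE ?powR_ge0 ?mulr_ge0 ?addr_ge0 ?sqr_ge0 ?normr_ge0//.
rewrite /jp /nk.
by have := sqr_ge0 (1 - `|k%:~R| : R); set n := `|_|; rewrite !expr2; nra.
Qed.
Lemma sw_ge0 s k : 0 <= sw s k. Proof. exact: powR_ge0. Qed.

Lemma H_pointwise s : 0 <= s -> forall (a : int -> R[i]) M,
  Sle (fun k => sw s k * nm (a k) ^+ 2) M ->
  forall k, nm (a k) <= (2 `^ s * M + 1) * jw s k.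
Proof.
move=> s0 a M aM k; have h := S_ge_term k aM; rewrite /= in h.
have j0 := jw_gt0 s k; rewrite -ler_pdivrMr//; set x := nm (a k) / jw s k.
have x2 : x ^+ 2 <= 2 `^ s * M.
  rewrite exprMn mulrC; apply: (@le_trans _ _ (2 `^ s * sw s k * nm (a k) ^+ 2)).
    by rewrite ler_wpM2r ?sqr_ge0// sw_ge.
  by rewrite -mulrA ler_wpM2l ?powR_ge0.
have := sqr_ge0 (x - 1); nra.
Qed.

Lemma H_A1 s : 3 / 2 < s -> exists2 C : R, 0 <= C & forall (a : int -> R[i]) M (m : R),
  0 < m -> Sle (fun k => sw s k * nm (a k) ^+ 2) M ->
  Sle (fun k => jp k * nm (a k)) (m * C + M / m).
Proof.
move=> s32; have s0 : 0 <= s by lra.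
have p1 : 1 < 2 * s - 2 by lra.
have [C CP] := S_jw p1.
have c20 : 0 < 2 `^ s :> R by rewrite powR_gt0.
exists (2 `^ s * C) => [|a M m m0 aM].
  by rewrite mulr_ge0 ?(ltW c20)// (S_bound_ge0 CP).
have h1 := S_Z (r := m * 2 `^ s) _ CP.
have h2 := S_Z (r := m^-1) _ aM.
have := S_D (h1 _) (h2 _); rewrite [_ * M]mulrC mulrA; move=> h3.
apply: S_le_trans (h3 _ _) => [k||]; [|by rewrite mulr_ge0// ltW|by rewrite invr_ge0 ltW].
have jk := jp_gt0 (R := R) k; have jwk := jw_gt0 s k.
set J := (jw s k)^-1; have J0 : 0 < J by rewrite invr_gt0.
have e1 : jw (2 * s - 2) k = (jp k) ^+ 2 / J ^+ 2.
  rewrite /J exprVn invrK /jw.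
  have -> : - (2 * s - 2) = - s + (- s + 2%:R) by ring.
  have e2 : jp k `^ 2 = jp k ^+ 2 := powR_mulrn 2 (ltW jk).
  rewrite powRD ?(gt_eqF jk) ?implybT// powRD ?(gt_eqF jk) ?implybT// e2; ring.
have h4 := sw_ge k s0; rewrite -/J in h4.
set x := nm (a k); have x0 : 0 <= x by exact: nm_ge0.
rewrite e1.
have -> : jp k * x = (jp k / J) * (J * x) by field; rewrite gt_eqF.
set y := jp k / J; have y0 : 0 < y by rewrite divr_gt0.
have -> : (jp k) ^+ 2 / J ^+ 2 = y ^+ 2 by rewrite /y expr_div_n.
have am : y * (J * x) <= m * 2 `^ s * y ^+ 2 + m^-1 * ((2 `^ s)^-1 * (J * x) ^+ 2).
  set c2 := 2 `^ s in c20 *; set z := J * x.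
  have mc : 0 < m * c2 by rewrite mulr_gt0.
  have -> : m^-1 * (c2^-1 * z ^+ 2) = (m * c2)^-1 * z ^+ 2 by rewrite invfM; ring.
  set q := m * c2 in mc *.
  have z0 : 0 <= z by rewrite mulr_ge0// ltW.
  have -> : q^-1 * z ^+ 2 = (z / q) ^+ 2 * q by field; rewrite gt_eqF.
  have -> : y * z = y * (z / q) * q by field; rewrite gt_eqF.
  have -> : q * y ^+ 2 + (z / q) ^+ 2 * q = (y ^+ 2 + (z / q) ^+ 2) * q by ring.
  rewrite ler_pM2r//; have := sqr_ge0 (y - z / q).
  have : 0 <= y * (z / q).
    apply: mulr_ge0; first exact: ltW.
    by apply: divr_ge0 => //; exact: ltW.
  set r := z / q; rewrite sqrrB; lra.
apply: (le_trans am); rewrite lerD2l ler_wpM2l ?invr_ge0 ?(ltW m0)//.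
by rewrite ler_pdivrMl// exprMn [leRHS]mulrA; apply: ler_wpM2r => //; exact: sqr_ge0.
Qed.

Lemma jw_H s : 0 <= s -> exists2 C : R, 0 <= C & forall (a : int -> R[i]) (g : R),
  0 <= g -> (forall k, nm (a k) <= g * jw (s + 3 / 4) k) ->
  Sle (fun k => sw s k * nm (a k) ^+ 2) (g ^+ 2 * C).
Proof.
move=> s0; have [|C CP] := @S_jw (3 / 2); first by lra.
exists C => [|a g g0 ag]; first exact: S_bound_ge0 CP.
have h := S_Z (r := g ^+ 2) _ CP; apply: S_le_trans (h _) => [k|]; last exact: sqr_ge0.
have j0 := jw_gt0 s k.
apply: (@le_trans _ _ ((jw s k)^-1 ^+ 2 * (g * jw (s + 3 / 4) k) ^+ 2)).
  apply: ler_pM; [exact: sw_ge0|exact: sqr_ge0|exact: sw_le|].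
  by rewrite ler_pXn2r ?nnegrE ?nm_ge0// mulr_ge0// ltW// jw_gt0.
rewrite jwD (_ : (3 / 2 : R) = 3 / 4 + 3 / 4); last by lra.
rewrite jwD le_eqVlt; apply/orP; left; apply/eqP; field; rewrite gt_eqF//.
Qed.

Lemma conv_jw s (A M N : R) (a b : int -> R) : 0 <= s -> 0 <= A ->
  (forall k, 0 <= a k) -> (forall k, 0 <= b k) ->
  (forall k, a k <= A * jw s k) -> (forall k, b k <= A * jw s k) ->
  Sle a M -> Sle b N ->
  forall k, Sle (fun j => a j * b (k - j)) (2 `^ s * A * (M + N) * jw s k).
Proof.
move=> s0 A0 a0 b0 aA bA aM bN k; set c2 := 2 `^ s.
have c20 : 0 < c2 by rewrite powR_gt0.
have j0 := jw_gt0 s k.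
have bN' : Sle (fun j => b (k - j)) N.
  by apply: S_reindex bN => x y /addrI/oppr_inj.
have := S_Z (r := c2 * A * jw s k) _ (S_D aM bN').
rewrite (_ : c2 * A * jw s k * (M + N) = c2 * A * (M + N) * jw s k); last by ring.
move=> h; apply: S_le_trans (h _) => [j|]; last by rewrite !mulr_ge0// ltW.
rewrite mulrDr; have aj := a0 j; have bj := b0 (k - j).
have [jk|jk] := lerP (jp k) (2 * jp j : R).
  apply: (@le_trans _ _ (c2 * A * jw s k * b (k - j))).
    rewrite ler_wpM2r//; apply: le_trans (aA j) _.
    by rewrite -mulrA mulrCA ler_wpM2l// jw_half.
  by rewrite lerDr !mulr_ge0// ltW.
apply: (@le_trans _ _ (c2 * A * jw s k * a j)).
  rewrite mulrC ler_wpM2r//; apply: le_trans (bA _) _.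
  rewrite -mulrA mulrCA ler_wpM2l// jw_half//.
  have := @nk_le R k j; move: jk; rewrite /jp; lra.
by rewrite lerDl !mulr_ge0// ltW.
Qed.

End PSeries.

Section SobolevSpace.
Context {R : realType}.
Local Notation mu := (@lebesgue_measure R).
Local Notation TT := (@TT R).
Implicit Types (f g : R -> R[i]) (s : R) (M : R) (a b : int -> R[i]).

Definition hs s a : int -> R := fun k => sw s k * nm (a k) ^+ 2.
Definition der a : int -> R[i] := fun k => 'i%C * k%:~R * a k.

Lemma hs_ge0 s a k : 0 <= hs s a k.
Proof. by rewrite mulr_ge0 ?sw_ge0 ?sqr_ge0. Qed.

Lemma nm_intr k : nm (k%:~R : R[i]) = nk k.
Proof. by rewrite -[k%:~R](rmorph_int (real_complex R)) nmR. Qed.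
Lemma nm_der a k : nm (der a k) = nk k * nm (a k).
Proof. by rewrite /der !nmM nmI mul1r nm_intr. Qed.

Lemma Sle_nf a M : Sle (fun k => jp k * nm (a k)) M -> Sle (nf a) M.
Proof.
by apply: S_le_trans => k; rewrite ler_peMl ?nm_ge0 ?jp_ge1.
Qed.
Lemma Sle_der a M : Sle (fun k => jp k * nm (a k)) M -> Sle (nf (der a)) M.
Proof.
apply: S_le_trans => k; rewrite /nf nm_der ler_wpM2r ?nm_ge0//.
by rewrite /jp lerDr.
Qed.

Lemma hsB s a b M (N : R) : Sle (hs s a) M -> Sle (hs s b) N ->
  Sle (hs s (fun k => a k - b k)) (2 * M + 2 * N).
Proof.
move=> aM bN; have h1 := S_Z (r := 2) _ aM; have h2 := S_Z (r := 2) _ bN.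
apply: S_le_trans (S_D (h1 _) (h2 _)) => // k; rewrite /hs.
have w0 := sw_ge0 s k.
have h : nm (a k - b k) ^+ 2 <= 2 * nm (a k) ^+ 2 + 2 * nm (b k) ^+ 2.
  have := nmB (a k) (b k); have := nm_ge0 (a k - b k).
  have := nm_ge0 (a k); have := nm_ge0 (b k); have := sqr_ge0 (nm (a k) - nm (b k)).
  set x := nm (a k); set y := nm (b k); set z := nm _; rewrite !expr2; nra.
by rewrite [leRHS](_ : _ = sw s k * (2 * nm (a k) ^+ 2 + 2 * nm (b k) ^+ 2)) ?ler_wpM2l//; ring.
Qed.

Lemma Hs_bound s f : Hs s f -> exists M, Sle (hs s (fourier f)) M.
Proof. by case=> _ h; apply: S_fin => // k; exact: hs_ge0. Qed.

Lemma Hs_integC s f : Hs s f -> integC TT f.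
Proof. by case=> /L2T_integC. Qed.

Lemma L2T_measC f : L2T f -> measC TT f.
Proof. by move=> /L2T_integC /integC_measC. Qed.

Lemma Hs_norm_le s f M : 0 <= M -> Sle (hs s (fourier f)) (M ^+ 2) -> Hs_norm s f <= M.
Proof.
move=> M0 h; rewrite /Hs_norm -[leRHS](ger0_norm M0) -sqrtr_sqr ler_sqrt ?sqr_ge0//.
rewrite -lee_fin fineK// ge0_fin_numE; first exact: le_lt_trans h (ltry _).
by apply: S_ge0 => k; exact: hs_ge0.
Qed.

Lemma Hs_norm_ge s f : (sobolev_sum s f < +oo)%E -> Sle (hs s (fourier f)) (Hs_norm s f ^+ 2).
Proof.
move=> h; have p0 : (0 <= sobolev_sum s f)%E by apply: S_ge0 => k; exact: hs_ge0.
rewrite /Hs_norm sqr_sqrtr ?fine_ge0// fineK ?ge0_fin_numE//.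
Qed.

Lemma fourier_sub s f g : Hs s f -> Hs s g ->
  fourier (f \- g) = (fun k => fourier f k - fourier g k).
Proof.
move=> hf hg; apply/funext => k.
by rewrite -(fourierB _ (Hs_integC hf) (Hs_integC hg)).
Qed.

Lemma Hs_distP s f g : Hs s f -> Hs s g ->
  Sle (hs s (fun k => fourier f k - fourier g k)) (Hs_norm s (f \- g) ^+ 2).
Proof.
move=> hf hg; have [M hM] := Hs_bound hf; have [N hN] := Hs_bound hg.
rewrite -(fourier_sub hf hg); apply: Hs_norm_ge.
by have := hsB hM hN; rewrite -(fourier_sub hf hg) => h; apply: le_lt_trans h (ltry _).
Qed.

Lemma Hs_dist_le s f g M : Hs s f -> Hs s g -> 0 <= M ->
  Sle (hs s (fun k => fourier f k - fourier g k)) (M ^+ 2) -> Hs_norm s (f \- g) <= M.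
Proof.
move=> hf hg M0 h; apply: Hs_norm_le => //.
by rewrite (fourier_sub hf hg).
Qed.

Lemma contC_L2T f : periodicT f -> contC f -> L2T f.
Proof.
move=> pf cf; have [c1 c2] := cf.
split => //; try exact: measurable_realfun.continuous_measurable_fun.
have := contC_integC (- pi) pi (contCM cf (f := f) cf) => _.
apply: continuous_compact_integrable; first exact: segment_compact.
apply: continuous_subspaceT => x; rewrite /comp.
by apply: cvgD; apply: cvgM => //; [exact: c1|exact: c1|exact: c2|exact: c2].
Qed.

Lemma smoothT_smooth f : smoothT f -> smooth f /\ periodicT f.
Proof. by case=> pf h; split => //; apply/smoothE. Qed.

Lemma wderiv_ae s f : 3 / 2 < s -> Hs s f ->
  measC TT (wderiv f) /\ aeC TT (wderiv f) (fsum (der (fourier f))).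
Proof.
move=> s32 hf; have [C C0 CP] := H_A1 (R := R) s32.
have [M hM] := Hs_bound hf; have {}CP := CP _ _ 1 ltr01 hM.
have a1 := Sle_nf CP; have a2 := Sle_der CP.
have ci := Hs_integC hf; have fae := fsum_fourier_ae ci a1.
have cf := contC_fsum a1; have cd := contC_fsum a2.
have e (phi : R -> R[i]) : smoothT phi ->
    intT (fun x => f x * derivC phi x) = - intT (fun x => fsum (der (fourier f)) x * phi x).
  move=> /smoothT_smooth[sp pp]; rewrite -(@fsum_parts _ _ _ _ phi (derivC phi) a1 a2)//.
  - have cp := smooth_contC (smooth_derivC sp).
    apply: intT_ae.
    + by apply: measCM; [exact: integC_measC|exact: contC_measC (@mTT R) cp].
    + exact: contC_measC (@mTT R) (contCM cf cp).
    + by apply: aeS fae => x h xT; rewrite h.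
  - by move=> x; exact: smooth_is_derC.
  - by apply: smooth_contC; exact: smooth_derivC.
have wd : weak_deriv f (fsum (der (fourier f))).
  by split => //; apply: contC_L2T => //; exact: periodic_fsum.
have [L2 H] : weak_deriv f (wderiv f) by rewrite /wderiv; case: xgetP => [h -> //|/(_ _ wd)].
have iw := L2T_integC L2.
split; first exact: L2T_measC.
have : aeC TT (fun x => wderiv f x - fsum (der (fourier f)) x) (fun=> 0).
  apply: fourier_uniqueness => [|k]; first exact: integCB (@mTT R) iw (contC_TT cd).
  rewrite fourierB//; last exact: contC_TT.
  have sk : smoothT (ek (- k) : R -> R[i]).
    by split; [exact: periodic_ek|apply/smoothE; exact: smooth_ek].
  apply/eqP; rewrite subr_eq0; apply/eqP; rewrite !fourierE; apply: oppr_inj.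
  by rewrite -H// e.
by apply: aeS => x h xT; apply/eqP; rewrite -subr_eq0 h.
Qed.
End SobolevSpace.

(** * Evolution of the Fourier coefficients of a solution *)

Section Curves.
Context {R : realType}.
Local Notation mu := (@lebesgue_measure R).
Local Notation TT := (@TT R).
Implicit Types (f g : R -> R[i]) (s e T t tau M : R).

Definition hcurve s (a : R -> int -> R[i]) :=
  (forall tau, exists M, Sle (hs s (a tau)) M) /\
  forall tau e, 0 < e -> \forall t \near tau, Sle (hs s (fun k => a t k - a tau k)) e.

Definition acurve (a : R -> int -> R[i]) :=
  (forall tau, exists M, Sle (fun k => jp k * nm (a tau k)) M) /\
  forall tau e, 0 < e -> \forall t \near tau, Sle (fun k => jp k * nm (a t k - a tau k)) e.

Definition ucurve (U : R -> R -> R[i]) := [/\ forall tau, contC (U tau),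
  forall tau, exists2 M, 0 <= M & forall x, nm (U tau x) <= M &
  forall tau e, 0 < e -> \forall t \near tau, forall x, nm (U t x - U tau x) <= e].

Lemma hcurve_acurve s a : 3 / 2 < s -> hcurve s a -> acurve a.
Proof.
move=> s32 [h1 h2]; have [C C0 CP] := H_A1 (R := R) s32.
split=> [tau|tau e e0].
  by have [M hM] := h1 tau; exists (1 * C + M / 1); exact: CP.
pose m := e / 2 / (C + 1); have C1 : 0 < C + 1 by rewrite ltr_wpDl.
have m0 : 0 < m by rewrite !divr_gt0.
have e2 : 0 < m * (e / 2) by rewrite mulr_gt0 ?divr_gt0.
near=> t; have ht : Sle (hs s (fun k => a t k - a tau k)) (m * (e / 2)).
  by near: t; exact: h2.
apply: le_trans (CP _ _ _ m0 ht) _; rewrite lee_fin.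
have -> : m * (e / 2) / m = e / 2 by rewrite mulrC mulKf// gt_eqF.
have : m * C <= e / 2.
  by rewrite /m mulrAC ler_pdivrMr// ler_wpM2l ?divr_ge0 ?(ltW e0)// lerDl.
lra.
Unshelve. all: by end_near.
Qed.

Lemma Sle0_fsumB a b M (N : R) x e : Sle (nf a) M -> Sle (nf b) N ->
  Sle (nf (fun k => a k - b k)) e -> nm (fsum a x - fsum b x) <= e.
Proof. by move=> aM bN h; rewrite -(fsumB x aM bN); exact: fsum_nm. Qed.

Lemma ucurve_fsum a : acurve a -> ucurve (fun tau => fsum (a tau)).
Proof.
move=> [h1 h2]; split=> [tau|tau|tau e e0].
- by have [M hM] := h1 tau; exact: contC_fsum (Sle_nf hM).
- have [M hM] := h1 tau; exists M => [|x]; first exact: S_bound_ge0 hM.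
  exact: fsum_nm (Sle_nf hM).
- near=> t => x; have [M hM] := h1 tau; have [N hN] := h1 t.
  apply: Sle0_fsumB (Sle_nf hN) (Sle_nf hM) _; apply: Sle_nf.
  by near: t; exact: h2.
Unshelve. all: by end_near.
Qed.

Lemma ucurve_der a : acurve a -> ucurve (fun tau => fsum (der (a tau))).
Proof.
move=> [h1 h2]; split=> [tau|tau|tau e e0].
- by have [M hM] := h1 tau; exact: contC_fsum (Sle_der hM).
- have [M hM] := h1 tau; exists M => [|x]; first exact: S_bound_ge0 hM.
  exact: fsum_nm (Sle_der hM).
- near=> t => x; have [M hM] := h1 tau; have [N hN] := h1 t.
  apply: Sle0_fsumB (Sle_der hN) (Sle_der hM) _.
  rewrite (_ : (fun k => _) = der (fun k => a t k - a tau k)); last first.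
    by apply/funext => k; rewrite /der mulrBr.
  by apply: Sle_der; near: t; exact: h2.
Unshelve. all: by end_near.
Qed.

Lemma ucurveM U V : ucurve U -> ucurve V -> ucurve (fun tau x => U tau x * V tau x).
Proof.
move=> [u1 u2 u3] [v1 v2 v3]; split=> [tau|tau|tau e e0].
- exact: contCM.
- have [M M0 hM] := u2 tau; have [N N0 hN] := v2 tau.
  exists (M * N) => [|x]; first exact: mulr_ge0.
  by rewrite nmM ler_pM ?nm_ge0.
- have [M M0 hM] := u2 tau; have [N N0 hN] := v2 tau.
  pose d := Num.min 1 (e / (M + N + 1)).
  have MN : 0 < M + N + 1 by rewrite ltr_wpDl ?addr_ge0.
  have d0 : 0 < d by rewrite lt_min ltr01 divr_gt0.
  have d1 : d <= 1 by rewrite ge_min lexx.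
  have de : d * (M + N + 1) <= e by rewrite -ler_pdivlMr// ge_min lexx orbT.
  near=> t => x.
  have hu : nm (U t x - U tau x) <= d by move: (x); near: t; exact: u3.
  have hv : nm (V t x - V tau x) <= d by move: (x); near: t; exact: v3.
  rewrite (_ : _ - _ = (U t x - U tau x) * (V t x - V tau x) +
     (U t x - U tau x) * V tau x + U tau x * (V t x - V tau x)); last by ring.
  apply: le_trans (nmD _ _) _; apply: le_trans (lerD (nmD _ _) (lexx _)) _.
  rewrite !nmM; have := hM x; have := hN x.
  have := nm_ge0 (U tau x); have := nm_ge0 (V tau x).
  have := nm_ge0 (U t x - U tau x); have := nm_ge0 (V t x - V tau x).
  move: hu hv; set p := nm (U t x - _); set q := nm (V t x - _); set r := nm (U tau x).
  set l := nm (V tau x) => *; apply: le_trans de.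
  have : p * q <= d * 1 by apply: ler_pM => //; apply: le_trans d1.
  have : p * l <= d * N by exact: ler_pM.
  have : r * q <= M * d by exact: ler_pM.
  lra.
Unshelve. all: by end_near.
Qed.

Lemma near_contC f :
  (forall tau e, 0 < e -> \forall t \near tau, nm (f t - f tau) <= e) -> contC f.
Proof.
move=> H; split=> tau; apply/cvgrPdist_le => e e0; near=> t.
  rewrite distrC /ReF -ReN -ReD; apply: le_trans (Re_le_nm _) _.
  by near: t; exact: H.
rewrite distrC /ImF -ImN -ImD; apply: le_trans (Im_le_nm _) _.
by near: t; exact: H.
Unshelve. all: by end_near.
Qed.

Lemma contC_intT U g : ucurve U -> contC g ->
  contC (fun tau => intT (fun x => U tau x * g x)).
Proof.
move=> [u1 u2 u3] cg; have [G G0 gG] := contC_bounded cg.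
have G1 : 0 < G + 1 by rewrite ltr_wpDl.
apply: near_contC => tau e e0; have d0 : 0 < e / 2 / (G + 1) by rewrite !divr_gt0.
near=> t.
have hu x : nm (U t x - U tau x) <= e / 2 / (G + 1) by move: (x); near: t; exact: u3.
rewrite -intTB; try by apply: contC_TT; exact: contCM.
have -> : e = 2 * (e / 2 / (G + 1) * (G + 1)) by field; rewrite gt_eqF.
apply: intT_bound => [|x xT]; first by apply: contC_TT; apply: contCB; exact: contCM.
rewrite -mulrBl nmM ler_pM ?nm_ge0//; apply: le_trans (gG _ xT) _; by rewrite lerDl.
Unshelve. all: by end_near.
Qed.

(* In [otime], [otimes], [ocut] and [sg], the boolean is true for the backward
   problem, which is run in the reversed time [- t]. *)
Definition clamp T t : R := Num.max 0 (Num.min t T).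
Definition otime (b : bool) T t : R := if b then - clamp T t else clamp T t.
Definition otimes (b : bool) T : set R :=
  if b then [set` `[- T, 0]] else [set` `[0, T]].
Definition sg (b : bool) : R[i] := if b then - 1 else 1.

Lemma clampP T t : 0 < T -> 0 <= clamp T t <= T.
Proof. by move=> T0; rewrite /clamp le_max lexx ge_max (ltW T0) ge_min lexx orbT. Qed.
Lemma clamp_id T t : 0 <= t <= T -> clamp T t = t.
Proof. by case/andP => t0 tT; rewrite /clamp min_l// max_r. Qed.
Lemma continuous_clamp T : continuous (clamp T).
Proof.
move=> t; apply: (@continuous_max _ _ (fun=> 0) (fun t => Num.min t T)); first exact: cvg_cst.
by apply: (@continuous_min _ _ id (fun=> T)); [exact: cvg_id|exact: cvg_cst].
Qed.
Lemma continuous_otime b T : continuous (otime b T).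
Proof.
case: b => t; rewrite /otime; last exact: continuous_clamp.
by apply: cvgN; exact: continuous_clamp.
Qed.
Lemma otime_in b T t : 0 < T -> otimes b T (otime b T t).
Proof.
move=> T0; have /andP[h1 h2] := clampP t T0.
by case: b; rewrite /otimes /otime /= in_itv /= ?lerN2 ?oppr_le0 ?h1 ?h2.
Qed.

Lemma fold_integral b T (F : R -> R[i]) : 0 < T -> contC (fun t => F (otime b T t)) ->
  intC (otimes b T) F = intC `[0, T] (fun t => F (otime b T t)).
Proof.
move=> T0 cF; case: b cF => cF.
  pose G t := F (otime true T (- t)).
  have -> : intC (otimes true T) F = intC `[- T, - 0] G.
    rewrite oppr0 /otimes; apply: eq_intC => t; rewrite /= in_itv /= => /andP[t1 t2].
    rewrite /G /otime clamp_id ?opprK//; apply/andP; split; lra.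
  have cG : contC G.
    case: cF => c1 c2; split=> t.
      by apply: (@continuous_comp _ _ _ -%R (ReF (fun t => F (otime true T t))));
        [exact: opp_continuous|exact: c1].
    by apply: (@continuous_comp _ _ _ -%R (ImF (fun t => F (otime true T t))));
        [exact: opp_continuous|exact: c2].
  have e : (fun t => F (otime true T t)) = G \o -%R.
    by apply/funext => t; rewrite /G /= opprK.
  case: cG => c1 c2; rewrite e /intC /Rintegral; congr (fine _ +i* fine _).
    have := @integration_by_substitution_oppr R (ReF G) 0 T (ltW T0).
    by apply; exact: continuous_subspaceT.
  have := @integration_by_substitution_oppr R (ImF G) 0 T (ltW T0).
  by apply; exact: continuous_subspaceT.
rewrite /otimes; apply: eq_intC => t; rewrite /= in_itv /= => tT.
by rewrite /otime clamp_id.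
Qed.

Definition ocut (b : bool) T : set R :=
  if b then [set` `]- T, 0]] else [set` `[0, T[].

Lemma derivC_otime b T (th : R -> R[i]) t : smooth th -> 0 <= t <= T ->
  let thb := fun t => th (if b then - t else t) in
  [/\ smooth thb, thb (otime b T t) = th t &
      derivC thb (otime b T t) = sg b * derivC th t].
Proof.
move=> sth tT; case: b => /=; rewrite /otime clamp_id//; last by rewrite mul1r.
split; [exact: smooth_opp|by rewrite opprK|].
by rewrite (is_derC_val (derivC_opp _ sth)) opprK mulN1r.
Qed.

Lemma test_tensor b T (th phi : R -> R[i]) : smooth th -> smooth phi -> periodicT phi ->
  (exists2 a, 0 < a < T & forall t, a <= t -> th t = 0) ->
  test_function (ocut b T) (fun t x => th (if b then - t else t) * phi x).
Proof.
move=> sth sphi pphi [a /andP[a0 aT] tha]; split.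
- move=> n; apply: (@classC_tensor _ n (fun t => th (if b then - t else t))) => //.
  by case: (b) => //; exact: smooth_opp.
- by move=> t x; rewrite pphi.
exists (if b then [set` `[- a, 0]] else [set` `[0, a]]); split.
- by case: b; exact: segment_compact.
- case: b => t /=; rewrite !in_itv /= => /andP[h1 h2].
    by rewrite h2 andbT; apply: lt_le_trans h1; rewrite ltrN2.
  by rewrite h1 (le_lt_trans h2).
- move=> t x; case: b => /=; rewrite !in_itv /= => /andP[h1 h2] h.
    rewrite tha ?mul0r// leNgt; apply/negP => ta; apply: h.
    by rewrite h2 andbT lerNl ltW.
  by rewrite tha ?mul0r// leNgt; apply/negP => ta; apply: h; rewrite h1 ltW.
Qed.

Lemma weak_evolution b T (e : R[i]) (y0 : R -> R[i]) (y N y' N' : R -> R -> R[i]) phi :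
  0 < T -> smooth phi -> periodicT phi -> integC TT y0 -> ucurve y' -> ucurve N' ->
  (forall t, measC TT (y (otime b T t)) /\ aeC TT (y (otime b T t)) (y' t)) ->
  (forall t, measC TT (N (otime b T t)) /\ aeC TT (N (otime b T t)) (N' t)) ->
  (forall chi, test_function (ocut b T) chi ->
     weak_identity (otimes b T) (- sg b) e y0 y N chi) ->
  let Y := fun t => intT (fun x => y' t x * phi x) in
  Y 0 = intT (fun x => y0 x * phi x) /\ forall t, 0 < t < T -> is_derC Y t
   (sg b * (intT (fun x => N' t x * phi x) -
            'i%C * e * intT (fun x => y' t x * derivC (derivC phi) x))).
Proof.
move=> T0 sphi pphi iy0 uy uN hy hN W Y.
have sp2 : smooth (derivC (derivC phi)) by do 2!apply: smooth_derivC.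
pose Z t := intT (fun x => y' t x * derivC (derivC phi) x).
pose NN t := intT (fun x => N' t x * phi x).
have cY : contC Y by apply: contC_intT => //; exact: smooth_contC.
have cZ : contC Z by apply: contC_intT => //; exact: smooth_contC.
have cN : contC NN by apply: contC_intT => //; exact: smooth_contC.
pose G t := sg b * (NN t - 'i%C * e * Z t).
have cG : contC G.
  apply: contCM; first exact: contC_cst.
  by apply: contCB => //; apply: contCM => //; exact: contC_cst.
apply: (dubois T0 cY cG) => th sth thT.
have key (v : R -> R -> R[i]) (v' : R -> R -> R[i]) (p : R -> R[i]) (h k : R -> R[i]) :
    ucurve v' -> contC p -> contC h -> contC k ->
    (forall t, measC TT (v (otime b T t)) /\ aeC TT (v (otime b T t)) (v' t)) ->
    (forall t, 0 <= t <= T -> h (otime b T t) = k t) ->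
    intC (otimes b T) (fun t => intT (fun x => v t x * (h t * p x))) =
    intC `[0, T] (fun t => k t * intT (fun x => v' t x * p x)).
  move=> uv cp ch ck hv hk.
  have e1 t : intT (fun x => v (otime b T t) x * (h (otime b T t) * p x)) =
      h (otime b T t) * intT (fun x => v' t x * p x).
    have [u1 _ _] := uv; have [m1 m2] := hv t.
    have cc : contC (fun x => h (otime b T t) * p x).
      by apply: contCM => //; exact: contC_cst.
    rewrite -intTZ; last by apply: contC_TT; exact: contCM.
    rewrite (@intT_ae _ _ (fun x => v' t x * (h (otime b T t) * p x))).
    - by apply: eq_intT => x; rewrite mulrCA.
    - by apply: measCM => //; exact: contC_measC (@mTT R) cc.
    - exact: contC_measC (@mTT R) (contCM (u1 t) cc).
    - by apply: aeS m2 => x hx xT; rewrite hx.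
  rewrite (fold_integral T0).
    by apply: eq_intC => t; rewrite /= in_itv /= => tT; rewrite e1 hk.
  under eq_fun do rewrite e1.
  apply: contCM; last exact: contC_intT.
  case: ch => c1 c2; split=> t.
    by apply: (@continuous_comp _ _ _ (otime b T) (ReF h));
      [exact: continuous_otime|exact: c1].
  by apply: (@continuous_comp _ _ _ (otime b T) (ImF h));
    [exact: continuous_otime|exact: c2].
pose thb t := th (if b then - t else t).
have sthb : smooth thb by rewrite /thb; case: (b) => //; exact: smooth_opp.
have sd := smooth_derivC sthb; have sdt := smooth_derivC sth.
have := W _ (test_tensor b sth sphi pphi thT); rewrite /weak_identity.
rewrite (@partial_t_tensor _ thb phi sthb) (@partial_x_tensor _ thb phi sphi).
rewrite (@partial_x_tensor _ thb _ (smooth_derivC sphi)).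
rewrite (key y y' phi (derivC thb) (fun t => sg b * derivC th t))//; first last.
- by move=> t tT; case: (derivC_otime b sth tT).
- by apply: contCM; [exact: contC_cst|exact: smooth_contC].
- exact: smooth_contC.
- exact: smooth_contC.
rewrite (key y y' _ thb th)//; first last.
- by move=> t tT; case: (derivC_otime b sth tT).
- exact: smooth_contC.
- exact: smooth_contC.
- exact: smooth_contC.
rewrite (key N N' phi thb th)//; first last.
- by move=> t tT; case: (derivC_otime b sth tT).
- exact: smooth_contC.
- exact: smooth_contC.
- exact: smooth_contC.
have -> : intT (fun x => y0 x * (th (if b then - 0 else 0) * phi x)) =
    th 0 * intT (fun x => y0 x * phi x).
  rewrite oppr0 if_same -intTZ; first by apply: eq_intT => x; rewrite mulrCA.
  by apply: integCM_cont => //; exact: smooth_contC.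
have iI (h : R -> R[i]) : contC h -> integC `[0, T] h by exact: contC_integC.
have cth := smooth_contC sth; have cdt := smooth_contC sdt.
have mI : measurable [set` `[0, T]] by exact: measurable_itv.
have -> : intC `[0, T] (fun t => sg b * derivC th t * intT (fun x => y' t x * phi x)) =
    sg b * intC `[0, T] (fun t => Y t * derivC th t).
  rewrite -intCZ//; last by apply: iI; exact: contCM.
  by apply: eq_intC => t _; rewrite -mulrA [Y t * _]mulrC.
have -> : intC `[0, T] (fun t => G t * th t) = sg b *
   (intC `[0, T] (fun t => th t * intT (fun x => N' t x * phi x)) -
    'i%C * e * intC `[0, T] (fun t => th t * Z t)).
  have i1 : integC `[0, T] (fun t => th t * NN t) by apply: iI; exact: contCM.
  have i2 : integC `[0, T] (fun t => th t * Z t) by apply: iI; exact: contCM.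
  rewrite -intCZ// -[intC _ (fun t => th t * intT _)]/(intC `[0, T] (fun t => th t * NN t)).
  rewrite -intCB//; last exact: integCZ.
  rewrite -intCZ//; last by apply: integCB => //; exact: integCZ.
  by apply: eq_intC => t _; rewrite /G; ring.
set A1 := intC _ _; set B1 := intC _ _; set C1 := intC _ _; set D1 := intT _.
have ii : 'i%C * 'i%C = - 1 :> R[i] by rewrite -expr2 sqr_i.
have ss : sg b * sg b = 1 by rewrite /sg; case: (b); rewrite ?mulN1r ?opprK ?mul1r.
move=> /(congr1 (fun z => 'i%C * sg b * z)).
have -> : 'i%C * sg b * (- 'i%C * (sg b * A1) + - sg b * 'i%C * (th 0 * D1) - e * B1) =
  - ('i%C * 'i%C) * (sg b * sg b) * (A1 + th 0 * D1) - sg b * ('i%C * e * B1) by ring.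
have -> : 'i%C * sg b * ('i%C * C1) = 'i%C * 'i%C * (sg b * C1) by ring.
rewrite ii ss => h.
have {}h : A1 + th 0 * D1 = - (sg b * C1) + sg b * ('i%C * e * B1).
  by rewrite -mulN1r -h; ring.
by rewrite [D1 * _]mulrC h; ring.
Qed.
End Curves.

Section Evolution.
Context {R : realType}.
Local Notation TT := (@TT R).
Implicit Types (f g : R -> R[i]) (s e T t tau M : R).

Lemma hcurve_of_CHs2 b s T (u : R -> R -> R[i]) (d : R -> R -> R) : 0 < T ->
  (forall t, otimes b T t -> Hs s (u t)) ->
  (forall t t', Hs_norm s (u t' \- u t) <= d t' t) ->
  (forall t, otimes b T t -> d t' t @[t' --> within (otimes b T) (nbhs t)] --> (0 : R)) ->
  hcurve s (fun t => fourier (u (otime b T t))).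
Proof.
move=> T0 hu ud cu; split=> [tau|tau e e0].
  by have [M hM] := Hs_bound (hu _ (otime_in b tau T0)); exists M.
have I0 := otime_in b tau T0; pose r := Num.sqrt e; have r0 : 0 < r by rewrite sqrtr_gt0.
have /cvgrPdist_le/(_ r r0) := cu _ I0; rewrite near_withinE => h.
have h2 := @continuous_otime R b T tau; have {h2}h := h2 _ h.
near=> t; have h1 : `|0 - d (otime b T t) (otime b T tau)| <= r.
  have : otimes b T (otime b T t) -> `|0 - d (otime b T t) (otime b T tau)| <= r.
    by near: t; exact: h.
  by apply; exact: otime_in.
apply: le_trans (Hs_distP (hu _ (otime_in b t T0)) (hu _ I0)) _.
rewrite lee_fin -(sqr_sqrtr (ltW e0)) -/r ler_pXn2r ?nnegrE ?sqrtr_ge0//.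
apply: le_trans (ud _ _) _; apply: le_trans h1.
by rewrite sub0r normrN; exact: ler_norm.
Unshelve. all: by end_near.
Qed.

Lemma fsum_ek a k M : Sle (nf a) M -> intT (fun x => fsum a x * ek (- k) x) = a k :> R[i].
Proof. by move=> aM; rewrite -(fourier_fsum k aM) fourierE. Qed.

Lemma evolution b s T (w0 : pairT R) (w : R -> pairT R) : 3 / 2 < s -> 0 < T ->
  integC TT w0.1 -> integC TT w0.2 ->
  solution s (otimes b T) (ocut b T) (- sg b) w0 w ->
  exists p q : R -> int -> R[i], [/\ hcurve s p, hcurve s q,
    p 0 = fourier w0.1, q 0 = fourier w0.2 &
    forall phi, smooth phi -> periodicT phi -> forall t, 0 < t < T ->
      is_derC (fun t => intT (fun x => fsum (p t) x * phi x)) t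
      (sg b * (intT (fun x => fsum (p t) x * fsum (q t) x * fsum (der (p t)) x * phi x) -
         'i%C * intT (fun x => fsum (p t) x * derivC (derivC phi) x)))].
Proof.
move=> s32 T0 i1 i2 [[hw cw] W].
pose u t := (w t).1; pose v t := (w t).2.
have hu t (h : otimes b T t) : Hs s (u t) := (hw t h).1.
have hv t (h : otimes b T t) : Hs s (v t) := (hw t h).2.
have np : hcurve s (fun t => fourier (u (otime b T t))).
  apply: (@hcurve_of_CHs2 _ _ _ _ (fun t' t => Hs2_dist s (w t') (w t))) => // t t'.
  by rewrite /Hs2_dist /Hs2_norm /= lerDl sqrtr_ge0.
have nq : hcurve s (fun t => fourier (v (otime b T t))).
  apply: (@hcurve_of_CHs2 _ _ _ _ (fun t' t => Hs2_dist s (w t') (w t))) => // t t'.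
  by rewrite /Hs2_dist /Hs2_norm /= lerDr sqrtr_ge0.
set p := (fun t => _) in np; set q := (fun t => _) in nq.
have ap := hcurve_acurve s32 np; have aq := hcurve_acurve s32 nq.
have up := ucurve_fsum ap; have uq := ucurve_fsum aq.
have dp := ucurve_der ap; have dq := ucurve_der aq.
have mu_ t : measC TT (u (otime b T t)) /\ aeC TT (u (otime b T t)) (fsum (p t)).
  have h := hu _ (otime_in b t T0); split; first by apply: L2T_measC; case: h.
  by have [M hM] := ap.1 t; exact: fsum_fourier_ae (Hs_integC h) (Sle_nf hM).
have mv_ t : measC TT (v (otime b T t)) /\ aeC TT (v (otime b T t)) (fsum (q t)).
  have h := hv _ (otime_in b t T0); split; first by apply: L2T_measC; case: h.
  by have [M hM] := aq.1 t; exact: fsum_fourier_ae (Hs_integC h) (Sle_nf hM).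
have mN (z : R -> R -> R[i]) (z' : R -> R -> R[i]) :
   (forall t, measC TT (z (otime b T t)) /\ aeC TT (z (otime b T t)) (z' t)) -> forall t,
   measC TT (fun x => u (otime b T t) x * v (otime b T t) x * z (otime b T t) x) /\
   aeC TT (fun x => u (otime b T t) x * v (otime b T t) x * z (otime b T t) x)
     (fun x => fsum (p t) x * fsum (q t) x * z' t x).
  move=> hz t; have [mz az] := hz t; have [m1 a1] := mu_ t; have [m2 a2] := mv_ t.
  split; first by apply: measCM => //; exact: measCM.
  by apply: aeS (aeI (aeI a1 a2) az) => x [[h1 h2] h3] xT; rewrite h1// h2// h3.
have N1 := mN (fun t => wderiv (u t)) _ (fun t => wderiv_ae s32 (hu _ (otime_in b t T0))).
have N2 := mN (fun t => wderiv (v t)) _ (fun t => wderiv_ae s32 (hv _ (otime_in b t T0))).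
have W1 phi (sphi : smooth phi) (pphi : periodicT phi) :=
  weak_evolution T0 sphi pphi i1 up (ucurveM (ucurveM up uq) dp) mu_ N1
    (fun chi tchi => (W chi tchi).1).
have W2 phi (sphi : smooth phi) (pphi : periodicT phi) :=
  weak_evolution T0 sphi pphi i2 uq (ucurveM (ucurveM up uq) dq) mv_ N2
    (fun chi tchi => (W chi tchi).2).
exists p, q; split; [exact: np|exact: nq| | |].
- apply/funext => k; have [M hM] := ap.1 0; rewrite -(fsum_ek k (Sle_nf hM)) fourierE.
  exact: (W1 _ (@smooth_ek R (- k)) (@periodic_ek R (- k))).1.
- apply/funext => k; have [M hM] := aq.1 0; rewrite -(fsum_ek k (Sle_nf hM)) fourierE.
  exact: (W2 _ (@smooth_ek R (- k)) (@periodic_ek R (- k))).1.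
move=> phi sphi pphi t tT; have [_ /(_ _ tT)] := W1 _ sphi pphi.
by rewrite mulr1.
Qed.
End Evolution.

Section Products.
Context {R : realType}.
Local Notation TT := (@TT R).
Implicit Types (f g : R -> R[i]) (s e T t tau M N A : R) (a b : int -> R[i]).

Lemma periodic_derivC f : smooth f -> periodicT f -> periodicT (derivC f).
Proof.
move=> sf pf x; have := smooth_is_derC (x + pi *+ 2) sf.
have d1 : is_derive x (1 : R) (fun y : R => y + pi *+ 2) 1.
  by apply: is_derive_eq; rewrite addr0.
case=> h1 h2; apply/esym; apply: is_derC_val; split.
  have := @is_derive1_comp _ (ReF f) (fun y => y + pi *+ 2) x _ _ h1 d1; rewrite mulr1.
  by rewrite (_ : _ \o _ = ReF f)//; apply/funext => y; rewrite /ReF /= pf.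
have := @is_derive1_comp _ (ImF f) (fun y => y + pi *+ 2) x _ _ h2 d1; rewrite mulr1.
by rewrite (_ : _ \o _ = ImF f)//; apply/funext => y; rewrite /ImF /= pf.
Qed.

Lemma smooth_decay f s : smooth f -> periodicT f ->
  exists2 C : R, 0 <= C & forall k, nm (fourier f k) <= C * jw s k.
Proof.
have H n : forall f, smooth f -> periodicT f ->
    exists2 C : R, 0 <= C & forall k, jp k ^+ n * nm (fourier f k) <= C.
  elim: n => [|n IH] {}f sf pf.
    have cf := smooth_contC sf; have [B B0 fB] := contC_bounded cf.
    exists (2 * B) => [|k]; first exact: mulr_ge0.
    by rewrite expr0 mul1r; apply: fourier_bound => //; exact: contC_TT.
  have sd := smooth_derivC sf.
  have [C C0 CP] := IH _ sf pf; have [D D0 DP] := IH _ sd (periodic_derivC sf pf).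
  exists (C + D) => [|k]; first exact: addr_ge0.
  have := DP k; rewrite (@fourier_der _ f)//; [|by move=> x; exact: smooth_is_derC|exact: smooth_contC].
  rewrite -/(der (fourier f) k) nm_der => h; have := CP k.
  by rewrite exprSr -!mulrA {2}/jp mulrDl mul1r mulrDr => h1; exact: lerD.
move=> sf pf; have [n sn] : exists n : nat, s <= n%:R.
  exists (Num.truncn `|s|).+1; apply: le_trans (ler_norm s) _.
  by apply: ltW; exact: truncnS_gt.
have [C C0 CP] := H n f sf pf; exists C => // k; rewrite /jw powRN.
rewrite ler_pdivlMr ?powR_gt0 ?jp_gt0// mulrC; apply: le_trans (CP k).
by rewrite ler_wpM2r ?nm_ge0// -powR_mulrn ?ler_powR ?jp_ge1// ltW// jp_gt0.
Qed.

Lemma smooth_summable f : smooth f -> periodicT f -> exists M, Sle (nf (fourier f)) M.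
Proof.
move=> sf pf; have [C C0 CP] := smooth_decay 2 sf pf.
have [D DP] : exists D : R, Sle (jw 2) D by apply: S_jw; lra.
exists (C * D); have h := S_Z (r := C) _ DP; exact: S_le_trans (h _).
Qed.

Lemma S_prod a g M N : Sle (nf a) M -> contC g -> Sle (nf (fourier g)) N ->
  Sle (nf (fourier (fun x => fsum a x * g x))) (M * N).
Proof.
move=> aM cg gN.
have a0 k : 0 <= nf a k by exact: nm_ge0.
have g0 k : 0 <= nf (fourier g) k by exact: nm_ge0.
have c0 k j : 0 <= nf a j * nf (fourier g) (k - j) by rewrite mulr_ge0.
have h := S_conv a0 g0 aM gN; apply: le_trans h.
have [B B0 aB] : exists2 B, 0 <= B & forall k, nf a k <= B.
  by exists M => [|k]; [exact: S_bound_ge0 aM|exact: S_ge_term aM].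
apply: le_esum => k _.
have fin : (S (fun j => (nf a j * nf (fourier g) (k - j))%R) < +oo)%E.
  have := S_Z (r := B) B0 (S_reindex (f := fun j => k - j) _ gN) => h.
  apply: le_lt_trans (ltry (B * N)); apply: S_le_trans (h _) => [j|x y /addrI/oppr_inj//].
  by rewrite ler_wpM2r.
have [L LP] := S_fin fin (c0 k).
have f0 := S_ge0 (c0 k).
rewrite -(fineK (x := S _)); last by rewrite ge0_fin_numE.
rewrite lee_fin; apply: fourier_prod aM cg _.
by rewrite fineK ?ge0_fin_numE.
Qed.

Lemma jw_prod s A M N a g : 0 <= s -> 0 <= A -> contC g ->
  (forall k, nf a k <= A * jw s k) -> (forall k, nf (fourier g) k <= A * jw s k) ->
  Sle (nf a) M -> Sle (nf (fourier g)) N ->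
  forall k, nm (fourier (fun x => fsum a x * g x) k) <= 2 `^ s * A * (M + N) * jw s k.
Proof.
move=> s0 A0 cg aA gA aM gN k; apply: (fourier_prod aM cg).
by apply: (@conv_jw _ s A M N (nf a) (nf (fourier g))) => // j; exact: nm_ge0.
Qed.

Lemma Sle_near M N a b : Sle (nf a) M -> Sle (nf (fun k => b k - a k)) N -> Sle (nf b) (M + N).
Proof. by move=> h1 h2; apply: S_le_trans (S_D h1 h2) => k; rewrite /nf nm_dist. Qed.

Lemma small_time s e (p : R -> int -> R[i]) : 3 / 2 < s -> hcurve s p -> 0 < e ->
  exists2 A, 0 <= A & \forall t \near (0 : R),
   [/\ forall k, nf (p t) k <= A * jw s k, Sle (fun k => jp k * nm (p t k)) A &
       Sle (nf (fun k => p t k - p 0 k)) e].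
Proof.
move=> s32 hp e0; have s0 : 0 <= s by lra.
have [a1 a2] := hcurve_acurve s32 hp; have [h1 h2] := hp.
have [M hM] := a1 0; have [N hN] := h1 0.
have M0 := S_bound_ge0 hM; have N0 := S_bound_ge0 hN.
have c0 : 0 <= 2 `^ s :> R by exact: powR_ge0.
pose A := M + e + ((2 `^ s * N + 1) + (2 `^ s * 1 + 1)).
have k0 : 0 <= (2 `^ s * N + 1) + (2 `^ s * 1 + 1) by rewrite !addr_ge0 ?mulr_ge0.
exists A; first by rewrite !addr_ge0 ?mulr_ge0 ?(ltW e0).
near=> t.
have d1 : Sle (hs s (fun k => p t k - p 0 k)) 1 by near: t; exact: h2.
have d2 : Sle (fun k => jp k * nm (p t k - p 0 k)) e by near: t; exact: a2.
split=> [k||]; last exact: Sle_nf.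
  have j0 := jw_gt0 s k; have := H_pointwise s0 hN k; have := H_pointwise s0 d1 k.
  have := nm_dist (p t k) (p 0 k); rewrite /nf /A.
  have : 0 <= (M + e) * jw s k by rewrite mulr_ge0 ?addr_ge0 ?(ltW j0) ?(ltW e0).
  lra.
apply: S_le_trans (S_le_trans (fun k => lexx _) _); last first.
  apply: le_trans (S_D hM d2) _; rewrite lee_fin /A; lra.
by move=> k; rewrite /= -mulrDr ler_wpM2l ?nm_dist// ltW// jp_gt0.
Unshelve. all: by end_near.
Qed.
End Products.

(** * The gauge transform *)

Section Gauge.
Context {R : realType}.
Local Notation TT := (@TT R).
Implicit Types (f g : R -> R[i]) (s e T t tau M N A : R) (a b : int -> R[i]) (k : int).

Lemma intT_lin3 (z1 z2 z3 : R[i]) f g h : contC f -> contC g -> contC h ->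
  intT (fun x => z1 * f x + z2 * g x + z3 * h x) = z1 * intT f + z2 * intT g + z3 * intT h.
Proof.
move=> cf cg ch; have iZ (z : R[i]) (u : R -> R[i]) : contC u -> contC (fun x => z * u x).
  by apply: contCM; exact: contC_cst.
have c1 := iZ z1 _ cf; have c2 := iZ z2 _ cg; have c3 := iZ z3 _ ch.
rewrite (intTD (contC_TT (contCD c1 c2)) (contC_TT c3)) (intTD (contC_TT c1) (contC_TT c2)).
by rewrite !intTZ//; exact: contC_TT.
Qed.

Lemma derivC_M_ek g k : smooth g -> derivC (fun x => g x * ek (- k) x) =
  (fun x => (derivC g x - 'i%C * k%:~R * g x) * ek (- k) x) :> (R -> R[i]).
Proof.
move=> sg; apply/funext => x.
have := is_derCM (smooth_is_derC x sg) (is_derC_ek (- k) x).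
by move/is_derC_val => ->; rewrite rmorphN /=; ring.
Qed.

Lemma fourier_parts a M N g k : Sle (nf a) M -> Sle (nf (der a)) N ->
  smooth g -> periodicT g ->
  fourier (fun x => fsum (der a) x * g x) k =
  'i%C * k%:~R * fourier (fun x => fsum a x * g x) k - fourier (fun x => fsum a x * derivC g x) k.
Proof.
move=> aM dN sg pg; have ca := contC_fsum aM; have cg := smooth_contC sg.
have cdg := smooth_contC (smooth_derivC sg).
have sge : smooth (fun x => g x * ek (- k) x) by apply: smoothM => //; exact: smooth_ek.
have cek : contC (ek (- k) : R -> R[i]) by exact: contC_ek.
have pge : periodicT (fun x => g x * ek (- k) x) by apply: periodicM => //; exact: periodic_ek.
have := @fsum_parts _ _ _ _ (fun x => g x * ek (- k) x) _ aM dN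
  (fun x => smooth_is_derC x sge) (smooth_contC (smooth_derivC sge)) pge.
rewrite !fourierE (derivC_M_ek k sg) => h.
transitivity (intT (fun x => fsum (der a) x * (g x * ek (- k) x))).
  by apply: eq_intT => x; rewrite mulrA.
have c1 := contCM (contCM ca cg) cek; have c2 := contCM (contCM ca cdg) cek.
rewrite -[LHS]opprK -h; apply: (@etrans _ _ (- intT (fun x => 1 * (fsum a x * derivC g x * ek (- k) x) +
   - ('i%C * k%:~R) * (fsum a x * g x * ek (- k) x) + 0 * (fsum a x * g x * ek (- k) x)))).
  by congr (- _); apply: eq_intT => x; ring.
by rewrite (intT_lin3 _ _ _ c2 c1 c1); ring.
Qed.

(* The terms containing [k * fourier (U * E')] produced by the commutator with the
   second derivative and by the principal part PQ - c of the transport term cancel. *)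
Lemma fourier_gauge a M N (V PQ E : R -> R[i]) (c : R[i]) k :
  Sle (nf a) M -> Sle (nf (der a)) N -> contC V -> contC PQ -> smooth E -> periodicT E ->
  (forall x, derivC E x = 'i%C / 2 * (PQ x - c) * E x) ->
  let U := fsum a in let phi := fun x => E x * ek (- k) x in
  intT (fun x => U x * V x * fsum (der a) x * phi x) -
    'i%C * intT (fun x => U x * derivC (derivC phi) x) =
  'i%C * (k%:~R ^+ 2 + c * k%:~R) * fourier (fun x => U x * E x) k +
  ('i%C * fourier (fun x => U x * derivC (derivC E) x) k - c * fourier (fun x => U x * derivC E x) k
   + fourier (fun x => (U x * V x - PQ x) * (fsum (der a) x * E x)) k).
Proof.
move=> aM dN cV cPQ sE pE EE U phi.
have sE1 := smooth_derivC sE; have sE2 := smooth_derivC sE1.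
have pE1 := periodic_derivC sE pE.
have cE := smooth_contC sE; have cE1 := smooth_contC sE1; have cE2 := smooth_contC sE2.
have cU : contC U := contC_fsum aM; have cD := contC_fsum dN.
have cek : contC (ek (- k) : R -> R[i]) by exact: contC_ek.
have c0 := contCM (contCM cU cE) cek; have c1 := contCM (contCM cU cE1) cek.
have c2 := contCM (contCM cU cE2) cek.
have h1 := fourier_parts k aM dN sE pE; have h2 := fourier_parts k aM dN sE1 pE1.
have L1 : intT (fun x => U x * derivC (derivC phi) x) =
   fourier (fun x => U x * derivC (derivC E) x) k
   - 2 * 'i%C * k%:~R * fourier (fun x => U x * derivC E x) k
   - k%:~R ^+ 2 * fourier (fun x => U x * E x) k.
  have sg : smooth (fun x => derivC E x - 'i%C * k%:~R * E x).
    rewrite (_ : (fun x => _) = (fun x => derivC E x + (- ('i%C * k%:~R)) * E x)).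
      by apply: smoothD => //; apply: smoothM => //; exact: smooth_cst.
    by apply/funext => x; rewrite mulNr.
  rewrite /phi (derivC_M_ek k sE) (derivC_M_ek k sg) !fourierE.
  have -> : derivC (fun x => derivC E x - 'i%C * k%:~R * E x) =
      (fun x => derivC (derivC E) x - 'i%C * k%:~R * derivC E x).
    apply/funext => x; have := is_derCM (is_derC_cst (- ('i%C * k%:~R)) x) (smooth_is_derC x sE).
    move/(is_derCD (smooth_is_derC x sE1)) => h; apply: is_derC_val.
    rewrite (_ : (fun x => _) = (fun x => derivC E x + (- ('i%C * k%:~R)) * E x)).
      by move: h; rewrite mul0r add0r mulNr.
    by apply/funext => y; rewrite mulNr.
  apply: (@etrans _ _ (intT (fun x => 1 * (U x * derivC (derivC E) x * ek (- k) x) +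
     - (2 * 'i%C * k%:~R) * (U x * derivC E x * ek (- k) x) +
     'i%C ^+ 2 * k%:~R ^+ 2 * (U x * E x * ek (- k) x)))).
    by apply: eq_intT => x; ring.
  rewrite (intT_lin3 1 (- (2 * 'i%C * k%:~R)) ('i%C ^+ 2 * k%:~R ^+ 2) c2 c1 c0) sqr_i.
  by move: (intT _) (intT _) (intT _) => J0 J1 J2; ring.
have L2 : intT (fun x => U x * V x * fsum (der a) x * phi x) =
   fourier (fun x => (U x * V x - PQ x) * (fsum (der a) x * E x)) k +
   (- 2 * 'i%C * fourier (fun x => fsum (der a) x * derivC E x) k +
    c * fourier (fun x => fsum (der a) x * E x) k).
  rewrite !fourierE.
  have d0 := contCM (contCM (contCB (contCM cU cV) cPQ) (contCM cD cE)) cek.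
  have d1 := contCM (contCM cD cE1) cek; have d2 := contCM (contCM cD cE) cek.
  apply: (@etrans _ _ (intT (fun x =>
     1 * ((U x * V x - PQ x) * (fsum (der a) x * E x) * ek (- k) x) +
     - 2 * 'i%C * (fsum (der a) x * derivC E x * ek (- k) x) +
     c * (fsum (der a) x * E x * ek (- k) x)))).
    apply: eq_intT => x; rewrite EE /phi.
    have -> : - 2 * 'i%C * (fsum (der a) x * ('i%C / 2 * (PQ x - c) * E x) * ek (- k) x) =
      - 'i%C ^+ 2 * ((PQ x - c) * (fsum (der a) x * E x * ek (- k) x)) by field.
    rewrite sqr_i; ring.
  by rewrite (intT_lin3 _ _ _ d0 d1 d2); ring.
rewrite L1 L2 h1 h2 -/U.
set w := fourier (fun x => U x * E x) k; set w1 := fourier _ k; set w2 := fourier _ k.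
ring.
Qed.
End Gauge.

Section CoreBounds.
Context {R : realType}.
Local Notation TT := (@TT R).
Implicit Types (f g : R -> R[i]) (s e T t tau M N A : R) (a b : int -> R[i]) (k j : int).

Lemma smooth_mul s A g : 0 <= s -> 0 <= A -> smooth g -> periodicT g ->
  exists2 C, 0 <= C & forall a, (forall k, nf a k <= A * jw s k) -> Sle (nf a) A ->
    (forall k, nm (fourier (fun x => fsum a x * g x) k) <= C * jw s k) /\
    Sle (nf (fourier (fun x => fsum a x * g x))) C.
Proof.
move=> s0 A0 sg_ pg; have [C C0 CP] := smooth_decay s sg_ pg.
have [M hM] := smooth_summable sg_ pg; have M0 := S_bound_ge0 hM.
have cg := smooth_contC sg_; pose K := 2 `^ s * (A + C) * (A + M).
have K0 : 0 <= K by rewrite /K !mulr_ge0 ?addr_ge0 ?powR_ge0.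
have L0 : 0 <= A * M by rewrite mulr_ge0.
exists (K + A * M) => [|a aA aM]; first exact: addr_ge0.
split=> [k|].
  have j0 k' := ltW (jw_gt0 s k').
  apply: (@le_trans _ _ (K * jw s k)); last by rewrite ler_wpM2r// lerDl.
  apply: jw_prod => // [|k'|k']; first exact: addr_ge0.
    by apply: le_trans (aA k') _; rewrite ler_wpM2r// lerDl.
  by apply: le_trans (CP k') _; rewrite ler_wpM2r// lerDr.
apply: le_trans (S_prod aM cg hM) _; by rewrite lee_fin lerDr.
Qed.

Lemma smooth_fsum_ae f : smooth f -> periodicT f -> aeC TT f (fsum (fourier f)).
Proof.
move=> sf pf; have [M hM] := smooth_summable sf pf.
by apply: fsum_fourier_ae hM; apply: contC_TT; exact: smooth_contC.
Qed.

Lemma delta_bound s (P Q : R -> R[i]) A e Mp Mq : 0 <= s -> 0 <= A ->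
  smooth P -> periodicT P -> smooth Q -> periodicT Q ->
  Sle (nf (fourier P)) Mp -> Sle (nf (fourier Q)) Mq ->
  exists2 C, 0 <= C & forall (p q : int -> R[i]),
    (forall k, nf p k <= A * jw s k) -> (forall k, nf q k <= A * jw s k) ->
    Sle (nf p) A -> Sle (nf (fun k => p k - fourier P k)) (2 * e) ->
    Sle (nf (fun k => q k - fourier Q k)) e ->
    let d := fourier (fun x => fsum p x * fsum q x - P x * Q x) in
    (forall k, nm (d k) <= C * jw s k) /\ Sle (nf d) (2 * e * (Mq + e) + e * Mp).
Proof.
move=> s0 A0 sP pP sQ pQ hP hQ.
have [CP CP0 dP] := smooth_decay s sP pP; have [CQ CQ0 dQ] := smooth_decay s sQ pQ.
have j0 k' := ltW (jw_gt0 s k'); have cP := smooth_contC sP; have cQ := smooth_contC sQ.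
pose A3 := A + CP + CQ; have A30 : 0 <= A3 by rewrite !addr_ge0.
pose C := 2 `^ s * A3 * (2 * e + (Mq + e)) + 2 `^ s * A3 * (e + Mp).
exists `|C| => // p q pA qA pM he1 he2 d.
have qM : Sle (nf q) (Mq + e) by exact: Sle_near hQ he2.
have cp := contC_fsum pM; have cq := contC_fsum qM.
have c1 := contC_fsum he1; have c2 := contC_fsum he2.
have fq : fourier (fsum q) = q by apply/funext => k; rewrite (fourier_fsum _ qM).
pose d1 := fourier (fun x => fsum (fun k => p k - fourier P k) x * fsum q x).
pose d2 := fourier (fun x => fsum (fun k => q k - fourier Q k) x * P x).
have dE k : d k = d1 k + d2 k.
  rewrite /d1 /d2 -fourierD; try exact: (contC_TT (contCM _ _)).
  apply: fourier_ae.
  - exact: contC_measC (@mTT R) (contCB (contCM cp cq) (contCM cP cQ)).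
  - exact: contC_measC (@mTT R) (contCD (contCM c1 cq) (contCM c2 cP)).
  - apply: aeS (aeI (smooth_fsum_ae sP pP) (smooth_fsum_ae sQ pQ)) => x [h1 h2] xT.
    rewrite (fsumB x pM hP) (fsumB x qM hQ) -(h1 xT) -(h2 xT).
    by move: (fsum p x) (fsum q x) (P x) (Q x) => x1 x2 x3 x4; ring.
split=> [k|].
  apply: (@le_trans _ _ (C * jw s k)); last by rewrite ler_wpM2r// ler_norm.
  rewrite dE mulrDl; apply: le_trans (nmD _ _) _; apply: lerD.
    apply: jw_prod => //; last by rewrite fq.
      move=> k'; apply: le_trans (nmB _ _) _; rewrite /A3 !mulrDl.
      by apply: le_trans (lerD (pA k') (dP k')) _; rewrite lerDl mulr_ge0.
    move=> k'; rewrite fq; apply: le_trans (qA k') _; rewrite ler_wpM2r// /A3; lra.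
  apply: jw_prod => //.
    move=> k'; apply: le_trans (nmB _ _) _; rewrite /A3 !mulrDl.
    apply: le_trans (lerD (qA k') (dQ k')) _; rewrite lerD2r lerDl mulr_ge0//.
  move=> k'; apply: le_trans (dP k') _; rewrite ler_wpM2r// /A3; lra.
have h1 : Sle (nf d1) (2 * e * (Mq + e)) by apply: S_prod => //; rewrite fq.
have h2 : Sle (nf d2) (e * Mp) by exact: S_prod.
by apply: S_le_trans (S_D h1 h2) => k; rewrite /nf dE nmD.
Qed.

Lemma remainder_bound s A C (E d : R -> R[i]) a M N B k : 0 <= s -> 0 <= C ->
  smooth E -> periodicT E -> contC d ->
  Sle (nf a) M -> Sle (nf (der a)) N -> 
  (forall j, nm (fourier d j) <= C * jw s j) -> Sle (nf (fourier d)) A ->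
  (forall j, nm (fourier (fun x => fsum a x * derivC E x) j) <= C * jw s j) ->
  Sle (nf (fourier (fun x => fsum a x * derivC E x))) C ->
  Sle (fun j => nm (fourier d j) *
    (nk (k - j) * nm (fourier (fun x => fsum a x * E x) (k - j)))) B ->
  nm (fourier (fun x => d x * (fsum (der a) x * E x)) k) <=
  2 `^ s * C * (A + C) * jw s k + B.
Proof.
move=> s0 C0 sE pE cd aM aN dC dA eC eS hB.
have cX : contC (fun x => fsum (der a) x * E x).
  by apply: contCM (contC_fsum aN) _; exact: smooth_contC.
rewrite (@fourier_ae _ _ (fun x => fsum (fourier d) x * (fsum (der a) x * E x))); last first.
- by apply: aeS (fsum_fourier_ae (contC_TT cd) dA) => x h xT; rewrite h.
- exact: contC_measC (@mTT R) (contCM (contC_fsum dA) cX).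
- exact: contC_measC (@mTT R) (contCM cd cX).
apply: (fourier_prod dA cX).
have h := @conv_jw _ s C A C (nf (fourier d)) _ s0 C0 (fun=> nm_ge0 _) (fun=> nm_ge0 _)
  dC eC dA eS k.
apply: S_le_trans (S_D h hB) => j; rewrite -mulrDr ler_wpM2l ?nm_ge0//.
rewrite (fourier_parts _ aM aN sE pE); apply: le_trans (nmB _ _) _.
by rewrite addrC lerD2l !nmM nmI mul1r nm_intr.
Qed.

(* Here y is the modulus of the gauged initial datum: its rough part decays like
   [jw (s + 3 / 4)], slower than the [jw (s + 1)] forced by the evolution. *)
Lemma no_decay (d g B s : R) (y : int -> R) : d != 0 -> 0 < g ->
  (forall k, 0 < d * k%:~R -> y k * nk k <= B * jw s k) ->
  ~ (exists G, forall k, g * jw (s + 3 / 4) k <= y k + G * jw (s + 2) k).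
Proof.
move=> d0 g0 yB [G yG].
have [k [kP k0 kbig]] : exists k, [/\ 0 < d * k%:~R, 1 <= nk k :> R &
    (2 * (`|B| + `|G|) / g) ^+ 4 < nk k].
  pose n := (Num.truncn ((2 * (`|B| + `|G|) / g) ^+ 4)).+1.
  have nb : (2 * (`|B| + `|G|) / g) ^+ 4 < n%:R by exact: truncnS_gt.
  have n1 : 1 <= (n%:R : R) by rewrite ler1n.
  have n0 : 0 < (n%:R : R) by apply: lt_le_trans n1.
  have [dn|dn|dz] := ltgtP d 0; last by rewrite dz eqxx in d0.
    exists (- n%:Z); rewrite /nk rmorphN /= -pmulrn normrN normr_nat; split => //.
    by rewrite mulrN -mulNr mulr_gt0// oppr_gt0.
  by exists n%:Z; rewrite /nk -pmulrn normr_nat; split => //; rewrite mulr_gt0.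
have h := yB _ kP; have := yG k.
have jk := jp_gt0 (R := R) k; have j0 := jw_gt0 s k.
have e2 : jw 2 k = (jp k)^-1 * (jp k)^-1 :> R by rewrite -!jw1 -jwD.
rewrite (jwD s (3 / 4)) (jwD s 2) e2; set J := jw (3 / 4) k.
have jk2 : nk k <= jp k :> R by rewrite /jp lerDr.
have jkn : jp k <= 2 * nk k :> R by rewrite /jp; lra.
have J0 : 0 < J by exact: jw_gt0.
move=> hg; have n0 : 0 < nk k :> R by apply: lt_le_trans k0.
have key : g * J * nk k <= `|B| + `|G|.
  have h3 : (g * J * nk k) * jw s k <= (`|B| + `|G|) * jw s k.
    have := ler_wpM2r (ltW n0) hg; rewrite mulrDl => h1.
    rewrite (_ : g * J * nk k * jw s k = g * (jw s k * J) * nk k); last by ring.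
    apply: (le_trans h1); rewrite mulrDl; apply: lerD.
      by apply: (le_trans h); rewrite ler_wpM2r ?ler_norm// ltW.
    rewrite (_ : G * _ * _ = G * (nk k / jp k / jp k) * jw s k); last by ring.
    rewrite ler_wpM2r ?(ltW j0)//; apply: le_trans (ler_norm _) _.
    rewrite normrM ler_piMr// ger0_norm; last by rewrite !divr_ge0 ?(ltW n0) ?(ltW jk).
    rewrite !ler_pdivrMr// mul1r; have := @jp_ge1 R k; nra.
  by move: h3; rewrite ler_pM2r.
have q4 : (J * jp k) ^+ 4 = jp k.
  have -> : J * jp k = jp k `^ 4^-1.
    rewrite /J /jw -{2}[jp k](powRr1 (ltW jk)) -powRD ?(gt_eqF jk) ?implybT//.
    by congr (_ `^ _); field.
  by rewrite -powR_mulrn ?powR_ge0// -powRrM mulVf ?powRr1 ?(ltW jk).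
have key2 : J * jp k <= 2 * (`|B| + `|G|) / g.
  rewrite ler_pdivlMr//; have : J * jp k * g <= J * (2 * nk k) * g.
    by rewrite ler_wpM2r ?(ltW g0)// ler_wpM2l// ltW.
  lra.
have := lt_le_trans kbig jk2; rewrite -q4 ltNge => /negP; apply.
have l0 : 0 <= J * jp k by rewrite mulr_ge0 ?(ltW J0) ?(ltW jk).
by rewrite ler_pXn2r ?nnegrE// (le_trans l0 key2).
Qed.
End CoreBounds.

Section Core.
Context {R : realType}.
Local Notation TT := (@TT R).
Implicit Types (f g : R -> R[i]) (t tau M N A B : R) (a : int -> R[i]) (k j : int).

Lemma nonexistence (b : bool) (s T e Mp Mq g G : R) (u0 v0 P Q E : R -> R[i]) (c : R[i]) w :
  3 / 2 < s -> 0 < T -> integC TT u0 -> integC TT v0 ->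
  smooth P -> periodicT P -> smooth Q -> periodicT Q -> smooth E -> periodicT E ->
  (forall x, derivC E x = 'i%C / 2 * (P x * Q x - c) * E x) -> complex.Im c != 0 ->
  Sle (nf (fourier P)) Mp -> Sle (nf (fourier Q)) Mq -> 0 < e ->
  24 * 2 `^ s * (2 * e * (Mq + e) + e * Mp) <= `|complex.Im c| ->
  Sle (nf (fun k => fourier u0 k - fourier P k)) e -> fourier v0 = fourier Q ->
  0 < g -> (forall k, g * jw (s + 3 / 4) k <=
     nm (fourier (fun x => u0 x * E x) k) + G * jw (s + 2) k) ->
  ~ solution s (otimes b T) (ocut b T) (- sg b) (u0, v0) w.
Proof.
move=> s32 T0 iu iv sP pP sQ pQ sE pE EE Imc hP hQ e0 eps_small hu hv g0 gG W.
have s0 : 0 <= s by lra.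
have hb (x y : R[i]) : nm ('i%C * x - c * y) <= nm x + nm c * nm y.
  by apply: le_trans (nmB _ _) _; rewrite !nmM nmI mul1r.
have arith (x y n B1 B2 D F j : R) : x <= B2 * j -> n * y <= n * (B1 * j) -> 0 <= F * j ->
    x + n * y + D * j <= (F + (B2 + n * B1 + D)) * j.
  by move=> h1 h2 h3; lra.
have le_sum4 (x y z u : R) : 0 <= x -> 0 <= y -> 0 <= z -> 0 <= u ->
    [/\ x <= x + y + z + u, y <= x + y + z + u & z <= x + y + z + u].
  by move=> *; split; lra.
have lt_half (x y z : R) : 2 * x <= y -> 0 < y -> z <= x -> z < y by lra.
have [p [q [hp hq p0 q0 ev]]] := evolution s32 T0 (w0 := (u0, v0)) iu iv W.
rewrite /= in p0 q0.
have [A1 A10 n1] := small_time s32 hp e0; have [A2 A20 n2] := small_time s32 hq e0.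
have [T1 [T10 T1T nT]] : exists T1, [/\ 0 < T1, T1 <= T & forall t, 0 <= t <= T1 ->
   [/\ forall k, nf (p t) k <= A1 * jw s k, Sle (fun k => jp k * nm (p t k)) A1 &
       Sle (nf (fun k => p t k - p 0 k)) e] /\
   [/\ forall k, nf (q t) k <= A2 * jw s k, Sle (fun k => jp k * nm (q t k)) A2 &
       Sle (nf (fun k => q t k - q 0 k)) e]].
  have [d /= d0 dP] : nbhs (0 : R) _ := filterI n1 n2.
  exists (Num.min T (d / 2)); split.
  - by rewrite lt_min T0 divr_gt0.
  - by rewrite ge_min lexx.
  - move=> t /andP[t0]; rewrite le_min => /andP[_ td]; apply: dP.
    by rewrite /= sub0r normrN ger0_norm//; lra.
have sE1 := smooth_derivC sE; have sE2 := smooth_derivC sE1.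
have pE1 := periodic_derivC sE pE; have pE2 := periodic_derivC sE1 pE1.
have cE := smooth_contC sE; have cE1 := smooth_contC sE1.
pose A := A1 + A2; have AA : 0 <= A by exact: addr_ge0.
have j0 k := ltW (jw_gt0 s k).
have Ap t : 0 <= t <= T1 -> [/\ forall k, nf (p t) k <= A * jw s k,
    Sle (nf (p t)) A & Sle (nf (der (p t))) A].
  move=> /nT[[h1 h2 _] _]; split=> [k||].
  - by apply: le_trans (h1 k) _; rewrite ler_wpM2r// lerDl.
  - by apply: le_trans (Sle_nf h2) _; rewrite lee_fin lerDl.
  - by apply: le_trans (Sle_der h2) _; rewrite lee_fin lerDl.
have [C0 C00 hC0] := smooth_mul s0 AA sE pE.
have [C1 C10 hC1] := smooth_mul s0 AA sE1 pE1.
have [C2 C20 hC2] := smooth_mul s0 AA sE2 pE2.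
have [C3 C30 hC3] := delta_bound e s0 AA sP pP sQ pQ hP hQ.
have [ME hME] := smooth_summable sE pE; have ME0 := S_bound_ge0 hME.
pose eps := 2 * e * (Mq + e) + e * Mp.
pose wk k t := intT (fun x => fsum (p t) x * (E x * ek (- k) x)).
have wkE k t : wk k t = fourier (fun x => fsum (p t) x * E x) k.
  by rewrite fourierE; apply: eq_intT => x; rewrite mulrA.
pose del t x := fsum (p t) x * fsum (q t) x - P x * Q x.
pose Hk k t := sg b * ('i%C * fourier (fun x => fsum (p t) x * derivC (derivC E) x) k
   - c * fourier (fun x => fsum (p t) x * derivC E x) k
   + fourier (fun x => del t x * (fsum (der (p t)) x * E x)) k).
pose lam k := sg b * ('i%C * (k%:~R ^+ 2 + c * k%:~R)).
pose dd : R := (if b then 1 else -1) * complex.Im c.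
have dd0 : dd != 0 by rewrite /dd mulf_neq0//; case: (b); rewrite ?oppr_eq0 oner_eq0.
pose PP : pred int := fun k => 0 < dd * k%:~R.
have ddn : `|dd| = `|complex.Im c|.
  by rewrite /dd normrM; case: (b); rewrite ?normrN normr1 mul1r.
have ap := hcurve_acurve s32 hp; have aq := hcurve_acurve s32 hq.
have up := ucurve_fsum ap; have uq := ucurve_fsum aq.
have sphi k : smooth (fun x => E x * ek (- k) x) by apply: smoothM => //; exact: smooth_ek.
have pphi k : periodicT (fun x => E x * ek (- k) x) by apply: periodicM => //; exact: periodic_ek.
have hdel t : 0 <= t <= T1 -> (forall k, nm (fourier (del t) k) <= C3 * jw s k) /\
    Sle (nf (fourier (del t))) eps.
  move=> tT; have [h1 h2 h3] := Ap t tT; have [[_ _ k3] [l1 l2 l3]] := nT t tT.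
  apply: (hC3 (p t) (q t) h1 _ h2).
  - by move=> k; apply: le_trans (l1 k) _; rewrite ler_wpM2r// lerDr.
  - rewrite (_ : 2 * e = e + e); last by ring.
    apply: S_le_trans (S_D k3 hu) => k; rewrite /nf p0.
    by apply: le_trans (nmD _ _); rewrite addrA subrK.
  - by rewrite -hv -q0.
pose K := C0 + C3 + (A * ME + C1) + (C2 + nm c * C1 + 2 `^ s * (C3 + C1) * (eps + (C3 + C1))).
have [Mp0 Mq0] := (S_bound_ge0 hP, S_bound_ge0 hQ).
have eps0 : 0 <= eps by rewrite /eps !addr_ge0 ?mulr_ge0 ?addr_ge0 ?(ltW e0).
have K1 : 0 <= A * ME + C1 by rewrite addr_ge0 ?mulr_ge0.
have K2 : 0 <= C2 + nm c * C1 + 2 `^ s * (C3 + C1) * (eps + (C3 + C1)).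
  have n0 := nm_ge0 c; have r0 : 0 <= 2 `^ s :> R := powR_ge0 _ _.
  by repeat first [assumption|apply: addr_ge0|apply: mulr_ge0].
have [C0K C3K AK] := le_sum4 _ _ _ _ C00 C30 K1 K2; rewrite -/K in C0K C3K AK.
have jK k (x y : R) : 0 <= y -> x <= y * jw s k -> y <= K -> x <= K * jw s k.
  by move=> y0 xy yK; apply: le_trans xy _; rewrite ler_wpM2r.
have nsg : nm (sg b : R[i]) = 1 by rewrite /sg; case: (b); rewrite ?nmN -[1](rmorph1 (real_complex R)) nmR normr1.
have [B hB] : exists B, forall k, PP k -> nm (wk k 0) * nk k <= B * jw s k.
  apply: (@seq_decay R s T1 `|complex.Im c| K eps PP wk Hk lam
     (fun t j => nm (fourier (del t) j)) s0 T10 _ eps_small).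
  - by rewrite normr_gt0.
  - by move=> k; apply: contraTneq => ->; rewrite /PP mulr0 ltxx.
  - move=> k j; rewrite /PP => kP kj; rewrite rmorphB /= mulrBr subr_gt0.
    have h1 : 2 * (`|dd| * nk j) <= `|dd| * nk k by rewrite mulrCA ler_wpM2l.
    have h2 : `|dd| * nk k = dd * k%:~R by rewrite /nk -normrM gtr0_norm.
    have h3 : dd * j%:~R <= `|dd| * nk j by rewrite /nk -normrM ler_norm.
    by rewrite h2 in h1; exact: lt_half h1 kP h3.
  - move=> k kP; rewrite -ddn /nk -normrM gtr0_norm// /lam /dd.
    rewrite -[k%:~R](rmorph_int (real_complex R)) /sg.
    by case: (b) => /=; rewrite !(ReM, ImM, ReD, ImD, ReN, ImN) /=; ring.
  - by move=> k; apply: contC_intT => //; exact: smooth_contC.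
  - move=> k kP t /andP[t0 tT]; have tT' : 0 < t < T by rewrite t0 (lt_le_trans tT).
    have [M hM] := ap.1 t; have [N hN] := aq.1 t.
    have := ev _ (sphi k) (pphi k) t tT'.
    have cPQ : contC (fun x => P x * Q x) by apply: contCM; exact: smooth_contC.
    rewrite (fourier_gauge k (Sle_nf hM) (Sle_der hM) (contC_fsum (Sle_nf hN)) cPQ sE pE EE).
    by rewrite -wkE mulrDr mulrA.
  - move=> k t tT; have [h1 h2 _] := Ap t tT; have [h3 _] := hC0 _ h1 h2.
    by rewrite wkE; exact: jK C00 (h3 k) C0K.
  - by move=> t j; exact: nm_ge0.
  - by move=> t j tT; have [h1 _] := hdel t tT; exact: jK C30 (h1 j) C3K.
  - by move=> t /hdel[].
  - move=> t tT; have [h1 h2 h3] := Ap t tT; have [_ h4] := hC1 _ h1 h2.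
    have h5 := S_prod h3 cE hME.
    apply: S_le_trans (S_le_trans (fun k => lexx _) (le_trans (S_D h5 h4) _)).
      move=> k; rewrite wkE -nm_intr -[X in X * _]mul1r -nmI -!nmM.
      rewrite /nf (fourier_parts k h2 h3 sE pE).
      by apply: le_trans (nmD _ _); rewrite subrK.
    by rewrite lee_fin.
  - move=> k t B kP tT hB; have [h1 h2 h3] := Ap t tT.
    have [a1 a2] := hC1 _ h1 h2; have [b1 _] := hC2 _ h1 h2; have [d1 d2] := hdel t tT.
    have cd : contC (del t).
      have [cp _ _] := up; have [cq _ _] := uq.
      by apply: contCB; apply: contCM => //; exact: smooth_contC.
    have C31 : 0 <= C3 + C1 by exact: addr_ge0.
    have hr : nm (fourier (fun x => del t x * (fsum (der (p t)) x * E x)) k) <=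
        2 `^ s * (C3 + C1) * (eps + (C3 + C1)) * jw s k + B.
      apply: (@remainder_bound _ s eps (C3 + C1) E (del t) (p t) A A B k s0 C31 sE pE cd h2 h3 _ d2).
      + by move=> j; apply: le_trans (d1 j) _; rewrite ler_wpM2r// lerDl.
      + by move=> j; apply: le_trans (a1 j) _; rewrite ler_wpM2r// lerDr.
      + by apply: le_trans a2 _; rewrite lee_fin lerDr.
      + by apply: S_le_trans hB => j; rewrite wkE.
    rewrite /Hk nmM nsg mul1r; apply: le_trans (nmD _ _) _.
    apply: le_trans (lerD (hb _ _) hr) _.
    have h5 := b1 k; have h6 := ler_wpM2l (nm_ge0 c) (a1 k).
    rewrite addrA lerD2r /K.
    have h7 : 0 <= (C0 + C3 + (A * ME + C1)) * jw s k by apply: mulr_ge0 => //; apply: addr_ge0 => //; exact: addr_ge0.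
    exact: arith h5 h6 h7.
have ae0 : fourier (fun x => u0 x * E x) = fun k => wk k 0.
  have [M hM] := ap.1 0; have hM' := Sle_nf hM; rewrite p0 in hM'.
  apply/funext => k; rewrite wkE p0; apply: fourier_ae.
  - by apply: measCM; [exact: integC_measC|exact: contC_measC (@mTT R) cE].
  - exact: contC_measC (@mTT R) (contCM (contC_fsum hM') cE).
  - by apply: aeS (fsum_fourier_ae iu hM') => x h xT; rewrite h.
rewrite ae0 in gG.
by apply: (@no_decay R dd g B s (fun k => nm (wk k 0)) dd0 g0 hB); exists G.
Qed.
End Core.

(** * Ill-posed data *)

Section Data.
Context {R : realType}.
Local Notation TT := (@TT R).
Implicit Types (f g : R -> R[i]) (s e T t tau M N A B : R) (a b : int -> R[i]) (k j : int).
Implicit Types (l : seq (R[i] * int)) (z : R[i]).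

Lemma tp_cons (p : R[i] * int) l x : tp (p :: l) x = p.1 * ek p.2 x + tp l x.
Proof. by rewrite /tp big_cons. Qed.

Lemma smooth_tp l : smooth (tp l).
Proof.
elim: l => [|p l IH].
  rewrite (_ : tp _ = fun=> 0); first exact: smooth_cst.
  by apply/funext => x; rewrite /tp big_nil.
rewrite (_ : tp _ = fun x => p.1 * ek p.2 x + tp l x); last by apply/funext => x; exact: tp_cons.
by apply: smoothD => //; apply: smoothM; [exact: smooth_cst|exact: smooth_ek].
Qed.

Lemma periodic_tp l : periodicT (tp l).
Proof. by move=> x; apply: eq_bigr => p _; rewrite periodic_ek. Qed.

Lemma eq_fourier f g k : f =1 g -> fourier f k = fourier g k.
Proof. by move=> /funext ->. Qed.

Lemma fourier_tp l k : fourier (tp l) k = \sum_(p <- l) p.1 * (p.2 == k)%:R.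
Proof.
elim: l => [|p l IH].
  rewrite big_nil -[RHS](mul0r (fourier (fun=> 0) k)) -fourierZ; last first.
    by apply: contC_TT; exact: contC_cst.
  apply: eq_fourier => x; rewrite /tp big_nil; exact/esym/mul0r.
rewrite big_cons -IH -fourier_ek -fourierZ; last by apply: contC_TT; exact: contC_ek.
rewrite -fourierD; first by apply: eq_fourier => x; exact: tp_cons.
  by apply: contC_TT; apply: contCM; [exact: contC_cst|exact: contC_ek].
by apply: contC_TT; apply: smooth_contC; exact: smooth_tp.
Qed.

Lemma is_derC_tp l x :
  is_derC (tp l) x (tp [seq ('i%C * p.2%:~R * p.1, p.2) | p <- l] x).
Proof.
elim: l => [|p l IH].
  rewrite (_ : tp [::] = fun=> 0); last by apply/funext => y; rewrite /tp big_nil.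
  exact: is_derC_cst.
rewrite (_ : tp (p :: l) = fun x => p.1 * ek p.2 x + tp l x); last by apply/funext => y; exact: tp_cons.
rewrite /= tp_cons /= -[X in X + _](_ : 0 * ek p.2 x + p.1 * ('i%C * p.2%:~R * ek p.2 x) = _); last by ring.
by apply: is_derCD => //; apply: is_derCM; [exact: is_derC_cst|exact: is_derC_ek].
Qed.

Lemma gauge_exists (PQ : R -> R[i]) : istp PQ -> exists E F : R -> R[i],
  [/\ smooth E, periodicT E, smooth F, periodicT F & (forall x, F x * E x = 1) /\
   forall x, derivC E x = 'i%C / 2 * (PQ x - fourier PQ 0) * E x].
Proof.
case=> l /funext ->.
pose L := tp [seq (p.1 / (2 * p.2%:~R), p.2) | p <- l & p.2 != 0].
have sL : smooth L := smooth_tp _; have pL : periodicT L := periodic_tp _.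
have sN : smooth (fun x => - L x).
  by under eq_fun do rewrite -mulN1r; apply: smoothM => //; exact: smooth_cst.
exists (fun x => cexp (L x)), (fun x => cexp (- L x)); split.
- exact: smooth_cexp.
- by move=> x; rewrite pL.
- exact: smooth_cexp.
- by move=> x; rewrite pL.
split=> x; first exact: cexpNK.
have := is_derC_cexp (is_derC_tp [seq (p.1 / (2 * p.2%:~R), p.2) | p <- l & p.2 != 0] x).
move/is_derC_val => ->; congr (_ * _).
rewrite -map_comp /tp big_map big_filter fourier_tp.
rewrite [X in X - _](bigID (fun p : R[i] * int => p.2 != 0)) /=.
have -> : \sum_(p <- l | ~~ (p.2 != 0)) p.1 * ek p.2 x = \sum_(p <- l) p.1 * (p.2 == 0)%:R.
  rewrite [RHS](bigID (fun p : R[i] * int => p.2 != 0)) /= [X in _ = X + _]big1 ?add0r.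
    by apply: eq_bigr => p; rewrite negbK => /eqP ->; rewrite eqxx ek0.
  by move=> p /negPf ->; rewrite mulr0.
rewrite addrK mulr_sumr; apply: eq_bigr => p p0.
have p1 : p.2%:~R != 0 :> R[i] by rewrite intr_eq0.
by field.
Qed.

Lemma S_single (x : R) : 0 <= x -> Sle (fun k => if k == 0 then x else 0) x.
Proof.
move=> x0; apply/S_leP => r ur; rewrite -big_mkcond /=.
have [r0|r0] := boolP (0 \in r); first by rewrite -big_filter (filter_pred1_uniq ur r0) big_seq1.
by rewrite big_seq_cond big1// => k /andP[kr /eqP k0]; rewrite k0 (negPf r0) in kr.
Qed.

Lemma hs_sub s a b : hs s (fun k => a k - b k) = hs s (fun k => b k - a k).
Proof. by apply/funext => k; rewrite /hs nmBC. Qed.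

Lemma hs_shift s a l z M : Sle (hs s (fun k => a k - fourier (tp l) k)) M ->
  Sle (hs s (fun k => a k - fourier (tp ((z, 0) :: l)) k)) (2 * M + 2 * nm z ^+ 2).
Proof.
move=> h; have h2 : Sle (hs s (fun k => if k == 0 then z else 0)) (nm z ^+ 2).
  apply: S_le_trans (S_single (sqr_ge0 (nm z))) => k; rewrite /hs.
  case: ifP => [/eqP ->|_]; last by rewrite nm0 expr0n mulr0.
  by rewrite /sw normr0 expr0n addr0 powR1 mul1r.
apply: S_le_trans (hsB h h2) => k; rewrite /hs.
rewrite (_ : a k - _ = a k - fourier (tp l) k - (if k == 0 then z else 0))//.
rewrite !fourier_tp big_cons /= eq_sym -addrA -opprD; congr (_ - _).
by rewrite addrC; case: ifP; rewrite ?mulr1 ?mulr0.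
Qed.

Lemma hs_approx s f e : Hs s f -> 0 < e ->
  exists l, Sle (hs s (fun k => fourier f k - fourier (tp l) k)) e.
Proof.
move=> hf e0; have [M hM] := Hs_bound hf.
have [r ur hr] := S_tail (hs_ge0 s (fourier f)) hM e0.
exists [seq (fourier f k, k) | k <- r]; apply: S_le_trans hr => k.
rewrite {1}/hs fourier_tp big_map /=.
have [kr|kr] := boolP (k \in r).
  rewrite /hs (bigD1_seq k)//= eqxx mulr1 big1 ?addr0 ?subrr ?nm0 ?expr0n ?mulr0//.
  by move=> j /negPf ->; rewrite mulr0.
rewrite /hs big_seq big1 ?subr0// => j jr.
by rewrite (_ : (j == k) = false) ?mulr0//; apply: contraNF kr => /eqP <-.
Qed.

Lemma approx_mean s f e : Hs s f -> 0 < e ->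
  exists2 l, Sle (hs s (fun k => fourier f k - fourier (tp l) k)) e & fourier (tp l) 0 != 0.
Proof.
move=> hf e0; have e4 : 0 < e / 4 by rewrite divr_gt0.
have [l hl] := hs_approx hf e4.
have [l0|l0] := eqVneq (fourier (tp l) 0) 0; last first.
  exists l => //; apply: le_trans hl _; rewrite lee_fin; lra.
pose x := Num.sqrt (e / 4); have x0 : 0 < x by rewrite sqrtr_gt0.
exists ((x%:C, 0) :: l); last first.
  by rewrite fourier_tp big_cons -fourier_tp l0 addr0 /= mulr1 -(rmorph0 (real_complex R)) (inj_eq (@complexI R)) gt_eqF.
have := hs_shift x%:C hl; rewrite nmR ger0_norm ?(ltW x0)// /x sqr_sqrtr ?(ltW e4)//.
by rewrite (_ : 2 * (e / 4) + 2 * (e / 4) = e); [exact|field].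
Qed.

(* Adding z to the second factor changes the mean of the product by z times the mean
   of the first one; a multiple of i times its conjugate moves the imaginary part. *)
Lemma approx_product s f e l : Hs s f -> 0 < e -> fourier (tp l) 0 != 0 ->
  exists2 m, Sle (hs s (fun k => fourier f k - fourier (tp m) k)) e &
    complex.Im (fourier (fun x => tp l x * tp m x) 0) != 0.
Proof.
move=> hf e0 l0; have e4 : 0 < e / 4 by rewrite divr_gt0.
have [m hm] := hs_approx hf e4.
have [m0|m0] := eqVneq (complex.Im (fourier (fun x => tp l x * tp m x) 0)) 0; last first.
  exists m => //; apply: le_trans hm _; rewrite lee_fin; lra.
set y := fourier (tp l) 0 in l0; have y0 := nm_gt0 l0.
pose x := Num.sqrt (e / 4); have x0 : 0 < x by rewrite sqrtr_gt0.
pose z := (x / nm y)%:C * ('i%C * (complex.Re y -i* complex.Im y)).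
have nz : nm z = x.
  rewrite nmM nmR nmM nmI mul1r ger0_norm ?divr_ge0 ?(ltW x0) ?nm_ge0//.
  have -> : nm (complex.Re y -i* complex.Im y) = nm y by rewrite !nmE /= sqrrN.
  by rewrite divfK// gt_eqF.
exists ((z, 0) :: m).
  have := hs_shift z hm; rewrite nz /x sqr_sqrtr ?(ltW e4)//.
  by rewrite (_ : 2 * (e / 4) + 2 * (e / 4) = e); [exact|field].
have cl := smooth_contC (smooth_tp l); have cm := smooth_contC (smooth_tp m).
rewrite (_ : fourier _ 0 = z * y + fourier (fun x => tp l x * tp m x) 0).
  rewrite ImD m0 addr0 (_ : z * y = 'i%C * ((x / nm y) * nm y ^+ 2)%:C).
    by rewrite ImM /= mul0r add0r mul1r mulf_neq0// ?mulf_neq0 ?invr_eq0 ?gt_eqF ?exprn_gt0.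
  rewrite nm_sqr /z; apply: complex_ext; rewrite !(ReM, ImM) /=; ring.
rewrite /y -fourierZ; last exact: contC_TT.
rewrite -fourierD; [|by apply: contC_TT; apply: contCM => //; exact: contC_cst|by apply: contC_TT; exact: contCM].
apply: eq_fourier => x'; rewrite tp_cons [_.1]/= [_.2]/= ek0.
by move: (tp l x') (tp m x') => x1 x2; ring.
Qed.

Lemma Hs_of_decay s f A : 0 <= s -> 0 <= A -> contC f -> periodicT f ->
  (forall k, nm (fourier f k) <= A * jw (s + 3 / 4) k) -> Hs s f.
Proof.
move=> s0 A0 cf pf fA; split; first exact: contC_L2T.
have [C C0 CP] := jw_H (R := R) s0.
exact: le_lt_trans (CP _ _ A0 fA) (ltry _).
Qed.
Lemma smooth_Hs s f : 0 <= s -> smooth f -> periodicT f -> Hs s f.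
Proof.
move=> s0 sf pf; have [C C0 CP] := smooth_decay (s + 3 / 4) sf pf.
exact: Hs_of_decay s0 C0 (smooth_contC sf) pf CP.
Qed.
End Data.

Section IllPosedData.
Context {R : realType}.
Local Notation TT := (@TT R).
Implicit Types (f g : R -> R[i]) (s e T t tau M N A B : R) (a b : int -> R[i]) (k j : int).

Lemma ill_posed_data s e (u0 v0 : R -> R[i]) : 3 / 2 < s -> Hs s u0 -> Hs s v0 -> 0 < e ->
  exists w0 : pairT R, [/\ Hs2 s w0, Hs2_dist s w0 (u0, v0) <= e &
    forall (b : bool) T w, 0 < T -> ~ solution s (otimes b T) (ocut b T) (- sg b) w0 w].
Proof.
move=> s32 hu hv e0; have s0 : 0 <= s by lra.
have s0' : 0 <= s + 3 / 4 by lra.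
have e2 : 0 < (e / 2) ^+ 2 by rewrite exprn_gt0 ?divr_gt0.
have e8 : 0 < (e / 2) ^+ 2 / 4 by rewrite divr_gt0.
have [l hl l0] := approx_mean hu e8; have [m hm Imc] := approx_product hv e2 l0.
pose P := tp l : R -> R[i]; pose Q := tp m : R -> R[i].
have sP : smooth P := smooth_tp l; have pP : periodicT P := periodic_tp l.
have sQ : smooth Q := smooth_tp m; have pQ : periodicT Q := periodic_tp m.
have [E [F [sE pE sF pF [FE EE]]]] : exists E F : R -> R[i],
  [/\ smooth E, periodicT E, smooth F, periodicT F & (forall x, F x * E x = 1) /\
   forall x, derivC E x = 'i%C / 2 * (P x * Q x - fourier (fun x => P x * Q x) 0) * E x].
  by apply: (@gauge_exists _ (fun x => P x * Q x)); apply: istpM; [exists l|exists m].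
set c := fourier (fun x => P x * Q x) 0 in EE.
have {}Imc : complex.Im c != 0 by [].
have [Mp hP] := smooth_summable sP pP; have [Mq hQ] := smooth_summable sQ pQ.
have [Mp0 Mq0] := (S_bound_ge0 hP, S_bound_ge0 hQ).
pose L := 2 * (Mq + 1) + Mp; have L0 : 0 < L by rewrite /L; lra.
have c2 : 0 < 2 `^ s :> R by rewrite powR_gt0.
have kap0 : 0 < `|complex.Im c| by rewrite normr_gt0.
pose eta := Num.min 1 (`|complex.Im c| / (24 * 2 `^ s * L)).
have D0 : 0 < 24 * 2 `^ s * L by rewrite !mulr_gt0.
have eta0 : 0 < eta by rewrite lt_min ltr01 divr_gt0.
have eta1 : eta <= 1 by rewrite ge_min lexx.
have etaL : 24 * 2 `^ s * (2 * eta * (Mq + eta) + eta * Mp) <= `|complex.Im c|.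
  have : eta * (24 * 2 `^ s * L) <= `|complex.Im c|.
    by rewrite -ler_pdivlMr// ge_min lexx orbT.
  apply: le_trans; rewrite [leRHS](_ : _ = 24 * 2 `^ s * (eta * L)); last by ring.
  apply: ler_wpM2l; first by rewrite mulr_ge0// ltW.
  have : eta * eta <= eta * 1 by rewrite ler_pM2l.
  by rewrite /L; lra.
pose r1 k : R[i] := (jw (s + 3 / 4) k)%:C.
have nr1 k : nm (r1 k) = jw (s + 3 / 4) k by rewrite nmR ger0_norm// ltW// jw_gt0.
have [C1 hC1] : exists C, Sle (nf r1) C.
  have [|C hC] := @S_jw R (s + 3 / 4); first by lra.
  by exists C; apply: S_le_trans hC => k; rewrite /nf nr1.
have cr1 := contC_fsum hC1.
pose A1 := 1 + C1; have C10 := S_bound_ge0 hC1.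
have A10 : 0 <= A1 by rewrite /A1; lra.
have [C2 C20 hC2] := smooth_mul s0' A10 sF pF.
have [k1 k2] : (forall k, nm (fourier (fun x => fsum r1 x * F x) k) <= C2 * jw (s + 3 / 4) k) /\
    Sle (nf (fourier (fun x => fsum r1 x * F x))) C2.
  apply: hC2 => [k|].
    rewrite /nf nr1 ler_peMl ?(ltW (jw_gt0 _ _))// /A1; lra.
  by apply: le_trans hC1 _; rewrite lee_fin /A1; lra.
have [CH CH0 hCH] := jw_H (R := R) s0.
pose gam := Num.min 1 (Num.min (eta / (C2 + 1)) ((e / 2) ^+ 2 / 4 / (C2 ^+ 2 * CH + 1))).
have C21 : 0 < C2 + 1 by rewrite ltr_wpDl.
have CH1 : 0 < C2 ^+ 2 * CH + 1 by rewrite ltr_wpDl ?mulr_ge0 ?sqr_ge0.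
have g0 : 0 < gam by rewrite !lt_min ltr01 !divr_gt0.
have g1 : gam <= 1 by rewrite ge_min lexx.
have g2 : gam * C2 <= eta.
  have : gam * (C2 + 1) <= eta by rewrite -ler_pdivlMr// /gam !ge_min lexx orbT.
  by apply: le_trans; rewrite ler_pM2l// lerDl.
have g3 : (gam * C2) ^+ 2 * CH <= (e / 2) ^+ 2 / 4.
  have : gam * (C2 ^+ 2 * CH + 1) <= (e / 2) ^+ 2 / 4.
    by rewrite -ler_pdivlMr// /gam !ge_min lexx !orbT.
  apply: le_trans; rewrite exprMn -mulrA; have h0 : 0 <= C2 ^+ 2 * CH by rewrite mulr_ge0 ?sqr_ge0.
  move: h0; set y := _ * CH => h0.
  rewrite mulrDr mulr1 expr2; apply: le_trans (_ : gam * y <= _).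
    by rewrite ler_wpM2r// ler_piMr// ltW.
  by rewrite lerDl ltW.
pose w1 x := fsum r1 x * F x.
pose u x := P x + gam%:C * w1 x.
have cF := smooth_contC sF; have cw1 : contC w1 by exact: contCM.
have cgw : contC (fun x => gam%:C * w1 x) by apply: contCM => //; exact: contC_cst.
have cP := smooth_contC sP; have cQ := smooth_contC sQ; have cE := smooth_contC sE.
have cu : contC u by exact: contCD.
have fu k : fourier u k = fourier P k + gam%:C * fourier w1 k.
  by rewrite fourierD ?fourierZ//; exact: contC_TT.
have pu : periodicT u by move=> x; rewrite /u /w1 pP pF periodic_fsum.
have ngw k : nm (gam%:C * fourier w1 k) <= gam * C2 * jw (s + 3 / 4) k.
  by rewrite nmM nmR ger0_norm ?(ltW g0)// -mulrA ler_pM2l// k1.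
have Hu : Hs s u.
  have [CP CP0 dP] := smooth_decay (s + 3 / 4) sP pP.
  apply: (@Hs_of_decay _ s u (CP + gam * C2)) => // [|k]; first by rewrite addr_ge0// mulr_ge0// ltW.
  by rewrite fu mulrDl; apply: le_trans (nmD _ _) _; apply: lerD.
have Hv : Hs s Q by exact: smooth_Hs.
exists (u, Q); split; first exact: (conj Hu Hv).
- have e20 : 0 <= e / 2 by rewrite divr_ge0// ltW.
  have du : Hs_norm s (u \- u0) <= e / 2.
    apply: (Hs_dist_le Hu hu e20); rewrite hs_sub.
    have gw0 : 0 <= gam * C2 by rewrite mulr_ge0// ltW.
    have h := hsB hl (hCH _ _ gw0 ngw).
    apply: le_trans (le_S _ (b := hs s _)) (le_trans h _).
      by move=> k; rewrite /hs fu opprD addrA.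
    by rewrite lee_fin; move: g3; set X := _ * CH; set Y := (e / 2) ^+ 2; lra.
  have dv : Hs_norm s (Q \- v0) <= e / 2 by apply: (Hs_dist_le Hv hv e20); rewrite hs_sub.
  have -> : e = e / 2 + e / 2 by field.
  exact: (lerD du dv).
move=> b T w T0; have [G G0 hG] := smooth_decay (s + 2) (smoothM sP sE) (periodicM pP pE).
apply: (@nonexistence _ b s T eta Mp Mq gam G u Q P Q E c w s32 T0 (Hs_integC Hu)
  (Hs_integC Hv) sP pP sQ pQ sE pE EE Imc hP hQ eta0 etaL _ erefl g0).
- apply: S_le_trans (le_trans (S_Z (ltW g0) k2) _); last by rewrite lee_fin.
  move=> k; rewrite /nf fu [_ + _ * _]addrC addrK nmM nmR ger0_norm ?(ltW g0)//.
- move=> k; apply: (@le_trans _ _ (nm (fourier (fun x => u x * E x) k) +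
     nm (fourier (fun x => P x * E x) k))); last by rewrite lerD2l.
  have -> : gam * jw (s + 3 / 4) k = nm (gam%:C * r1 k).
    by rewrite nmM nmR nr1 ger0_norm// ltW.
  have -> : gam%:C * r1 k =
     fourier (fun x => u x * E x) k - fourier (fun x => P x * E x) k.
    rewrite -fourierB; try by apply: contC_TT; exact: contCM.
    rewrite -(fourier_fsum k hC1) -fourierZ; last exact: contC_TT.
    apply: eq_fourier => x; rewrite /u /w1 -[LHS]mulr1 -(FE x).
    by move: (fsum r1 x) (F x) (E x) (P x) => x1 x2 x3 x4; ring.
  exact: nmB.
Qed.
End IllPosedData.

Theorem theorem1p2 (R : realType) (s : R) (hs : 3 / 2 < s)
    (u0 v0 : R -> R[i]) (hu0 : Hs s u0) (hv0 : Hs s v0) :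
  (forall T : R, 0 < T ->
     ~ flow_map_continuous_at s `[0, T] (forward_solution s T) (u0, v0)
     /\ ~ flow_map_continuous_at s `[- T, 0] (backward_solution s T) (u0, v0))
  /\
  (exists u0n v0n : nat -> R -> R[i],
     [/\ forall n, Hs s (u0n n) /\ Hs s (v0n n),
         Hs2_dist s (u0n n, v0n n) (u0, v0) @[n --> \oo] --> (0 : R) &
         forall (n : nat) (T : R), 0 < T ->
           ~ (exists u v : R -> R -> R[i],
                forward_solution s T (u0n n, v0n n) (fun t => (u t, v t)))
           /\
           ~ (exists u v : R -> R -> R[i],
                backward_solution s T (u0n n, v0n n) (fun t => (u t, v t)))]).
Proof.
have data e (e0 : 0 < e) := ill_posed_data hs hu0 hv0 e0.
have fwd T w0 w (H : forall b T w, 0 < T ->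
    ~ solution s (otimes b T) (ocut b T) (- sg b) w0 w) :
    0 < T -> ~ forward_solution s T w0 w by move=> T0; exact: (H false T w T0).
have bwd T w0 w (H : forall b T w, 0 < T ->
    ~ solution s (otimes b T) (ocut b T) (- sg b) w0 w) :
    0 < T -> ~ backward_solution s T w0 w.
  by move=> T0; have := H true T w T0; rewrite /sg opprK.
split=> [T T0|].
  split=> -[Phi [[r r0 HPhi] _]]; have [|w0 [h1 h2 h3]] := data (r / 2); rewrite ?divr_gt0//.
    by apply: (fwd T w0 (Phi w0) h3 T0); apply: HPhi => //; apply: le_lt_trans h2 _; lra.
  by apply: (bwd T w0 (Phi w0) h3 T0); apply: HPhi => //; apply: le_lt_trans h2 _; lra.
have /choice[f fP] : forall n : nat, exists w0 : pairT R, [/\ Hs2 s w0,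
    Hs2_dist s w0 (u0, v0) <= n.+1%:R^-1 &
    forall b T w, 0 < T -> ~ solution s (otimes b T) (ocut b T) (- sg b) w0 w].
  by move=> n; apply: data; rewrite invr_gt0 ltr0n.
exists (fun n => (f n).1), (fun n => (f n).2); split.
- by move=> n; have [[h1 h2] _ _] := fP n.
- have h0 : (fun n : nat => (n.+1%:R^-1 : R)) @ \oo --> (0 : R) by exact: cvg_harmonic.
  apply: (squeeze_cvgr _ (cvg_cst 0) h0); apply: nearW => n.
  have [_ h _] := fP n; rewrite -surjective_pairing h andbT.
  by rewrite addr_ge0 ?sqrtr_ge0.
- move=> n T T0; have [_ _ h] := fP n; rewrite -surjective_pairing.
  by split=> -[u [v uv]]; [exact: (fwd T (f n) _ h T0 uv)|exact: (bwd T (f n) _ h T0 uv)].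
Qed.
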